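(* Let $f:\mathbb{R}^{m\times n}\to\mathbb{R}$ be a differentiable convex function and $t>0$, and consider the nuclear norm regularized problem $$\min_{Z\in\mathbb{R}^{m\times n},\ \|Z\|_*\le t/2}f(Z).$$ After at most $O\left(\frac1\varepsilon\right)$ many iterations (i.e. approximate eigenvalue computations), the algorithm ''Nuclear Norm Regularized Solver'' obtains a solution that is $\varepsilon$-close to the optimum of this problem, i.e. a feasible $Z$ with $f(Z)$ at most $\varepsilon$ above the optimal value. The algorithm requires a total of $\tilde O\left(\frac{N_f}{\varepsilon^{1.5}}\right)$ arithmetic operations (with high probability).
   Context: $\|Z\|_*$ is the nuclear norm (sum of singular values). $\mathbb{S}^{N\times N}$ denotes the symmetric real $N\times N$ matrices with Frobenius inner product $A\bullet B=\mathrm{Tr}(A^TB)$. Transformed function: writing $X\in\mathbb{S}^{(m+n)\times(m+n)}$ in blocks as $X=\begin{pmatrix}V&Z\\Z^T&W\end{pmatrix}$ with $V\in\mathbb{S}^{m\times m}$, $W\in\mathbb{S}^{n\times n}$, $Z\in\mathbb{R}^{m\times n}$, set $\hat f(X):=f(Z)$, and let $F(X):=\hat f(tX)$. Let $\mathcal{S}:=\{X\in\mathbb{S}^{(m+n)\times(m+n)} : X\succeq0,\ \mathrm{Tr}(X)=1\}$. Algorithm ''Nuclear Norm Regularized Solver'': run Hazan's algorithm for $F$ over $\mathcal{S}$, and output the upper right $m\times n$ block of $t X^{(k)}$. Hazan's algorithm: $X^{(0)}:=vv^T$ for an arbitrary unit vector $v$; for $k=0,1,2,\dots$, let $\alpha:=\frac{2}{k+2}$,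 compute $v:=\mathrm{ApproxEV}(\nabla F(X^{(k)}),\alpha C_F)$, and set $X^{(k+1)}:=X^{(k)}+\alpha(vv^T-X^{(k)})$. $\mathrm{ApproxEV}(A,\varepsilon')$ returns a unit vector $v$ with $v^TAv\le\lambda_{\min}(A)+\varepsilon'$; it is implemented by Lanczos' algorithm with a random start vector, applied to $-A$ with its spectrum shifted by a multiple of the identity so as to be positive semidefinite. Here $C_F$ is the curvature constant $$C_F:=\sup_{\substack{X,S\in\mathcal{S},\ \alpha\in(0,1],\\ Y=X+\alpha(S-X)}}\frac{1}{\alpha^2}\bigl(F(Y)-F(X)-(Y-X)\bullet\nabla F(X)\bigr),$$ assumed finite and positive. $N_f$ is the number of non-zero entries of the gradient $\nabla f$ (the number of matrix entries on which $f$ depends). Standing assumptions for the operation count: the spectral norms of the gradient matrices are bounded by a constant $L$ over the domain, one matrix-vector multiplication with the gradient matrix (one Lanczos step) costs $O(N_f)$, and the rank-one update of the relevant entries of $X$ costs $O(N_f)$. $O(\cdot)$ and $\tilde O(\cdot)$ hide constants depending on $C_F$ and $L$, and $\tilde O(\cdot)$ additionally suppresses factors logarithmic in $m+n$. ''With high probability'' is over the random start vectors. *)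

(* Defs.v *)
From HB Require Import structures.
From mathcomp Require Import all_boot all_order all_algebra.
From mathcomp Require Import polyrcf.
From mathcomp Require Import all_classical all_reals all_analysis.
Set Implicit Arguments.
Unset Strict Implicit.
Unset Printing Implicit Defensive.
Import Order.TTheory GRing.Theory Num.Theory.
Import numFieldNormedType.Exports.
Local Open Scope classical_set_scope.
Local Open Scope ring_scope.

(* MathComp / MathComp-Analysis, over an arbitrary realType. *)

Section LinearAlgebra.
Context {R : realType}.

Definition dot N (u v : 'cV[R]_N) : R := (u^T *m v) 0 0.

(* The Euclidean norm; the library norm `|v| on matrices is the sup norm. *)
Definition enorm N (v : 'cV[R]_N) : R := Num.sqrt (dot v v).

Definition frob N (A B : 'M[R]_N) : R := \tr (A^T *m B).

Definition quad N (A : 'M[R]_N) (v : 'cV[R]_N) : R := dot v (A *m v).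

Definition psd N (A : 'M[R]_N) : Prop :=
  A^T = A /\ forall v : 'cV[R]_N, 0 <= quad A v.

Definition lambda_min N (A : 'M[R]_N) : R := inf [set a | eigenvalue A a].
Definition lambda_max N (A : 'M[R]_N) : R := sup [set a | eigenvalue A a].

Definition spectral_norm N (A : 'M[R]_N) : R :=
  sup [set enorm (A *m v) | v in [set v : 'cV[R]_N | enorm v = 1]].

(* The singular values of Z are the square roots of the eigenvalues of Z^T Z,
   each repeated according to its multiplicity as a root of the characteristic
   polynomial. *)
Definition nuclear_norm m n (Z : 'M[R]_(m, n)) : R :=
  let p := char_poly (Z^T *m Z) in
  \sum_(x <- rootsR p) (Num.sqrt x *+ mup x p).

End LinearAlgebra.

Section Optimization.
Context {R : realType}.

Definition grad m n (f : 'M[R]_(m, n) -> R) (Z : 'M[R]_(m, n)) : 'M[R]_(m, n) :=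
  \matrix_(i, j) 'D_(delta_mx i j) f Z.

(* Gradient on the space of symmetric matrices with the Frobenius inner product:
   the symmetric G with 'D_D F X = frob G D for every symmetric D. Its (i, j)
   entry is frob G D at the symmetric direction D = (E_ij + E_ji) / 2. *)
Definition symgrad N (F : 'M[R]_N -> R) (X : 'M[R]_N) : 'M[R]_N :=
  \matrix_(i, j) 'D_(2%:R^-1 *: (delta_mx i j + delta_mx j i)) F X.

Definition spectahedron N : set 'M[R]_N := [set X | psd X /\ \tr X = 1].

(* Extended-real valued, so that the curvature of F may be infinite. *)
Definition curvature N (F : 'M[R]_N -> R) : \bar R :=
  ereal_sup [set c | exists (X S : 'M[R]_N) (al : R),
    [/\ spectahedron X, spectahedron S, 0 < al <= 1 &
        let Y := X + al *: (S - X) in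
        c = ((al ^+ 2)^-1 * (F Y - F X - frob (Y - X) (symgrad F X)))%:E]].

(* F(X) = f(t Z), Z the upper right block of X. Only the values on symmetric
   matrices are used. *)
Definition transformed m n (f : 'M[R]_(m, n) -> R) (t : R)
    (X : 'M[R]_(m + n)) : R := f (ursubmx (t *: X)).

Definition feasible m n (t : R) : set 'M[R]_(m, n) :=
  [set Z | nuclear_norm Z <= t / 2%:R].

Definition opt_value m n (f : 'M[R]_(m, n) -> R) (t : R) : R :=
  inf (f @` feasible t).

Definition eps_optimal m n (f : 'M[R]_(m, n) -> R) (t eps : R)
    (Z : 'M[R]_(m, n)) : Prop :=
  feasible t Z /\ f Z <= opt_value f t + eps.

(* C is the (finite) curvature constant of F; L bounds the spectral norm of
   the matrices handed to the eigenvector routine. *)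
Definition problem m n (f : 'M[R]_(m, n) -> R) (t C L : R) : Prop :=
  [/\ 0 < t,
      forall Z, differentiable f Z,
      convex_function [set: 'M[R]_(m, n)] f,
      curvature (transformed f t) = C%:E &
      forall X : 'M[R]_(m + n), spectahedron X ->
        spectral_norm (symgrad (transformed f t) X) <= L].

(* N_f *)
Definition num_entries m n (f : 'M[R]_(m, n) -> R) : nat :=
  #|[set ij : 'I_m * 'I_n |
      `[< exists Z, grad f Z ij.1 ij.2 != 0 >]]%SET|.

End Optimization.

Section Algorithm.
Context {R : realType}.

Definition stepsize (k : nat) : R := 2%:R / k.+2%:R.

Definition approxEV_spec N (A : 'M[R]_N) (e : R) (v : 'cV[R]_N) : Prop :=
  enorm v = 1 /\ quad A v <= lambda_min A + e.

(* An eigenvector routine: [ev k A e] is the vector returned by the call made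
   at iteration k with matrix A and accuracy e. The index k lets a randomized
   routine draw fresh randomness at each call. *)
Definition ev_routine N := nat -> 'M[R]_N -> R -> 'cV[R]_N.

Fixpoint hazan N (F : 'M[R]_N -> R) (C : R) (ev : ev_routine N)
    (v0 : 'cV[R]_N) (k : nat) : 'M[R]_N :=
  if k is k'.+1 then
    let X := hazan F C ev v0 k' in
    let v := ev k' (symgrad F X) (stepsize k' * C) in
    X + stepsize k' *: (v *m v^T - X)
  else v0 *m v0^T.

Definition calls_succeed N (F : 'M[R]_N -> R) (C : R) (ev : ev_routine N)
    (v0 : 'cV[R]_N) (k : nat) : Prop :=
  forall j, (j < k)%N ->
    let A := symgrad F (hazan F C ev v0 j) in
    approxEV_spec A (stepsize j * C) (ev j A (stepsize j * C)).

Definition nnr_solver m n (f : 'M[R]_(m, n) -> R) (t C : R)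
    (ev : ev_routine (m + n)) (v0 : 'cV[R]_(m + n)) (k : nat) : 'M[R]_(m, n) :=
  ursubmx (t *: hazan (transformed f t) C ev v0 k).

(* The least natural number greater than c / eps, hence at most c / eps + 1. *)
Definition iterations (c eps : R) : nat := (Num.truncn (c / eps)).+1.

End Algorithm.

Section Lanczos.
Context {R : realType}.
Variables (N : nat) (M : 'M[R]_N) (b : 'cV[R]_N).

(* The state after j steps is (q_{j-1}, beta_j, q_j), where
     beta_{j+1} q_{j+1} = M q_j - alpha_j q_j - beta_j q_{j-1},
     alpha_j = <q_j, M q_j>,  |q_{j+1}| = 1.
   At breakdown the right-hand side vanishes; since 0^-1 = 0, all the later q_j
   are then 0. *)
Definition lanczos_next (st : 'cV[R]_N * R * 'cV[R]_N) :=
  let: (q0, beta, q) := st in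
  let r := M *m q - quad M q *: q - beta *: q0 in
  (q, enorm r, (enorm r)^-1 *: r).

Definition lanczos_state (j : nat) := iter j lanczos_next (0, 0, b).
Definition lanczos_vec (j : nat) : 'cV[R]_N := (lanczos_state j).2.
Definition lanczos_beta (j : nat) : R := (lanczos_state j).1.2.
Definition lanczos_alpha (j : nat) : R := quad M (lanczos_vec j).

(* The number of steps performed out of s, allowing for breakdown. *)
Definition lanczos_dim (s : nat) : nat :=
  (\sum_(j < s) (lanczos_vec j != 0%R))%N.

Definition lanczos_tridiag (d : nat) : 'M[R]_d :=
  \matrix_(i, j)
    (if i == j then lanczos_alpha i
     else if j == i.+1 :> nat then lanczos_beta j
     else if i == j.+1 :> nat then lanczos_beta i
     else 0).

Definition lanczos_basis (d : nat) : 'M[R]_(N, d) :=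
  \matrix_(i, j) lanczos_vec j i 0.

Definition lanczos_output (s : nat) (v : 'cV[R]_N) : Prop :=
  let d := lanczos_dim s in
  let T := lanczos_tridiag d in
  exists y : 'cV[R]_d,
    [/\ enorm y = 1, T *m y = lambda_max T *: y & v = lanczos_basis d *m y].

(* The Ritz vector for the largest Ritz value after s steps, which is unique up
   to sign. *)
Definition lanczos (s : nat) : 'cV[R]_N := xget 0 [set v | lanczos_output s v].

End Lanczos.

Section RandomizedSolver.
Context {R : realType}.

Definition lanczos_ev N (L : R) (steps : nat -> R -> nat) (b : nat -> 'cV[R]_N) :
    ev_routine N :=
  fun k A e => lanczos (L%:M - A) (b k) (steps N e).

Definition borel N : set (set 'cV[R]_N) := <<s [set U | open U] >>.

(* Independent start vectors, each uniform on the unit sphere; the uniform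
   distribution is the unique probability distribution on the sphere that is
   invariant under all orthogonal transformations. *)
Definition random_starts N (d : measure_display) (T : measurableType d)
    (P : probability T R) (b : nat -> T -> 'cV[R]_N) : Prop :=
  [/\ forall k B, borel B -> measurable (b k @^-1` B),
      forall k w, enorm (b k w) = 1,
      forall k (Q : 'M[R]_N) B, Q^T *m Q = 1%:M -> borel B ->
        P [set w | B (Q *m b k w)] = P (b k @^-1` B) &
      forall (J : seq nat) (B : nat -> set 'cV[R]_N), uniq J ->
        (forall j, borel (B j)) ->
        P (\bigcap_(j in [set` J]) (b j @^-1` B j)) =
        (\prod_(j <- J) P (b j @^-1` B j))%E].

(* Operations of K iterations in dimension N: [cstep k j] is the cost of
   Lanczos step j of call k, [cupd 0] that of forming the relevant entries of
   the initial rank-one matrix, [cupd k.+1] that of the rank-one update of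
   iteration k. *)
Definition total_ops (N : nat) (C : R) (steps : nat -> R -> nat)
    (cstep : nat -> nat -> nat) (cupd : nat -> nat) (K : nat) : nat :=
  (cupd 0 + \sum_(k < K)
     (\sum_(j < steps N (stepsize k * C)%R) cstep k j + cupd k.+1))%N.

End RandomizedSolver.

(* Main.v *)
Require Import Defs.
From mathcomp Require Import all_boot all_order all_algebra.
From mathcomp Require Import polyrcf complex.
From mathcomp Require Import all_classical all_reals all_analysis.
From mathcomp Require Import measurable_realfun.
From mathcomp Require Import ring lra.
Set Implicit Arguments.
Unset Strict Implicit.
Unset Printing Implicit Defensive.
Import Order.TTheory GRing.Theory Num.Theory.
Import numFieldNormedType.Exports.
Local Open Scope classical_set_scope.
Local Open Scope ring_scope.

(** Why the theorem holds.

Iterations. A matrix [Z] satisfies [nuclear_norm Z <= t / 2] exactly when it is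
the upper right block of [t *: X] for some [X] in the spectahedron
([spectahedron_feasible], [psd_lift]), so that the problem is the minimization of
the convex function [F = transformed f t] over the spectahedron. The linear
function of the gradient is minimized there, up to the error of the eigenvector,
by the rank-one matrix of an approximate eigenvector. Together with convexity and
the curvature bound this gives the recursion
[h_(k+1) <= (1 - a) h_k + 2 a^2 C] with [a = 2 / (k + 2)] for the gap [h] to any
competitor ([hazan_step]), hence [h_k <= 8 C / (k + 2)] ([hazan_convergence]).

One call of the Lanczos routine. The Ritz vector maximizes the Rayleigh quotient
over the Krylov space, so it suffices to exhibit one good Krylov vector
([lanczos_approxEV]). It is [T_n (Y) b], where [Y] is an affine image of the
gradient [A] that maps the eigenvalues above [lambda_min A + e / 2] into
[[-1, 1]] and [lambda_min A] to [1 + e / (2 L)]: the Chebyshev polynomial [T_n]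
is bounded by 1 on the former and at least [(1 + sqrt (e / L))^n / 2] at the
latter ([cheb_filter], [cheb_growth]). Hence a degree of order
[sqrt (L / e) * log (L / (e eta))] suffices when the start vector has a component
of size [eta] along an eigenvector for [lambda_min A]
([cheb_degree_amplifies]). By averaging over a grid of directions, a rotation
invariant unit vector has a component below [1 / (2 M N)] along a given direction
with probability at most [1 / M] ([strip_prob]).

Dependence. The matrix of the [k]-th call depends on the earlier start vectors,
so the last bound is applied conditionally on them. The iterates are measurable
functions of the earlier start vectors: the sign of a Ritz vector is an arbitrary
choice, but its rank-one matrix is a limit of normalized matrix powers
([ritz_limit], [mx_measurable_lanczos]), and derivatives are limits of difference
quotients. Partitioning the range of the gradient into countably many cells
reduces the conditional bound to the independence of events, and success, up to
strictness, is continuous in the gradient, so that finer and finer partitions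
suffice ([failure_event]).

Operations. The [k]-th call may fail with probability [N^-a / (k + 3)^2], which
sums to at most [N^-a]. Its accuracy is [e = 2 C / (k + 2)], so it takes order
[sqrt k * (log N + log k)] steps; the number of steps is moreover capped by [N],
as the Krylov space is invariant after [N] steps ([krylov_cap]). The cap removes
[log k]: below [N^2] calls [log k <= 2 log N], and beyond them [N <= sqrt k]
([solver_steps_le]). Summing [sqrt k * log N] over the order of [1 / eps] calls
gives the exponent 3/2. *)

(** * Inner product and reflections *)

Section InnerProduct.
Context {R : realType}.
Implicit Types (N : nat).

Lemma dotE N (u v : 'cV[R]_N) : dot u v = \sum_i u i 0 * v i 0.
Proof. by rewrite /dot mxE; apply: eq_bigr => i _; rewrite mxE. Qed.

Lemma dotC N (u v : 'cV[R]_N) : dot u v = dot v u.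
Proof. by rewrite !dotE; apply: eq_bigr => i _; rewrite mulrC. Qed.

Lemma dotDl N (u v w : 'cV[R]_N) : dot (u + v) w = dot u w + dot v w.
Proof. by rewrite /dot linearD mulmxDl mxE. Qed.

Lemma dotZl N a (u v : 'cV[R]_N) : dot (a *: u) v = a * dot u v.
Proof. by rewrite /dot linearZ -scalemxAl mxE. Qed.

Lemma dotNl N (u v : 'cV[R]_N) : dot (- u) v = - dot u v.
Proof. by rewrite -scaleN1r dotZl mulN1r. Qed.

Lemma dotBl N (u v w : 'cV[R]_N) : dot (u - v) w = dot u w - dot v w.
Proof. by rewrite dotDl dotNl. Qed.

Lemma dotDr N (u v w : 'cV[R]_N) : dot w (u + v) = dot w u + dot w v.
Proof. by rewrite dotC dotDl !(dotC w). Qed.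

Lemma dotZr N a (u v : 'cV[R]_N) : dot v (a *: u) = a * dot v u.
Proof. by rewrite dotC dotZl dotC. Qed.

Lemma dotNr N (u v : 'cV[R]_N) : dot v (- u) = - dot v u.
Proof. by rewrite dotC dotNl dotC. Qed.

Lemma dotBr N (u v w : 'cV[R]_N) : dot w (u - v) = dot w u - dot w v.
Proof. by rewrite dotDr dotNr. Qed.

Lemma dot0l N (v : 'cV[R]_N) : dot 0 v = 0.
Proof. by rewrite -(scale0r 0) dotZl mul0r. Qed.

Lemma dot0r N (v : 'cV[R]_N) : dot v 0 = 0.
Proof. by rewrite dotC dot0l. Qed.

Lemma dot_mulmxr m n (A : 'M[R]_(m, n)) u v : dot u (A *m v) = dot (A^T *m u) v.
Proof. by rewrite /dot trmx_mul trmxK mulmxA. Qed.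

Lemma dot_mulmxl m n (A : 'M[R]_(m, n)) u v : dot (A *m u) v = dot u (A^T *m v).
Proof. by rewrite dot_mulmxr trmxK. Qed.

Lemma dotvv_ge0 N (v : 'cV[R]_N) : 0 <= dot v v.
Proof. by rewrite dotE sumr_ge0 // => i _; rewrite -expr2 sqr_ge0. Qed.

Lemma dotvv_eq0 N (v : 'cV[R]_N) : (dot v v == 0) = (v == 0).
Proof.
apply/idP/eqP => [|->]; last by rewrite dot0l.
rewrite dotE psumr_eq0; last by move=> i _; rewrite -expr2 sqr_ge0.
move=> /allP h; apply/matrixP => i j; rewrite (ord1 j) mxE.
have := h i (mem_index_enum _); rewrite /= mulf_eq0 orbb => /eqP //.
Qed.

Lemma enorm_ge0 N (v : 'cV[R]_N) : 0 <= enorm v.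
Proof. exact: sqrtr_ge0. Qed.

Lemma enorm_sqr N (v : 'cV[R]_N) : enorm v ^+ 2 = dot v v.
Proof. by rewrite sqr_sqrtr // dotvv_ge0. Qed.

Lemma enorm_eq0 N (v : 'cV[R]_N) : (enorm v == 0) = (v == 0).
Proof. by rewrite -(sqrf_eq0 (enorm v)) enorm_sqr dotvv_eq0. Qed.

Lemma enorm1E N (v : 'cV[R]_N) : enorm v = 1 <-> dot v v = 1.
Proof.
split=> h; first by rewrite -enorm_sqr h expr1n.
by rewrite /enorm h sqrtr1.
Qed.

Lemma enormZ N a (v : 'cV[R]_N) : enorm (a *: v) = `|a| * enorm v.
Proof.
rewrite /enorm dotZl dotZr mulrA -expr2 sqrtrM ?sqr_ge0 //.
by rewrite sqrtr_sqr.
Qed.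

Lemma enorm_normalize N (v : 'cV[R]_N) : v != 0 -> enorm ((enorm v)^-1 *: v) = 1.
Proof.
move=> v0; rewrite enormZ ger0_norm ?invr_ge0 ?enorm_ge0 //.
by rewrite mulVf // enorm_eq0.
Qed.

Lemma dot_delta N (v : 'cV[R]_N) i : dot (delta_mx i 0) v = v i 0.
Proof.
rewrite dotE (bigD1 i) //= mxE !eqxx mul1r big1 ?addr0 // => j ji.
by rewrite mxE (negPf ji) mul0r.
Qed.

Lemma mul_trmx_col N (u v : 'cV[R]_N) : u^T *m v = (dot u v)%:M.
Proof. by rewrite /dot -mx11_scalar. Qed.

Lemma outer_mul N (u v w : 'cV[R]_N) : u *m v^T *m w = dot v w *: u.
Proof. by rewrite -mulmxA mul_trmx_col mul_mx_scalar. Qed.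

Lemma tr_outer N (u v : 'cV[R]_N) : \tr (u *m v^T) = dot u v.
Proof. by rewrite mxtrace_mulC mul_trmx_col mxtrace_scalar dotC. Qed.

Lemma Cauchy_Schwarz N (u v : 'cV[R]_N) : dot u v ^+ 2 <= dot u u * dot v v.
Proof.
have [->|v0] := eqVneq v 0; first by rewrite !dot0r expr0n mulr0.
have vv : 0 < dot v v by rewrite lt_def dotvv_eq0 v0 dotvv_ge0.
have := dotvv_ge0 (dot v v *: u - dot u v *: v).
rewrite !(dotBl, dotBr, dotZl, dotZr) (dotC v u).
set a := dot u u; set b := dot u v; set c := dot v v in vv * => h.
have : 0 <= c * (a * c - b ^+ 2).
  by apply: le_trans h _; rewrite le_eqVlt; apply/orP; left; apply/eqP; ring.
by rewrite pmulr_rge0 // subr_ge0.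
Qed.

End InnerProduct.

Section Orthogonal.
Context {R : realType}.

Definition orthomx N (Q : 'M[R]_N) := Q^T *m Q = 1%:M.

Lemma orthomxC N (Q : 'M[R]_N) : orthomx Q -> Q *m Q^T = 1%:M.
Proof. by move=> /mulmx1C. Qed.

Lemma dot_ortho N (Q : 'M[R]_N) u v : orthomx Q -> dot (Q *m u) (Q *m v) = dot u v.
Proof. by move=> h; rewrite dot_mulmxl mulmxA h mul1mx. Qed.

Lemma enorm_ortho N (Q : 'M[R]_N) v : orthomx Q -> enorm (Q *m v) = enorm v.
Proof. by move=> h; rewrite /enorm dot_ortho. Qed.

Lemma orthomx_mul N (Q Q' : 'M[R]_N) : orthomx Q -> orthomx Q' -> orthomx (Q *m Q').
Proof.
by rewrite /orthomx => h h'; rewrite trmx_mul mulmxA -(mulmxA Q'^T) h mulmx1.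
Qed.

(** The witness is the reflection in the hyperplane orthogonal to [u - w]. *)
Lemma householder N (u w : 'cV[R]_N) : enorm u = 1 -> enorm w = 1 ->
  exists Q : 'M[R]_N, [/\ orthomx Q, Q^T = Q & Q *m u = w].
Proof.
move=> /enorm1E u1 /enorm1E w1.
have [->|uw] := eqVneq u w.
  by exists 1%:M; rewrite /orthomx trmx1 !mul1mx.
pose z := u - w; have z0 : dot z z != 0 by rewrite dotvv_eq0 subr_eq0.
pose H := 1%:M - (2%:R / dot z z) *: (z *m z^T).
have HT : H^T = H by rewrite /H linearB linearZ /= trmx1 trmx_mul trmxK.
have Hx x : H *m x = x - (2%:R / dot z z * dot z x) *: z.
  by rewrite mulmxBl mul1mx -scalemxAl outer_mul scalerA.
exists H; split => //.
  rewrite /orthomx HT {2}/H mulmxBr mulmx1 -scalemxAr mulmxA Hx.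
  rewrite divfK // mulmxBl -scalemxAl scalerBr /H scalerA.
  apply/matrixP => i j; rewrite !mxE; ring.
rewrite Hx; have -> : dot z z = 2%:R * dot z u.
  rewrite /z !(dotBl, dotBr) (dotC w u) u1 w1; ring.
have z1 : dot z u != 0.
  apply: contra z0; rewrite /z !(dotBl, dotBr) (dotC w u) u1 w1 => /eqP h.
  by apply/eqP; lra.
have -> : 2%:R / (2%:R * dot z u) * dot z u = 1 by field.
rewrite scale1r.
by rewrite /z opprB addrC subrK.
Qed.

End Orthogonal.

(** * The spectral theorem for real symmetric matrices *)

Section SpectralTheorem.
Context {R : realType}.

(** A complex eigenvector of a real symmetric matrix exists because the complex
numbers are algebraically closed; its eigenvalue is real, so that its real and
imaginary parts are real eigenvectors. *)
Lemma sym_eigenvector N (A : 'M[R]_N) : (0 < N)%N -> A^T = A ->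
  exists (v : 'cV[R]_N) a, enorm v = 1 /\ A *m v = a *: v.
Proof.
move=> N0 AT.
suff [v [a [v0 Av]]] : exists (v : 'cV[R]_N) a, v != 0 /\ A *m v = a *: v.
  exists ((enorm v)^-1 *: v), a; split; first exact: enorm_normalize.
  by rewrite -scalemxAr Av !scalerA mulrC.
pose B := map_mx (real_complex R) A.
have [l /eigenvalueP [v vB v0]] := spectral.eigenvalue_closed B N0.
pose x : 'cV[R]_N := \col_i complex.Re (v 0 i).
pose y : 'cV[R]_N := \col_i complex.Im (v 0 i).
have BT : B *m v^T = l *: v^T.
  have <- : B^T = B by apply/matrixP => i j; rewrite !mxE -{1}AT mxE.
  by rewrite -trmx_mul vB linearZ.
have xA : A *m x = complex.Re l *: x - complex.Im l *: y.
  apply/matrixP => i j; have /matrixP/(_ i 0) := BT.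
  rewrite !mxE => h; have := congr1 (@complex.Re R) h.
  have -> : complex.Re (l * v 0 i) =
      complex.Re l * complex.Re (v 0 i) - complex.Im l * complex.Im (v 0 i).
    by case: (l) => ? ?; case: (v 0 i).
  move=> <-; rewrite raddf_sum; apply: eq_bigr => k _; rewrite !mxE /=.
  by case: (v 0 k) => p q /=; rewrite mul0r subr0.
have yA : A *m y = complex.Im l *: x + complex.Re l *: y.
  apply/matrixP => i j; have /matrixP/(_ i 0) := BT.
  rewrite !mxE => h; have := congr1 (@complex.Im R) h.
  have -> : complex.Im (l * v 0 i) =
      complex.Im l * complex.Re (v 0 i) + complex.Re l * complex.Im (v 0 i).
    by case: (l) => ? ?; case: (v 0 i) => ? ? /=; rewrite addrC.
  move=> <-; rewrite raddf_sum; apply: eq_bigr => k _; rewrite !mxE /=.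
  by case: (v 0 k) => p q /=; rewrite mul0r addr0.
have xy0 : 0 < dot x x + dot y y.
  rewrite lt_def addr_ge0 ?dotvv_ge0 // andbT paddr_eq0 ?dotvv_ge0 //.
  rewrite !dotvv_eq0; apply: contra v0 => /andP[/eqP x0 /eqP y0].
  apply/eqP/matrixP => i j; rewrite (ord1 i) mxE.
  have /matrixP/(_ j 0) := x0; have /matrixP/(_ j 0) := y0; rewrite !mxE.
  by case: (v 0 j) => p q /= -> ->.
have : dot (A *m x) y = dot x (A *m y) by rewrite dot_mulmxl AT.
rewrite xA yA !(dotBl, dotDr, dotZl, dotZr) => h.
have im0 : complex.Im l = 0.
  apply/eqP; have : complex.Im l * (dot x x + dot y y) == 0 by apply/eqP; lra.
  by rewrite mulf_eq0 (gt_eqF xy0) orbF.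
rewrite im0 !scale0r subr0 add0r in xA yA.
have [x0|x0] := eqVneq x 0; last by exists x, (complex.Re l).
exists y, (complex.Re l); split => //.
by move: xy0; rewrite x0 dot0l add0r lt_def dotvv_eq0 => /andP[].
Qed.

(** Induction on the dimension: a reflection that moves an eigenvector to the
first basis vector makes the matrix block diagonal. *)
Lemma spectral_theorem N (A : 'M[R]_N) : A^T = A ->
  exists (Q : 'M[R]_N) (d : 'rV[R]_N), orthomx Q /\ A = Q *m diag_mx d *m Q^T.
Proof.
elim: N A => [|N IH] A AT.
  exists 0, 0; split; by apply/matrixP => -[].
have [v [a [v1 Av]]] := sym_eigenvector (ltn0Sn N) AT.
have e1 : enorm (delta_mx 0 0 : 'cV[R]_N.+1) = 1.
  by apply/enorm1E; rewrite dot_delta mxE !eqxx.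
have [H [Ho HT He]] := householder e1 v1.
have Hv : H *m v = delta_mx 0 0 by rewrite -He -{1}HT mulmxA Ho mul1mx.
pose B : 'M[R]_(1 + N) := H *m A *m H.
have BT : B^T = B by rewrite /B !trmx_mul AT HT mulmxA.
have Be : B *m (delta_mx 0 0 : 'cV[R]_N.+1) = a *: delta_mx 0 0.
  by rewrite /B -!mulmxA He Av -scalemxAr Hv.
have B0 i : B i 0 = a * (i == 0)%:R.
  have := congr1 (fun w : 'cV[R]_N.+1 => w i 0) Be.
  by rewrite -colE mxE => ->; rewrite !mxE andbT.
have AE : A = H *m B *m H.
  by rewrite /B !mulmxA -{1}HT Ho mul1mx -mulmxA -{1}HT Ho mulmx1.
clearbody B.
pose B' := drsubmx B.
have B'T : B'^T = B' by rewrite /B' trmx_drsub BT.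
have [Q' [d' [Qo' B'E]]] := IH _ B'T.
have l0 : lshift N (0 : 'I_1) = 0 by apply/val_inj.
have r0 j : (rshift 1 (j : 'I_N) == 0) = false by apply/eqP => /(congr1 val).
have BE : B = block_mx a%:M 0 0 B'.
  rewrite -[LHS]submxK; congr block_mx.
  - by apply/matrixP => i j; rewrite !ord1 !mxE l0 B0 eqxx mulr1.
  - by apply/matrixP => i j; rewrite !ord1 -BT !mxE l0 B0 r0 mulr0.
  - by apply/matrixP => i j; rewrite !ord1 !mxE l0 B0 r0 mulr0.
pose Q : 'M[R]_(1 + N) := block_mx 1%:M 0 0 Q'.
have Qo : orthomx Q.
  rewrite /orthomx /Q tr_block_mx mulmx_block !trmx0 trmx1 !mul1mx !mul0mx mulmx0.
  by rewrite !addr0 add0r Qo' -scalar_mx_block.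
have BQ : B = Q *m diag_mx (row_mx a%:M d' : 'rV_(1 + N)) *m Q^T.
  rewrite BE B'E /Q tr_block_mx diag_mx_row mulmx_block.
  rewrite !trmx0 trmx1 !mul1mx !mulmx0 !mul0mx !addr0 !add0r.
  rewrite mulmx_block !mulmx0 !mul0mx !mulmx1 !addr0 !add0r.
  by congr block_mx; apply/matrixP => i j; rewrite !ord1 !mxE eqxx.
exists (H *m Q), (row_mx a%:M d' : 'rV_(1 + N)); split; first exact: orthomx_mul.
by rewrite AE BQ trmx_mul HT !mulmxA.
Qed.

End SpectralTheorem.

(** * Eigenvalues and quadratic forms *)

Section Eigenvalues.
Context {R : realType}.

Lemma quad_eigen N (A : 'M[R]_N) v a : A *m v = a *: v -> quad A v = a * dot v v.
Proof. by rewrite /quad => ->; rewrite dotZr. Qed.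

Lemma quadB N (A B : 'M[R]_N) v : quad (A - B) v = quad A v - quad B v.
Proof. by rewrite /quad mulmxBl dotBr. Qed.

Lemma quadD N (A B : 'M[R]_N) v : quad (A + B) v = quad A v + quad B v.
Proof. by rewrite /quad mulmxDl dotDr. Qed.

Lemma quad_scalar N a (v : 'cV[R]_N) : quad a%:M v = a * dot v v.
Proof. by rewrite /quad mul_scalar_mx dotZr. Qed.

Lemma quadN N (A : 'M[R]_N) v : quad (- A) v = - quad A v.
Proof. by rewrite /quad mulNmx dotNr. Qed.

Lemma quadZ N (A : 'M[R]_N) a v : quad A (a *: v) = a ^+ 2 * quad A v.
Proof. by rewrite /quad -scalemxAr dotZl dotZr mulrA expr2. Qed.

Lemma quad_diag N (d : 'rV[R]_N) (w : 'cV[R]_N) :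
  quad (diag_mx d) w = \sum_i d 0 i * w i 0 ^+ 2.
Proof.
rewrite /quad dotE; apply: eq_bigr => i _.
by rewrite mul_diag_mx mxE mulrCA expr2.
Qed.

Lemma quad_conj m n (B : 'M[R]_(m, n)) (A : 'M[R]_m) v :
  quad (B^T *m A *m B) v = quad A (B *m v).
Proof. by rewrite /quad -!mulmxA dot_mulmxr trmxK. Qed.

Lemma quad_spectral N (A Q : 'M[R]_N) d v : A = Q *m diag_mx d *m Q^T ->
  quad A v = \sum_i d 0 i * (Q^T *m v) i 0 ^+ 2.
Proof. by move=> ->; rewrite -quad_diag -quad_conj trmxK. Qed.

Lemma eigen_col N (A Q : 'M[R]_N) d i : orthomx Q -> A = Q *m diag_mx d *m Q^T ->
  A *m col i Q = d 0 i *: col i Q.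
Proof.
move=> Qo ->; rewrite colE -!mulmxA (mulmxA Q^T) Qo mul1mx scalemxAr.
by congr (_ *m _); apply/matrixP => j k; rewrite mul_diag_mx !mxE;
  case: eqP => [->|]; rewrite ?mulr0.
Qed.

Lemma enorm_col_ortho N (Q : 'M[R]_N) i : orthomx Q -> enorm (col i Q) = 1.
Proof.
by move=> Qo; rewrite colE enorm_ortho //; apply/enorm1E; rewrite dot_delta mxE !eqxx.
Qed.

Lemma dot_ortho_tr N (Q : 'M[R]_N) v : orthomx Q ->
  dot v v = \sum_i (Q^T *m v) i 0 ^+ 2.
Proof.
move=> Qo; have QTo : orthomx Q^T by rewrite /orthomx trmxK orthomxC.
by rewrite -(dot_ortho _ _ QTo) dotE; apply: eq_bigr => i _; rewrite expr2.
Qed.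

(** In coordinates for an orthonormal eigenbasis the quadratic form is the sum of
the squared coordinates weighted by the eigenvalues. *)
Lemma min_eigenvector N (A : 'M[R]_N) : (0 < N)%N -> A^T = A ->
  exists (u : 'cV[R]_N) a, [/\ enorm u = 1, A *m u = a *: u &
    forall v, a * dot v v <= quad A v].
Proof.
move=> N0 AT; have [Q [d [Qo AE]]] := spectral_theorem AT.
pose i0 := [arg min_(i < Ordinal N0) d 0 i]%O.
have i0P i : d 0 i0 <= d 0 i.
  by rewrite /i0; case: arg_minP => // j _ h; exact: h.
exists (col i0 Q), (d 0 i0); split; [exact: enorm_col_ortho|exact: eigen_col|].
move=> v; rewrite (quad_spectral v AE) (dot_ortho_tr v Qo) mulr_sumr.
by apply: ler_sum => i _; rewrite ler_wpM2r ?sqr_ge0.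
Qed.

Lemma eigenvalue_sym N (A : 'M[R]_N) a : A^T = A ->
  eigenvalue A a <-> exists2 v : 'cV[R]_N, v != 0 & A *m v = a *: v.
Proof.
move=> AT; split=> [/eigenvalueP[v vA v0]|[v v0 Av]].
  exists v^T; last by rewrite -{1}AT -trmx_mul vA linearZ.
  by apply: contra v0 => /eqP h; rewrite -(trmxK v) h trmx0.
apply/eigenvalueP; exists v^T; first by rewrite -{1}AT -trmx_mul Av linearZ.
by apply: contra v0 => /eqP h; rewrite -(trmxK v) h trmx0.
Qed.

Lemma lambda_minP N (A : 'M[R]_N) : (0 < N)%N -> A^T = A ->
  exists u : 'cV[R]_N, [/\ enorm u = 1, A *m u = lambda_min A *: u &
    forall v, lambda_min A * dot v v <= quad A v].
Proof.
move=> N0 AT; have [u [a [u1 Au aP]]] := min_eigenvector N0 AT.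
have ea : eigenvalue A a.
  by apply/eigenvalue_sym => //; exists u => //; rewrite -enorm_eq0 u1 oner_eq0.
have lb : lbound [set a | eigenvalue A a] a.
  move=> b /= /(eigenvalue_sym _ AT) [v v0 Av].
  by have := aP v; rewrite (quad_eigen Av) ler_pM2r // lt_def dotvv_eq0 v0 dotvv_ge0.
suff -> : lambda_min A = a by exists u.
apply/eqP; rewrite eq_le; apply/andP; split.
  by apply: ge_inf; [exists a|].
by apply: lb_le_inf => //; exists a.
Qed.

Lemma lambda_maxP N (A : 'M[R]_N) : (0 < N)%N -> A^T = A ->
  exists u : 'cV[R]_N, [/\ enorm u = 1, A *m u = lambda_max A *: u &
    forall v, quad A v <= lambda_max A * dot v v].
Proof.
move=> N0 AT; have ANT : (- A)^T = - A by rewrite linearN /= AT.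
have [u [b [u1 Au bP]]] := min_eigenvector N0 ANT.
pose a := - b; have {}Au : A *m u = a *: u.
  by rewrite /a scaleNr -Au mulNmx opprK.
have {}aP v : quad A v <= a * dot v v.
  by have := bP v; rewrite quadN /a; lra.
have ea : eigenvalue A a.
  by apply/eigenvalue_sym => //; exists u => //; rewrite -enorm_eq0 u1 oner_eq0.
have ub : ubound [set a | eigenvalue A a] a.
  move=> c /= /(eigenvalue_sym _ AT) [v v0 Av].
  by have := aP v; rewrite (quad_eigen Av) ler_pM2r // lt_def dotvv_eq0 v0 dotvv_ge0.
suff -> : lambda_max A = a by exists u.
apply/eqP; rewrite eq_le; apply/andP; split.
  by apply: ge_sup => //; exists a.
by apply: ub_le_sup => //; exists a.
Qed.

(** The supremum in [spectral_norm] is over a bounded set, because [|A v|^2] is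
the quadratic form of [A^T *m A]. *)
Lemma quad_spectral_norm N (A : 'M[R]_N) v : 
  `|quad A v| <= spectral_norm A * dot v v.
Proof.
have [->|v0] := eqVneq v 0; first by rewrite /quad !dot0l normr0 mulr0.
have N0 : (0 < N)%N.
  by case: N A v v0 => // A v; rewrite (flatmx0 v) eqxx.
have STS : (- (A^T *m A))^T = - (A^T *m A) by rewrite linearN /= trmx_mul trmxK.
have [_ [b [_ _ bP]]] := min_eigenvector N0 STS.
have ub : has_ubound [set enorm (A *m v) | v in [set v : 'cV[R]_N | enorm v = 1]].
  exists (Num.sqrt (- b)) => _ [w /= w1 <-]; rewrite /enorm ler_wsqrtr //.
  have := bP w; rewrite quadN /quad -mulmxA dot_mulmxr trmxK.
  by move/enorm1E: w1 => ->; lra.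
pose w := (enorm v)^-1 *: v; have w1 : enorm w = 1 by exact: enorm_normalize.
have e0 : 0 < enorm v by rewrite lt_def enorm_eq0 v0 enorm_ge0.
have vw : v = enorm v *: w by rewrite /w scalerA divff ?scale1r // gt_eqF.
have h : enorm (A *m w) <= spectral_norm A by apply: ub_le_sup => //; exists w.
have : `|quad A w| <= enorm (A *m w).
  rewrite -sqrtr_sqr /enorm ler_wsqrtr //; have := Cauchy_Schwarz w (A *m w).
  by move/enorm1E: w1 => ->; rewrite mul1r.
move=> h2; rewrite vw quadZ dotZl dotZr (enorm1E w).1 // mulr1 -expr2.
rewrite normrM ger0_norm ?sqr_ge0 // mulrC ler_wpM2r ?sqr_ge0 //.
exact: le_trans h.
Qed.

Lemma mxtrace_quad n m (B : 'M[R]_(m, n)) (A : 'M[R]_m) :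
  \tr (B^T *m A *m B) = \sum_i quad A (col i B).
Proof.
apply: eq_bigr => i _; rewrite -mulmxA mxE /quad dotE; apply: eq_bigr => j _.
rewrite !mxE; congr (_ * _); apply: eq_bigr => k _; by rewrite !mxE.
Qed.

Lemma mxtrace_quad_ge0 n m (B : 'M[R]_(m, n)) (A : 'M[R]_m) :
  psd A -> 0 <= \tr (B^T *m A *m B).
Proof. by move=> [_ h]; rewrite mxtrace_quad sumr_ge0. Qed.

Lemma psd_spectral N (S : 'M[R]_N) : psd S ->
  exists Q (d : 'rV_N), [/\ orthomx Q, S = Q *m diag_mx d *m Q^T & forall i, 0 <= d 0 i].
Proof.
move=> [ST Sp]; have [Q [d [Qo SE]]] := spectral_theorem ST.
exists Q, d; split => // i; have := Sp (col i Q).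
by rewrite (quad_eigen (eigen_col i Qo SE)) (enorm1E _).1 ?mulr1 // enorm_col_ortho.
Qed.

(** [frob S A] is the sum of the quadratic form of [A] over the eigenvectors of
[S], weighted by the eigenvalues, which are nonnegative and sum to [\tr S]. *)
Lemma frob_psd_ge N (S A : 'M[R]_N) a : psd S ->
  (forall v, a * dot v v <= quad A v) -> a * \tr S <= frob S A.
Proof.
move=> Sp aP; have [Q [d [Qo SE d0]]] := psd_spectral Sp.
have -> : \tr S = \sum_i d 0 i.
  by rewrite SE mxtrace_mulC mulmxA Qo mul1mx mxtrace_diag.
have -> : frob S A = \sum_i d 0 i * quad A (col i Q).
  rewrite /frob (proj1 Sp) SE -mulmxA mxtrace_mulC mulmxA -mulmxA.
  rewrite mulmxA mxtrace_mulC mul_diag_mx /mxtrace; apply: eq_bigr => i _.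
  rewrite mxE; congr (_ * _); rewrite -mulmxA mxE /quad dotE; apply: eq_bigr => j _.
  by rewrite !mxE; congr (_ * _); apply: eq_bigr => k _; rewrite !mxE.
rewrite mulr_sumr; apply: ler_sum => i _; rewrite mulrC ler_wpM2l //.
by have := aP (col i Q); rewrite (enorm1E _).1 ?mulr1 // enorm_col_ortho.
Qed.

Lemma frob_outer N (v : 'cV[R]_N) (A : 'M[R]_N) : frob (v *m v^T) A = quad A v.
Proof.
rewrite /frob trmx_mul trmxK -mulmxA mxtrace_mulC -mulmxA mul_trmx_col.
by rewrite mxtrace_scalar dotC /quad dotC.
Qed.

End Eigenvalues.

(** * Nuclear norm and spectahedron *)

Section NuclearNorm.
Context {R : realType}.

Lemma char_poly_orthomx N (Q : 'M[R]_N) (d : 'rV[R]_N) : orthomx Q ->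
  char_poly (Q *m diag_mx d *m Q^T) = \prod_i ('X - (d 0 i)%:P).
Proof.
move=> Qo; have -> : \prod_i ('X - (d 0 i)%:P) = char_poly (diag_mx d).
  rewrite char_poly_trig ?diag_mx_is_trig //.
  by apply: eq_bigr => i _; rewrite !mxE eqxx.
pose P := map_mx polyC Q; have PP : P *m P^T = 1%:M.
  by rewrite /P map_trmx -map_mxM orthomxC // map_mx1.
rewrite /char_poly; have -> : char_poly_mx (Q *m diag_mx d *m Q^T) =
    P *m char_poly_mx (diag_mx d) *m P^T.
  rewrite /char_poly_mx !map_mxM mulmxBr mulmxBl -map_trmx; congr (_ - _).
  by rewrite mul_mx_scalar -scalemxAl PP scalemx1.
rewrite !det_mulmx mulrC mulrA -det_mulmx.
by rewrite (mulmx1C PP) det1 mul1r.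
Qed.

Lemma mup_prod_XsubC (I : finType) (s : seq I) (e : I -> R) x :
  mup x (\prod_(i <- s) ('X - (e i)%:P)) = (\sum_(i <- s) (e i == x))%N.
Proof.
elim: s => [|i s IH]; first by rewrite !big_nil mupNroot // root1.
rewrite !big_cons mupM ?polyXsubC_eq0 ?IH //; last first.
  by rewrite monic_neq0 // monic_prod_XsubC.
by rewrite -['X - _]expr1 mup_XsubCX; case: eqP.
Qed.

(** The multiplicity of an eigenvalue as a root of the characteristic polynomial
is the number of its occurrences on the diagonal. *)
Lemma nuclear_norm_spectral m n (Z : 'M[R]_(m, n)) (Q : 'M[R]_n) d :
  orthomx Q -> Z^T *m Z = Q *m diag_mx d *m Q^T ->
  nuclear_norm Z = \sum_i Num.sqrt (d 0 i).
Proof.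
move=> Qo ZE; rewrite /nuclear_norm ZE char_poly_orthomx //.
set p := \prod_i _; have p0 : p != 0.
  by rewrite monic_neq0 // /p monic_prod_XsubC.
transitivity (\sum_(x <- rootsR p) \sum_(i : 'I_n) Num.sqrt x *+ (d 0 i == x)).
  apply: eq_bigr => x _; rewrite mup_prod_XsubC.
  by rewrite -sumrMnr.
rewrite exchange_big /=; apply: eq_bigr => i _.
have di : d 0 i \in rootsR p.
  have /(_ (d 0 i)) <- := roots_on_rootsR p0; rewrite in_itv /=.
  by rewrite /p (bigD1 i) //= rootM root_XsubC eqxx.
rewrite (bigD1_seq (d 0 i)) //= ?eqxx ?mulr1n; last exact: uniq_roots.
by rewrite big1 ?addr0 // => x; rewrite eq_sym => /negPf ->.
Qed.

Lemma dot_col m n p (A : 'M[R]_(m, n)) (B : 'M[R]_(m, p)) i j :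
  dot (col i A) (col j B) = (A^T *m B) i j.
Proof. by rewrite dotE !mxE; apply: eq_bigr => k _; rewrite !mxE. Qed.

(** The singular value decomposition, with zero columns of [U] in the place of
the left singular vectors of the singular value [0]. *)
Lemma partial_svd m n (Z : 'M[R]_(m, n)) :
  exists (U : 'M[R]_(m, n)) (Q : 'M[R]_n) (s : 'rV[R]_n),
  [/\ orthomx Q, Z = U *m diag_mx s *m Q^T, forall i, 0 <= s 0 i,
     nuclear_norm Z = \sum_i s 0 i &
     U^T *m U = diag_mx (\row_i (s 0 i != 0)%:R)].
Proof.
have ZT : (Z^T *m Z)^T = Z^T *m Z by rewrite trmx_mul trmxK.
have Zp : psd (Z^T *m Z).
  by split => // v; rewrite /quad -mulmxA dot_mulmxr trmxK dotvv_ge0.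
have [Q [d [Qo ZE d0]]] := psd_spectral Zp.
have [s sd] : exists s : 'rV[R]_n, forall i, s 0 i = Num.sqrt (d 0 i).
  by exists (\row_i Num.sqrt (d 0 i)) => i; rewrite mxE.
have [r rs] : exists r : 'rV[R]_n, forall i, r 0 i = (s 0 i)^-1.
  by exists (\row_i (s 0 i)^-1) => i; rewrite mxE.
have sE i : s 0 i ^+ 2 = d 0 i by rewrite sd sqr_sqrtr.
pose W := Z *m Q; pose U := W *m diag_mx r.
have ZQ : W^T *m W = diag_mx d.
  rewrite /W trmx_mul mulmxA -(mulmxA Q^T) ZE !mulmxA Qo mul1mx -mulmxA Qo.
  by rewrite mulmx1.
have ZW : Z = W *m Q^T by rewrite /W -mulmxA orthomxC // mulmx1.
clearbody W.
have UU : U^T *m U = diag_mx (\row_i (s 0 i != 0)%:R).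
  rewrite /U trmx_mul -mulmxA (mulmxA W^T) ZQ tr_diag_mx !mul_diag_mx.
  apply/matrixP => i j; rewrite !mxE; have [->|ij] := eqVneq i j; last by rewrite !mulr0n !mulr0.
  rewrite !mulr1n -sE rs; have [->|s0] := eqVneq (s 0 j) 0.
    by rewrite invr0 mul0r.
  by rewrite /=; field.
exists U, Q, s; split => //.
- suff -> : U *m diag_mx s = W by rewrite ZW.
  apply/matrixP => i j; rewrite /U !mul_mx_diag !mxE rs.
  have [s0|s0] := eqVneq (s 0 j) 0; last by rewrite mulfVK.
  have : dot (col j W) (col j W) = 0.
    by rewrite dot_col ZQ !mxE eqxx mulr1n -sE s0 expr0n.
  move=> /eqP; rewrite dotvv_eq0 => /eqP/matrixP/(_ i 0); rewrite !mxE => ->.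
  by rewrite mul0r mul0r.
- by move=> i; rewrite sd sqrtr_ge0.
- by rewrite (nuclear_norm_spectral Qo ZE); apply: eq_bigr => i _; rewrite sd.
Qed.

Lemma mxtrace_submx m n (X : 'M[R]_(m + n)) :
  \tr X = \tr (ulsubmx X) + \tr (drsubmx X).
Proof. by rewrite -{1}(submxK X) mxtrace_block. Qed.

(** With [Z = U S Q^T], testing positivity on the vectors [(u_i, - q_i)] bounds
twice the sum of the singular values by the trace. *)
Lemma nuclear_norm_block m n (X : 'M[R]_(m + n)) : psd X ->
  2%:R * nuclear_norm (ursubmx X) <= \tr X.
Proof.
move=> Xp; have [U [Q [s [Qo ZE s0 nE UU]]]] := partial_svd (ursubmx X).
set Z := ursubmx X in ZE nE *; set V := ulsubmx X; set W := drsubmx X.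
have XE : X = block_mx V Z Z^T W.
  by rewrite -[LHS]submxK /Z trmx_ursub (proj1 Xp).
have Vp : psd V.
  split; first by rewrite /V trmx_ulsub (proj1 Xp).
  move=> v; have := (proj2 Xp) (col_mx v 0).
  rewrite {1}XE /quad mul_block_col !mulmx0 !addr0 /dot tr_col_mx mul_row_col.
  by rewrite trmx0 mul0mx addr0.
pose B := col_mx U (- Q).
have := mxtrace_quad_ge0 B Xp.
rewrite XE /B tr_col_mx mul_row_block mul_row_col linearN /= !mulmxDl !mulNmx !mulmxN.
rewrite opprK !mxtraceD !raddfN /=.
have -> : \tr (Q^T *m W *m Q) = \tr W.
  by rewrite mxtrace_mulC mulmxA orthomxC // mul1mx.
have tZ : \tr (U^T *m Z *m Q) = nuclear_norm Z.
  rewrite nE ZE !mulmxA UU -!mulmxA Qo mulmx1 mul_diag_mx; apply: eq_bigr => i _.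
  by rewrite !mxE eqxx mulr1n; case: eqP => [->|_]; rewrite ?mulr0 ?mul1r.
have -> : \tr (Q^T *m Z^T *m U) = nuclear_norm Z.
  by rewrite -tZ -[RHS]mxtrace_tr !trmx_mul trmxK mulmxA.
rewrite tZ.
(* U U^T is an orthogonal projection, so compressing V by U loses trace. *)
have tU : \tr (U^T *m V *m U) <= \tr V.
  pose E : 'M[R]_m := 1%:M - U *m U^T.
  have ET : E^T = E by rewrite /E linearB /= trmx1 trmx_mul trmxK.
  have UP : U *m (U^T *m U) = U.
    rewrite UU; apply/matrixP => i j; rewrite mul_mx_diag !mxE.
    have [sj|_] := eqVneq (s 0 j) 0; last by rewrite mulr1.
    have : dot (col j U) (col j U) = 0.
      by rewrite dot_col UU !mxE eqxx mulr1n sj eqxx.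
    by move=> /eqP; rewrite dotvv_eq0 => /eqP/matrixP/(_ i 0); rewrite !mxE => ->; rewrite mul0r.
  have EE : E *m E = E.
    have EU : E *m U = 0 by rewrite /E mulmxBl mul1mx -mulmxA UP subrr.
    by rewrite {2}/E mulmxBr mulmx1 mulmxA EU mul0mx subr0.
  have := mxtrace_quad_ge0 E Vp; rewrite ET mxtrace_mulC mulmxA EE /E mulmxBl mul1mx.
  by rewrite raddfB /= -(mulmxA U) (mxtrace_mulC U) subr_ge0.
rewrite -XE mxtrace_submx -/V -/W; lra.
Qed.

Lemma ursubmxD m n (X Y : 'M[R]_(m + n)) : ursubmx (X + Y) = ursubmx X + ursubmx Y.
Proof. by apply/matrixP => i j; rewrite !mxE. Qed.

Lemma ursubmxZ m n a (X : 'M[R]_(m + n)) : ursubmx (a *: X) = a *: ursubmx X.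
Proof. by apply/matrixP => i j; rewrite !mxE. Qed.

(** With [Z = U S Q^T], the positive semidefinite matrix [B S B^T], where [B] is
[U] on top of [Q], has [Z] as its upper right block and twice the nuclear norm of
[Z] as its trace; a diagonal entry makes up for the rest of the trace. *)
Lemma psd_lift m n (Z : 'M[R]_(m, n)) (t : R) : (0 < m + n)%N -> 0 < t ->
  nuclear_norm Z <= t / 2%:R ->
  exists X : 'M[R]_(m + n), spectahedron X /\ ursubmx (t *: X) = Z.
Proof.
move=> mn0 t0 Zt; have [U [Q [s [Qo ZE s0 nE UU]]]] := partial_svd Z.
pose B := col_mx U Q.
pose i0 := Ordinal mn0.
pose e := t - 2%:R * nuclear_norm Z; have e0 : 0 <= e by rewrite /e; lra.
pose D : 'cV[R]_(m + n) := delta_mx i0 0.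
pose Y := B *m diag_mx s *m B^T + e *: (D *m D^T).
have Yp : psd Y.
  split.
    by rewrite /Y linearD /= linearZ /= !trmx_mul !trmxK tr_diag_mx mulmxA.
  move=> v; rewrite /Y quadD addr_ge0 //.
    rewrite -[X in X *m _ *m _](trmxK B) quad_conj quad_diag sumr_ge0 // => i _.
    by rewrite mulr_ge0 // sqr_ge0.
  rewrite /quad -scalemxAl dotZr mulr_ge0 // outer_mul dotZr (dotC v D).
  by rewrite -expr2 sqr_ge0.
have us i : (U^T *m U) i i * s 0 i = s 0 i.
  by rewrite UU !mxE eqxx mulr1n; case: eqP => [->|]; rewrite ?mulr0 ?mul1r.
have Yt : \tr Y = t.
  rewrite /Y mxtraceD mxtraceZ tr_outer /D dot_delta mxE !eqxx mulr1.
  rewrite mxtrace_mulC mulmxA /B tr_col_mx mul_row_col mulmxDl Qo mul1mx mxtraceD.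
  rewrite mxtrace_diag -nE.
  have -> : \tr (U^T *m U *m diag_mx s) = nuclear_norm Z.
    by rewrite nE mul_mx_diag; apply: eq_bigr => i _; rewrite mxE us.
  by rewrite /e; ring.
have tn : t != 0 by rewrite gt_eqF.
exists (t^-1 *: Y); split; last first.
  rewrite scalerA divff // scale1r /Y /B tr_col_mx mul_col_mx mul_col_row.
  rewrite ursubmxD block_mxKur -ZE ursubmxZ.
  suff -> : ursubmx (D *m D^T) = 0 by rewrite scaler0 addr0.
  apply/matrixP => i j; rewrite !mxE big1 // => k _; rewrite !mxE.
  case: eqP => [<-|_]; last by rewrite mul0r.
  by rewrite eq_rlshift /= mulr0.
split; last by rewrite mxtraceZ Yt mulVf.
split; first by rewrite linearZ /= (proj1 Yp).
move=> v; rewrite /quad -scalemxAl dotZr mulr_ge0 ?invr_ge0 ?(ltW t0) //.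
exact: (proj2 Yp).
Qed.

Lemma psdZ N (X : 'M[R]_N) a : 0 <= a -> psd X -> psd (a *: X).
Proof.
move=> a0 [XT Xp]; split; first by rewrite linearZ /= XT.
by move=> v; rewrite /quad -scalemxAl dotZr mulr_ge0 //; exact: Xp.
Qed.

Lemma spectahedron_feasible m n (X : 'M[R]_(m + n)) t : 0 < t ->
  spectahedron X -> feasible t (ursubmx (t *: X)).
Proof.
move=> t0 [Xp Xt]; have := nuclear_norm_block (psdZ (ltW t0) Xp).
by rewrite mxtraceZ Xt mulr1 /feasible /=; lra.
Qed.

End NuclearNorm.

(** * Gradients of convex functions *)

Section Gradient.
Context {R : realType}.

Lemma derive_cvg_seq (V : normedModType R) (f : V -> R) (a v : V) : differentiable f a ->
  (fun n => n.+1%:R * (f (n.+1%:R^-1 *: v + a) - f a)) @ \oo --> 'D_v f a.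
Proof.
move=> /(diff_derivable (v := v)) df.
have /cvgr_dnbhsP/(_ harmonic) := df.
have -> : (fun n => (harmonic n)^-1 *: ((f \o shift a) (harmonic n *: v) - f a)) =
  (fun n => n.+1%:R * (f (n.+1%:R^-1 *: v + a) - f a)).
  by apply/funext => n; rewrite /harmonic /= invrK.
apply; split; last exact: cvg_harmonic.
by move=> n; rewrite gt_eqF // harmonic_gt0.
Qed.

(** Convexity bounds each difference quotient along the segment from [Z] to [Z']. *)
Lemma convex_derive_le m n (f : 'M[R]_(m, n) -> R) (Z Z' : 'M[R]_(m, n)) :
  differentiable f Z -> convex_function [set: 'M[R]_(m, n)] f ->
  'D_(Z' - Z) f Z <= f Z' - f Z.
Proof.
move=> df cf.
have h0 k : 0 <= k.+1%:R^-1 :> R by rewrite invr_ge0.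
have h1 k : k.+1%:R^-1 <= 1 :> R by rewrite invf_le1 ?ler1n.
apply: (cvgr_to_le (derive_cvg_seq (v := Z' - Z) df)).
apply: nearW => k.
have cfk : f (k.+1%:R^-1 *: Z' + (1 - k.+1%:R^-1) *: Z) <=
    k.+1%:R^-1 * f Z' + (1 - k.+1%:R^-1) * f Z.
  exact: (cf (Itv01 (h0 k) (h1 k)) Z' Z (in_setT _) (in_setT _)).
have -> : k.+1%:R^-1 *: (Z' - Z) + Z = k.+1%:R^-1 *: Z' + (1 - k.+1%:R^-1) *: Z.
  by rewrite scalerBr scalerBl scale1r -addrA (addrC (- _)).
rewrite -ler_pdivlMl ?ltr0n //.
move: cfk; move: (k.+1%:R^-1) (f Z) (f Z') (f _) => r p q s; lra.
Qed.

Context {m n : nat} (f : 'M[R]_(m, n) -> R) (t : R).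
Hypothesis df : forall Z, differentiable f Z.

Lemma derive_linearZ (Z : 'M[R]_(m, n)) a v : 'D_(a *: v) f Z = a * 'D_v f Z.
Proof. by rewrite !deriveE // linearZ. Qed.

Lemma derive_linear_sum (Z : 'M[R]_(m, n)) (I : Type) (r : seq I) (v : I -> 'M[R]_(m, n)) :
  'D_(\sum_(i <- r) v i) f Z = \sum_(i <- r) 'D_(v i) f Z.
Proof. by rewrite !deriveE // linear_sum; apply: eq_bigr => i _; rewrite deriveE. Qed.

Lemma derive_transformed (X D : 'M[R]_(m + n)) :
  'D_D (transformed f t) X = 'D_(ursubmx (t *: D)) f (ursubmx (t *: X)).
Proof.
rewrite /derive; set g := (fun h => _ : R); set g' := (fun h => _ : R).
suff -> : g = g' by [].
apply/funext => h; rewrite /g /g' /=; congr (_ *: (_ - _)).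
by rewrite /transformed !ursubmxZ ursubmxD ursubmxZ scalerDr !scalerA (mulrC h).
Qed.

Lemma symgrad_sym (F : 'M[R]_(m + n) -> R) X : (symgrad F X)^T = symgrad F X.
Proof. by apply/matrixP => i j; rewrite !mxE addrC. Qed.

Lemma ursubmx_sum (I : Type) (r : seq I) (v : I -> 'M[R]_(m + n)) :
  ursubmx (\sum_(i <- r) v i) = \sum_(i <- r) ursubmx (v i).
Proof. by apply/matrixP => i j; rewrite !(mxE, summxE); apply: eq_bigr => k _; rewrite !mxE. Qed.

(** The symmetric directions [(E_ij + E_ji) / 2] span the symmetric matrices, and
the derivative is linear in the direction. *)
Lemma frob_symgrad (X D : 'M[R]_(m + n)) : D^T = D ->
  frob D (symgrad (transformed f t) X) = 'D_(ursubmx (t *: D)) f (ursubmx (t *: X)).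
Proof.
move=> DT; set Z := ursubmx _.
pose E (i j : 'I_(m + n)) : 'M[R]_(m + n) := 2%:R^-1 *: (delta_mx i j + delta_mx j i).
have DE : D = \sum_i \sum_j D i j *: E i j.
  rewrite {1}(_ : D = 2%:R^-1 *: (D + D^T)); last first.
    by rewrite DT; apply/matrixP => i j; rewrite !mxE; field.
  rewrite {1}[D in D + _]matrix_sum_delta {1}[D in _ + D^T]matrix_sum_delta.
  rewrite linear_sum -big_split scaler_sumr; apply: eq_bigr => i _.
  rewrite linear_sum -big_split scaler_sumr; apply: eq_bigr => j _ /=.
  by rewrite linearZ /= trmx_delta -scalerDr !scalerA mulrC.
rewrite [in RHS]DE ursubmxZ ursubmx_sum derive_linearZ derive_linear_sum mulr_sumr.
rewrite /frob DT /mxtrace; apply: eq_bigr => i _.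
rewrite ursubmx_sum derive_linear_sum mulr_sumr mxE; apply: eq_bigr => j _.
rewrite ursubmxZ derive_linearZ mulrCA; congr (_ * _).
by rewrite mxE derive_transformed -/Z ursubmxZ derive_linearZ /E (addrC (delta_mx j i)).
Qed.
End Gradient.

(** * Convergence of the conditional gradient iteration *)

Section Hazan.
Context {R : realType}.

Lemma unit_dim_gt0 N (v : 'cV[R]_N) : enorm v = 1 -> (0 < N)%N.
Proof.
case: N v => // v; rewrite (flatmx0 v) /enorm dot0l sqrtr0 => /eqP.
by rewrite eq_sym oner_eq0.
Qed.

Lemma spectahedron_outer N (v : 'cV[R]_N) : enorm v = 1 -> spectahedron (v *m v^T).
Proof.
move=> v1; split; last by rewrite tr_outer; apply/enorm1E.
split; first by rewrite trmx_mul trmxK.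
by move=> w; rewrite /quad outer_mul dotZr (dotC w) -expr2 sqr_ge0.
Qed.

Lemma spectahedron_convex N (X Y : 'M[R]_N) a : 0 <= a <= 1 ->
  spectahedron X -> spectahedron Y -> spectahedron (X + a *: (Y - X)).
Proof.
move=> /andP[a0 a1] [[XT Xp] Xt] [[YT Yp] Yt].
have -> : X + a *: (Y - X) = (1 - a) *: X + a *: Y.
  by rewrite scalerBr scalerBl scale1r addrA addrAC.
split; last by rewrite mxtraceD !mxtraceZ Xt Yt !mulr1 subrK.
split; first by rewrite linearD !linearZ /= XT YT.
move=> v; rewrite quadD /quad -!scalemxAl !dotZr addr_ge0 // mulr_ge0 ?subr_ge0 //.
  exact: Xp.
exact: Yp.
Qed.

Lemma stepsize_itv k : 0 < (stepsize k : R) <= 1.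
Proof.
by rewrite /stepsize divr_gt0 ?ltr0n //= ler_pdivrMr ?ltr0n // mul1r ler_nat.
Qed.

Lemma hazan_spectahedron N (F : 'M[R]_N -> R) C ev v0 k : enorm v0 = 1 ->
  (forall j, (j < k)%N -> let A := symgrad F (hazan F C ev v0 j) in
     enorm (ev j A (stepsize j * C)) = 1) ->
  spectahedron (hazan F C ev v0 k).
Proof.
move=> v01; elim: k => [|k IH] h /=; first exact: spectahedron_outer.
have /andP[s0 s1] := stepsize_itv k.
apply: spectahedron_convex; first by rewrite (ltW s0) s1.
  by apply: IH => j jk; apply: h; exact: ltnW.
by apply: spectahedron_outer; exact: h.
Qed.

Lemma frobB N (A B G : 'M[R]_N) : frob (A - B) G = frob A G - frob B G.
Proof. by rewrite /frob linearB /= mulmxBl raddfB. Qed.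

Lemma frobZ N a (A G : 'M[R]_N) : frob (a *: A) G = a * frob A G.
Proof. by rewrite /frob linearZ /= -scalemxAl mxtraceZ. Qed.

Context {m n : nat} (f : 'M[R]_(m, n) -> R) (t C L : R).
Hypothesis pf : problem f t C L.
Hypothesis C_gt0 : 0 < C.
Let F := transformed f t.

Lemma curvature_le (X S : 'M[R]_(m + n)) al : spectahedron X -> spectahedron S ->
  0 < al <= 1 ->
  F (X + al *: (S - X)) <= F X + al * frob (S - X) (symgrad F X) + al ^+ 2 * C.
Proof.
move=> Xs Ss a01; have [_ _ _ cE _] := pf.
have /andP[a0 _] := a01.
have : (((al ^+ 2)^-1 * (F (X + al *: (S - X)) - F X
     - frob (X + al *: (S - X) - X) (symgrad F X)))%:E <= C%:E)%E.
  by rewrite -cE; apply: ereal_sup_ubound; exists X, S, al; split.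
rewrite lee_fin ler_pdivrMl ?exprn_gt0 // (addrC X) addrK frobZ; lra.
Qed.

Lemma transformed_convex_le (X S : 'M[R]_(m + n)) : X^T = X -> S^T = S ->
  frob (S - X) (symgrad F X) <= F S - F X.
Proof.
move=> XT ST; have [_ df cf _ _] := pf.
rewrite frob_symgrad //; last by rewrite linearB /= XT ST.
have -> : ursubmx (t *: (S - X)) = ursubmx (t *: S) - ursubmx (t *: X).
  by rewrite scalerBr; apply/matrixP => i j; rewrite !mxE.
exact: convex_derive_le.
Qed.

(** One step: the linear model at [X] decreases by at least the gap to any
competitor [S], up to the error of the eigenvector and the curvature. *)
Lemma hazan_step (X S : 'M[R]_(m + n)) al v : (0 < m + n)%N ->
  spectahedron X -> spectahedron S -> 0 < al <= 1 ->
  approxEV_spec (symgrad F X) (al * C) v ->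
  F (X + al *: (v *m v^T - X)) - F S <= (1 - al) * (F X - F S) + 2%:R * al ^+ 2 * C.
Proof.
move=> N0 Xs Ss a01 [v1 vA].
have step := curvature_le Xs (spectahedron_outer v1) a01.
have /andP[a0 _] := a01.
have gT : (symgrad F X)^T = symgrad F X by exact: symgrad_sym.
have [u [_ _ lP]] := lambda_minP N0 gT.
have := frob_psd_ge Ss.1 lP; rewrite Ss.2 mulr1 => lS.
have := transformed_convex_le Xs.1.1 Ss.1.1.
move: step; rewrite !frobB frob_outer.
set G := frob X _ in lS *; move: vA lS.
move: (F _) (frob S _) (quad _ _) (lambda_min _) (F X) (F S) => FY fS q l FX FS.
move=> ql lS st gap.
have : al * (q - G) <= al * (FS - FX + al * C).
  by rewrite ler_wpM2l ?(ltW a0) //; lra.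
lra.
Qed.

(** The first step has length 1, so that the gap of the initial matrix drops out
of the recursion. *)
Lemma hazan_convergence (ev : ev_routine (m + n)) v0 k (S : 'M[R]_(m + n)) :
  enorm v0 = 1 -> calls_succeed F C ev v0 k.+1 -> spectahedron S ->
  F (hazan F C ev v0 k.+1) - F S <= 8%:R * C / k.+3%:R.
Proof.
have C0 := C_gt0.
move=> v01; have N0 := unit_dim_gt0 v01.
move=> cs Ss; elim: k cs => [|k IH] cs.
  have h : spectahedron (hazan F C ev v0 0) by exact: spectahedron_outer.
  have := hazan_step N0 h Ss (stepsize_itv 0) (cs 0%N isT).
  rewrite -[X in F X]/(hazan F C ev v0 1).
  have -> : stepsize 0 = 1 :> R by rewrite /stepsize divff ?pnatr_eq0.
  lra.
have h : spectahedron (hazan F C ev v0 k.+1).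
  by apply: hazan_spectahedron => // j jk; have [] := cs j (leqW jk).
have := hazan_step N0 h Ss (stepsize_itv k.+1) (cs k.+1 (leqnn _)).
rewrite -[X in F X]/(hazan F C ev v0 k.+2) => st.
apply: (le_trans st).
have {}IH := IH (fun j jk => cs j (leqW jk)).
have /andP[_ s1] := stepsize_itv k.+1.
apply: (@le_trans _ _ ((1 - stepsize k.+1) * (8%:R * C / k.+3%:R) + 2%:R * stepsize k.+1 ^+ 2 * C)).
  by rewrite lerD2r ler_wpM2l // subr_ge0.
rewrite /stepsize -[k.+4]addn1 natrD.
have : 0 < k.+3%:R :> R by rewrite ltr0n.
move: (k.+3%:R) => x x0.
have -> : (1 - 2%:R / x) * (8%:R * C / x) + 2%:R * (2%:R / x) ^+ 2 * C =
    8%:R * C * (x - 1) / x ^+ 2.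
  by field; rewrite gt_eqF.
rewrite ler_pdivrMr ?exprn_gt0 // [leRHS]mulrAC ler_pdivlMr; last lra.
rewrite -!mulrA ler_pM2l ?ltr0n // ler_pM2l //; nra.
Qed.

(** Each feasible point lifts to a competitor in the spectahedron, so that the
rate holds against the infimum even if it is not attained. *)
Lemma solver_eps_optimal (eps : R) (ev : ev_routine (m + n)) v0 k : 0 < eps ->
  enorm v0 = 1 -> (iterations (8%:R * C) eps <= k)%N ->
  calls_succeed F C ev v0 k -> eps_optimal f t eps (nnr_solver f t C ev v0 k).
Proof.
move=> e0 v01; have [t0 _ _ _ _] := pf.
case: k => // k Kk cs; split.
  apply: spectahedron_feasible => //; apply: hazan_spectahedron => // j jk.
  by have [] := cs j jk.
have N0 := unit_dim_gt0 v01.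
rewrite -lerBlDr /opt_value; apply: lb_le_inf.
  exists (f (ursubmx (t *: (v0 *m v0^T)))); exists (ursubmx (t *: (v0 *m v0^T))) => //.
  by apply: spectahedron_feasible => //; exact: spectahedron_outer.
move=> _ [Z Zf <-]; have [S [Ss <-]] := psd_lift N0 t0 Zf.
have := hazan_convergence v01 cs Ss; rewrite -/F.
rewrite -[f (nnr_solver _ _ _ _ _ _)]/(F (hazan F C ev v0 k.+1)) -[f _]/(F S).
move=> hc; rewrite lerBlDr -lerBlDl; apply: (le_trans hc).
rewrite ler_pdivrMr ?ltr0n // [leRHS]mulrC -ler_pdivrMr //.
have /andP[_ /ltW h] := truncn_itv (divr_ge0 (mulr_ge0 (ler0n _ 8) (ltW C_gt0)) (ltW e0)).
apply: (le_trans h); rewrite ler_nat; apply: (leq_trans Kk).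
by rewrite -addn2 leq_addr.
Qed.

End Hazan.

(** * Chebyshev filtering *)

Section Chebyshev.
Context {R : realType}.

(** The Chebyshev polynomials of the first and second kind at [x], the latter
with shifted index: [T_n] and [U_(n-1)]. *)
Fixpoint cheb (x : R) n : R * R :=
  if n is n'.+1 then
    let: (T, U) := cheb x n' in (x * T + (x ^+ 2 - 1) * U, x * U + T)
  else (1, 0).

Lemma chebS x n : cheb x n.+1 = (x * (cheb x n).1 + (x ^+ 2 - 1) * (cheb x n).2,
  x * (cheb x n).2 + (cheb x n).1).
Proof. by rewrite /=; case: (cheb x n). Qed.

Lemma cheb_pell x n : (cheb x n).1 ^+ 2 - (x ^+ 2 - 1) * (cheb x n).2 ^+ 2 = 1.
Proof.
elim: n => [|n IH]; first by rewrite /= expr1n expr0n mulr0 subr0.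
rewrite chebS -[RHS]IH /=; ring.
Qed.

Lemma cheb_le1 x n : -1 <= x <= 1 -> (cheb x n).1 ^+ 2 <= 1.
Proof.
move=> /andP[x0 x1]; rewrite -[leRHS](cheb_pell x n) lerBrDl gerDr.
by rewrite mulr_le0_ge0 ?sqr_ge0 //; nra.
Qed.

(** For [s ^ 2 = x ^ 2 - 1] one has [T_n + s U_(n-1) = (x + s)^n] and
[T_n - s U_(n-1) = (x - s)^n]; at [x = 1 + g] the latter is nonnegative and
[s >= sqrt (2 g)]. *)
Lemma cheb_growth (g : R) n : 0 <= g -> (1 + Num.sqrt (2%:R * g)) ^+ n <= 2%:R * (cheb (1 + g) n).1.
Proof.
move=> g0; set x : R := 1 + g; pose s : R := Num.sqrt (x ^+ 2 - 1).
have x2 : 0 <= x ^+ 2 - 1 by rewrite /x; nra.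
have s2 : s ^+ 2 = x ^+ 2 - 1 by rewrite sqr_sqrtr.
have sP k : (cheb x k).1 + s * (cheb x k).2 = (x + s) ^+ k.
  elim: k => [|k IH]; first by rewrite /= mulr0 addr0.
  by rewrite [RHS]exprS -IH chebS -s2 /=; ring.
have sN k : (cheb x k).1 - s * (cheb x k).2 = (x - s) ^+ k.
  elim: k => [|k IH]; first by rewrite /= mulr0 subr0.
  by rewrite [RHS]exprS -IH chebS -s2 /=; ring.
have sx : s <= x.
  rewrite -(@ler_pXn2r _ 2) ?nnegrE ?sqrtr_ge0 // /x; last by lra.
  by rewrite s2 /x; lra.
have gs : Num.sqrt (2%:R * g) <= s by rewrite ler_wsqrtr // /x; nra.
have := sP n; have := sN n; have : 0 <= (x - s) ^+ n by rewrite exprn_ge0 // subr_ge0.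
have : (1 + Num.sqrt (2%:R * g)) ^+ n <= (x + s) ^+ n.
  by rewrite lerXn2r ?nnegrE ?addr_ge0 ?sqrtr_ge0 ?lerD // /x; lra.
lra.
Qed.

(** The vectors [T_n(Y) b] and [U_(n-1)(Y) b]. *)
Fixpoint chebv N (Y : 'M[R]_N) (b : 'cV[R]_N) n : 'cV[R]_N * 'cV[R]_N :=
  if n is n'.+1 then
    let: (T, U) := chebv Y b n' in (Y *m T + (Y *m (Y *m U) - U), Y *m U + T)
  else (b, 0).

Lemma chebvS N (Y : 'M[R]_N) b n : chebv Y b n.+1 =
  (Y *m (chebv Y b n).1 + (Y *m (Y *m (chebv Y b n).2) - (chebv Y b n).2),
   Y *m (chebv Y b n).2 + (chebv Y b n).1).
Proof. by rewrite /=; case: (chebv Y b n). Qed.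

Lemma dot_chebv N (Y : 'M[R]_N) b n q y : Y^T = Y -> Y *m q = y *: q ->
  dot q (chebv Y b n).1 = (cheb y n).1 * dot q b.
Proof.
move=> YT Yq; have Yd v : dot q (Y *m v) = y * dot q v.
  by rewrite dot_mulmxr YT Yq dotZl.
suff [-> _] : dot q (chebv Y b n).1 = (cheb y n).1 * dot q b /\
  dot q (chebv Y b n).2 = (cheb y n).2 * dot q b by [].
elim: n => [|n [IH1 IH2]]; first by rewrite /= dot0r mul1r mul0r.
rewrite chebvS chebS /= !dotDr dotNr !Yd IH1 IH2; split; ring.
Qed.

Lemma spectral_min N (A : 'M[R]_N) : (0 < N)%N -> A^T = A ->
  exists Q d i0, [/\ orthomx Q, A = Q *m diag_mx d *m Q^T, d 0 i0 = lambda_min A &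
    forall i, lambda_min A <= d 0 i].
Proof.
move=> N0 AT; have [Q [d [Qo AE]]] := spectral_theorem AT.
have [u [u1 Au lP]] := lambda_minP N0 AT.
have lmd i : lambda_min A <= d 0 i.
  have := lP (col i Q); rewrite (quad_eigen (eigen_col i Qo AE)).
  by rewrite (enorm1E _).1 ?mulr1 // enorm_col_ortho.
pose i0 := [arg min_(i < Ordinal N0) d 0 i]%O.
have i0P i : d 0 i0 <= d 0 i.
  by rewrite /i0; case: arg_minP => // j _ h; exact: h.
exists Q, d, i0; split => //; apply/eqP; rewrite eq_le lmd andbT.
have u1' := (enorm1E _).1 u1.
rewrite -[leRHS]mulr1 -u1' -(quad_eigen Au) (quad_spectral u AE).
rewrite -[leLHS]mulr1 -u1' (dot_ortho_tr u Qo) mulr_sumr.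
by apply: ler_sum => i _; rewrite ler_wpM2r ?sqr_ge0.
Qed.

Lemma col_tr_mul N (Q : 'M[R]_N) v i : (Q^T *m v) i 0 = dot (col i Q) v.
Proof. by rewrite dotE mxE; apply: eq_bigr => k _; rewrite !mxE. Qed.

(** The eigenvalues [l] of [A] with [l >= lambda_min A + e / 2] are mapped into
[[-1, 1]], and [lambda_min A] to [1 + e / (2 L)]. *)
Definition cheb_arg N (L e : R) (A : 'M[R]_N) : 'M[R]_N :=
  (1 + e / (2%:R * L) + lambda_min A / L)%:M - L^-1 *: A.

(** Nonpositive exactly when the Rayleigh quotient of [A] at [x] is within [e] of
[lambda_min A], for [x] nonzero. *)
Definition excess N (e : R) (A : 'M[R]_N) (x : 'cV[R]_N) : R :=
  quad A x - (lambda_min A + e) * dot x x.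

(** In an orthonormal eigenbasis the excess is a sum over the eigenvalues: those
above [lambda_min A + e / 2] are mapped into [[-1, 1]], where the polynomial is
bounded by 1, those below contribute a nonpositive term, and [u] belongs to
[lambda_min A], whose term is amplified. *)
Lemma cheb_filter N (A : 'M[R]_N) (L e : R) : (0 < N)%N -> 0 < L -> 0 < e ->
  A^T = A -> spectral_norm A <= L ->
  exists u : 'cV[R]_N, enorm u = 1 /\ forall b n, enorm b = 1 ->
   excess e A (chebv (cheb_arg L e A) b n).1 <=
   2%:R * L - e * (cheb (1 + e / (2%:R * L)) n).1 ^+ 2 * dot u b ^+ 2.
Proof.
move=> N0 L0 e0 AT AL; have [Q [d [i0 [Qo AE di0 lmd]]]] := spectral_min N0 AT.
exists (col i0 Q); split; first exact: enorm_col_ortho.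
move=> b n b1; set l := lambda_min A in di0 lmd *; set Y := cheb_arg _ _ _.
have quadL v : `|quad A v| <= L * dot v v.
  by apply: (le_trans (quad_spectral_norm A v)); rewrite ler_wpM2r ?dotvv_ge0.
have dL i : -L <= d 0 i <= L.
  rewrite -ler_norml; have := quadL (col i Q).
  by rewrite (quad_eigen (eigen_col i Qo AE)) (enorm1E _).1 ?mulr1 // enorm_col_ortho.
have YT : Y^T = Y by rewrite /Y /cheb_arg linearB /= linearZ /= tr_scalar_mx AT.
pose y i := 1 + e / (2%:R * L) - (d 0 i - l) / L.
have Yq i : Y *m col i Q = y i *: col i Q.
  rewrite /Y /cheb_arg mulmxBl mul_scalar_mx -scalemxAl (eigen_col i Qo AE).
  by rewrite scalerA -scalerBl -/l; congr (_ *: _); rewrite /y; ring.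
set x := (chebv Y b n).1.
have xq i : (Q^T *m x) i 0 = (cheb (y i) n).1 * dot (col i Q) b.
  by rewrite col_tr_mul (dot_chebv b n YT (Yq i)).
have -> : excess e A x = \sum_i (d 0 i - l - e) * ((cheb (y i) n).1 ^+ 2 * dot (col i Q) b ^+ 2).
  rewrite /excess (quad_spectral x AE) (dot_ortho_tr x Qo) mulr_sumr -sumrB.
  by apply: eq_bigr => i _; rewrite xq -/l; ring.
have b1' : \sum_i dot (col i Q) b ^+ 2 = 1.
  by rewrite -((enorm1E b).1 b1) (dot_ortho_tr b Qo); apply: eq_bigr => i _; rewrite col_tr_mul.
have yi0 : y i0 = 1 + e / (2%:R * L) by rewrite /y di0 subrr mul0r subr0.
rewrite (bigD1 i0) //= di0 subrr sub0r yi0 addrC mulNr mulrA lerB //.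
have -> : 2%:R * L = \sum_i 2%:R * L * dot (col i Q) b ^+ 2.
  by rewrite -mulr_sumr b1' mulr1.
rewrite [leRHS](bigD1 i0) //=.
apply: le_trans (_ : \sum_(i | i != i0) 2%:R * L * dot (col i Q) b ^+ 2 <= _); last first.
  by rewrite lerDr mulr_ge0 ?sqr_ge0 // mulr_ge0 // ltW.
apply: ler_sum => i _; rewrite mulrA ler_wpM2r ?sqr_ge0 //.
have /andP[dL1 dL2] := dL i; have /andP[dL3 _] := dL i0; rewrite di0 in dL3.
have := lmd i; set di := d 0 i in dL1 dL2 *; move=> ldi.
have [le|lt] := leP (e / 2%:R) (di - l); last first.
  apply: (@le_trans _ _ 0); last by rewrite mulr_ge0 // ltW.
  by rewrite mulr_le0_ge0 ?sqr_ge0 //; lra.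
have t1 : (cheb (y i) n).1 ^+ 2 <= 1.
  apply: cheb_le1; have -> : y i = 1 - (di - l - e / 2%:R) / L.
    by rewrite /y -/di; field; rewrite gt_eqF.
  have h0 : 0 <= (di - l - e / 2%:R) / L by rewrite divr_ge0 ?subr_ge0 // ltW.
  have h2 : (di - l - e / 2%:R) / L <= 2%:R by rewrite ler_pdivrMr //; lra.
  by apply/andP; split; lra.
have [ge|lt0] := leP 0 (di - l - e).
  rewrite -[leRHS]mulr1 ler_pM ?sqr_ge0 //; lra.
by apply: (@le_trans _ _ 0); [rewrite mulr_le0_ge0 ?sqr_ge0 // ltW|rewrite mulr_ge0 // ltW].
Qed.

End Chebyshev.

(** * The Lanczos recurrence *)

Section LanczosAlgebra.
Context {R : realType}.
Variables (N : nat) (M : 'M[R]_N) (b : 'cV[R]_N).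
Hypothesis MT : M^T = M.
Hypothesis b1 : enorm b = 1.

Local Notation q := (lanczos_vec M b).
Local Notation beta := (lanczos_beta M b).
Local Notation alpha := (lanczos_alpha M b).

Definition lanczos_prev j := (lanczos_state M b j).1.1.
Local Notation q' := lanczos_prev.

Definition lanczos_resid j := M *m q j - alpha j *: q j - beta j *: q' j.

Lemma lanczos_prevS j : q' j.+1 = q j.
Proof. by rewrite /q' /= /lanczos_vec; case: (lanczos_state M b j) => [[? ?] ?]. Qed.

Lemma lanczos_betaS j : beta j.+1 = enorm (lanczos_resid j).
Proof.
rewrite /lanczos_resid /lanczos_alpha /lanczos_prev /lanczos_beta /lanczos_vec /=.
by case: (lanczos_state M b j) => [[? ?] ?].
Qed.

Lemma lanczos_vecS j : q j.+1 = (enorm (lanczos_resid j))^-1 *: lanczos_resid j.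
Proof.
rewrite /lanczos_resid /lanczos_alpha /lanczos_prev /lanczos_beta /lanczos_vec /=.
by case: (lanczos_state M b j) => [[? ?] ?].
Qed.

Lemma lanczos_beta_eq0 j : (beta j.+1 == 0) = (q j.+1 == 0).
Proof.
rewrite lanczos_betaS lanczos_vecS scaler_eq0 invr_eq0 enorm_eq0.
by case: eqP.
Qed.

Lemma lanczos_recS j : beta j.+1 *: q j.+1 = lanczos_resid j.
Proof.
rewrite lanczos_betaS lanczos_vecS scalerA.
have [->|r0] := eqVneq (lanczos_resid j) 0; first by rewrite scaler0.
by rewrite divff ?scale1r // enorm_eq0.
Qed.

Lemma lanczos_rec j :
  M *m q j = beta j.+1 *: q j.+1 + alpha j *: q j + beta j *: q' j.
Proof. by rewrite lanczos_recS /lanczos_resid [X in X + _]addrAC !subrK. Qed.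

Lemma lanczos_breakdownS j : q j = 0 -> q j.+1 = 0.
Proof.
case: j => [|j] qj.
  by move: b1; rewrite -[b]/(q 0) qj /enorm dot0l sqrtr0 => /eqP; rewrite eq_sym oner_eq0.
rewrite lanczos_vecS /lanczos_resid qj mulmx0 scaler0 !sub0r.
have /eqP -> : beta j.+1 == 0 by rewrite lanczos_beta_eq0 qj.
by rewrite scale0r !oppr0 addr0 scaler0.
Qed.

Lemma lanczos_breakdown i j : (i <= j)%N -> q i = 0 -> q j = 0.
Proof.
move=> ij qi; rewrite -(subnK ij); elim: (j - i)%N => [|k IH] //.
by rewrite addSn; exact: lanczos_breakdownS.
Qed.

Lemma lanczos_vec_unit j : q j != 0 -> dot (q j) (q j) = 1.
Proof.
move=> qj; apply/enorm1E; case: j qj => // j.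
rewrite lanczos_vecS scaler_eq0 negb_or invr_eq0 enorm_eq0 => /andP[r0 _].
exact: enorm_normalize.
Qed.

(** By symmetry of [M] and induction, [M *m q_j] is orthogonal to all [q_i] with
[i + 1 < j]; the recurrence subtracts the two remaining components. *)
Lemma lanczos_ortho i j : (i < j)%N -> dot (q i) (q j) = 0.
Proof.
elim/ltn_ind: j i => -[//|j] IH i; rewrite ltnS => ij.
have [->|qj1] := eqVneq (q j.+1) 0; first by rewrite dot0r.
have bj : beta j.+1 != 0 by rewrite lanczos_beta_eq0.
have qn0 k : (k <= j.+1)%N -> q k != 0.
  by move=> kj; apply: contra qj1 => /eqP h; apply/eqP; apply: lanczos_breakdown h.
apply: (mulfI bj); rewrite mulr0 -dotZr lanczos_recS /lanczos_resid !dotBr !dotZr.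
move: ij; rewrite leq_eqVlt => /predU1P[->|ij].
  rewrite lanczos_vec_unit ?qn0 // mulr1 subrr sub0r.
  case: j {IH qj1 bj qn0} (IH j (leqnn _)) => [|j] IH.
    by rewrite /q' /= dot0r mulr0 oppr0.
  by rewrite lanczos_prevS dotC IH // mulr0 oppr0.
rewrite (IH j) // mulr0 subr0.
have -> : dot (q i) (M *m q j) = dot (M *m q i) (q j) by rewrite dot_mulmxl MT.
rewrite lanczos_rec !dotDl !dotZl (IH j _ i) // mulr0 addr0.
have -> : beta i * dot (q' i) (q j) = 0.
  case: i ij => [|i] ij; first by rewrite /q' /= dot0l mulr0.
  by rewrite lanczos_prevS (IH j) ?mulr0 //; exact: ltnW.
rewrite addr0; case: j ij IH qn0 {qj1 bj} => // j; rewrite ltnS => ij IH qn0.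
rewrite lanczos_prevS; move: ij; rewrite leq_eqVlt => /predU1P[->|ij].
  by rewrite !lanczos_vec_unit ?qn0 ?mulr1 ?subrr //; exact: leqW.
by rewrite (IH j.+1) // mulr0 (IH j) ?mulr0 ?subrr.
Qed.

Lemma lanczos_dim_spec s j : (j < s)%N -> (q j != 0) = (j < lanczos_dim M b s)%N.
Proof.
elim: s j => // s IH j; rewrite ltnS /lanczos_dim big_ord_recr /= => js.
rewrite -[X in (X + _)%N]/(lanczos_dim M b s).
have dims : (lanczos_dim M b s <= s)%N.
  by rewrite /lanczos_dim -[leqRHS]card_ord -sum1_card leq_sum // => i _; exact: leq_b1.
have [qs|qs] := eqVneq (q s) 0.
  rewrite addn0; move: js; rewrite leq_eqVlt => /predU1P[->|]; last exact: IH.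
  by rewrite qs eqxx ltnNge dims.
have alln i : (i <= s)%N -> q i != 0.
  by move=> ks; apply: contra qs => /eqP h; apply/eqP; apply: lanczos_breakdown h.
have -> : lanczos_dim M b s = s.
  rewrite /lanczos_dim -[RHS]card_ord -sum1_card; apply: eq_bigr => i _.
  by rewrite alln // ltnW.
by rewrite addn1 ltnS js alln.
Qed.

Lemma lanczos_dim_le s : (lanczos_dim M b s <= s)%N.
Proof.
by rewrite /lanczos_dim -[leqRHS]card_ord -sum1_card leq_sum // => i _; exact: leq_b1.
Qed.

Lemma lanczos_dim_gt0 s : (0 < s)%N -> (0 < lanczos_dim M b s)%N.
Proof. by move=> s0; rewrite -lanczos_dim_spec // -[q 0]/b -enorm_eq0 b1 oner_eq0. Qed.

Lemma lanczos_dim_neq0 s j : (j < lanczos_dim M b s)%N -> q j != 0.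
Proof.
by move=> jd; rewrite (@lanczos_dim_spec s) // (leq_trans jd (lanczos_dim_le s)).
Qed.

Lemma lanczos_basis_ortho s : let B := lanczos_basis M b (lanczos_dim M b s) in
  B^T *m B = 1%:M.
Proof.
move=> B; apply/matrixP => i j.
have -> : (B^T *m B) i j = dot (q i) (q j).
  by rewrite mxE dotE; apply: eq_bigr => k _; rewrite !mxE.
rewrite mxE; have [->|] := eqVneq i j.
  by rewrite lanczos_vec_unit ?mulr1n // (@lanczos_dim_neq0 s).
rewrite -val_eqE neq_ltn => /orP[] ij; first exact: lanczos_ortho.
by rewrite dotC lanczos_ortho.
Qed.

Lemma lanczos_tridiagE s : let d := lanczos_dim M b s in
  let B := lanczos_basis M b d in lanczos_tridiag M b d = B^T *m M *m B.
Proof.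
move=> d B; apply/matrixP => i j.
have -> : (B^T *m M *m B) i j = dot (q i) (M *m q j).
  rewrite -mulmxA mxE dotE; apply: eq_bigr => k _; rewrite !mxE; congr (_ * _).
  by apply: eq_bigr => l _; rewrite !mxE.
have qd (k : 'I_d) : q k != 0 by exact: (@lanczos_dim_neq0 s).
rewrite mxE; have [->|ij] := eqVneq i j.
  by rewrite /lanczos_alpha /quad.
have sub (x y : 'I_d) : (y < x)%N ->
      dot (q x) (M *m q y) = (if x == y.+1 :> nat then beta x else 0).
  move=> yx; rewrite lanczos_rec !dotDr !dotZr [dot _ (q y)]dotC (lanczos_ortho yx) mulr0 addr0.
  have -> : beta y * dot (q x) (q' y) = 0.
    case: (nat_of_ord y) yx => [|k] kx; first by rewrite /q' /= dot0r mulr0.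
    by rewrite lanczos_prevS dotC lanczos_ortho ?mulr0 // ltnW.
  rewrite addr0; case: eqP => [e|/eqP ne].
    by rewrite -e lanczos_vec_unit ?mulr1.
  by rewrite dotC lanczos_ortho ?mulr0 // ltn_neqAle eq_sym ne.
move: (ij); rewrite -val_eqE neq_ltn /= => /orP[] lt.
  rewrite dot_mulmxr MT dotC sub //.
  case: eqP => // _; case: eqP => // h; by move: lt; rewrite h ltnNge leqW.
rewrite sub //; case: eqP => // h; first by move: lt; rewrite h ltnNge leqW.
Qed.

(** The Krylov space of dimension at most [j], as the span of the Lanczos
vectors. *)
Definition krylov j (x : 'cV[R]_N) := exists c : nat -> R, x = \sum_(i < j) c i *: q i.

Lemma krylovD j x y : krylov j x -> krylov j y -> krylov j (x + y).
Proof.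
move=> [c ->] [e ->]; exists (fun i => c i + e i); rewrite -big_split.
by apply: eq_bigr => i _; rewrite scalerDl.
Qed.

Lemma krylovZ j a x : krylov j x -> krylov j (a *: x).
Proof.
move=> [c ->]; exists (fun i => a * c i); rewrite scaler_sumr.
by apply: eq_bigr => i _; rewrite scalerA.
Qed.

Lemma krylov0 j : krylov j 0.
Proof. by exists (fun=> 0); rewrite big1 // => i _; rewrite scale0r. Qed.

Lemma krylov_sum j k (x : 'I_k -> 'cV[R]_N) :
  (forall i, krylov j (x i)) -> krylov j (\sum_i x i).
Proof.
by move=> h; elim/big_ind: _ => //; [exact: krylov0|exact: krylovD].
Qed.

Lemma krylov_vec i j : (i < j)%N -> krylov j (q i).
Proof.
move=> ij; exists (fun k => (k == i)%:R); rewrite (bigD1 (Ordinal ij)) //= eqxx scale1r.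
by rewrite big1 ?addr0 // => k; rewrite -val_eqE /= => /negPf ->; rewrite scale0r.
Qed.

Lemma krylov_trunc d j x : (forall i, (d <= i)%N -> q i = 0) -> krylov j x -> krylov d x.
Proof.
move=> qd [c ->]; apply: krylov_sum => i; apply: krylovZ.
by have [id|/qd ->] := ltnP i d; [exact: krylov_vec|exact: krylov0].
Qed.

Lemma krylov_mono j k x : (j <= k)%N -> krylov j x -> krylov k x.
Proof.
move=> jk [c ->]; apply: krylov_sum => i; apply: krylovZ; apply: krylov_vec.
exact: leq_trans jk.
Qed.

Lemma krylov_mul j x : krylov j x -> krylov j.+1 (M *m x).
Proof.
move=> [c ->]; rewrite mulmx_sumr; apply: krylov_sum => i.
rewrite -scalemxAr; apply: krylovZ; rewrite lanczos_rec.
apply: krylovD; first apply: krylovD.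
- by apply/krylovZ/krylov_vec; rewrite ltnS.
- by apply/krylovZ/krylov_vec; rewrite ltnW // ltnS.
apply: krylovZ; case: i => -[|i] /= ij; first exact: krylov0.
by rewrite lanczos_prevS; apply: krylov_vec; rewrite ltnW // ltnW.
Qed.

Lemma krylov_chebv (Y : 'M[R]_N) a c n : Y = a%:M + c *: M ->
  krylov n.+1 (chebv Y b n).1 /\ krylov n (chebv Y b n).2.
Proof.
move=> YE; have YK j x : krylov j x -> krylov j.+1 (Y *m x).
  move=> h; rewrite YE mulmxDl mul_scalar_mx -scalemxAl; apply: krylovD.
    by apply: krylovZ; apply: krylov_mono h.
  by apply: krylovZ; exact: krylov_mul.
elim: n => [|n [IH1 IH2]]; first by split; [exact: (@krylov_vec 0)|exact: krylov0].
rewrite chebvS /=; split; last by apply: krylovD => //; exact: YK.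
apply: krylovD; first exact: YK.
apply: krylovD; first by apply: (YK); exact: YK.
by rewrite -scaleN1r; apply: krylovZ; apply: krylov_mono IH2; rewrite -addn2 leq_addr.
Qed.

Lemma krylov_basis j x : krylov j x -> exists y, x = lanczos_basis M b j *m y.
Proof.
move=> [c ->]; exists (\col_i c i); apply/matrixP => i k; rewrite !ord1 summxE mxE.
by apply: eq_bigr => l _; rewrite !mxE mulrC.
Qed.

Lemma krylov_full x : lanczos_dim M b N = N -> krylov N x.
Proof.
move=> dN; have := lanczos_basis_ortho N; rewrite dN => /= /mulmx1C BB.
exists (fun i => dot (q i) x); rewrite -[LHS]mul1mx -BB -mulmxA.
apply/matrixP => i k; rewrite !ord1 summxE mxE.
apply: eq_bigr => l _; rewrite !mxE mulrC; congr (_ * _).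
by rewrite dotE; apply: eq_bigr => h _; rewrite !mxE.
Qed.

(** Either the recurrence breaks down, after which all further Lanczos vectors
vanish, or there are [N] orthonormal Lanczos vectors, which span everything. So
capping the number of steps at [N] loses nothing. *)
Lemma krylov_cap n x : krylov n.+1 x -> krylov (lanczos_dim M b (minn N n.+1)) x.
Proof.
move=> Kx.
have zero s : (lanczos_dim M b s < s)%N -> forall i, (lanczos_dim M b s <= i)%N -> q i = 0.
  move=> ds i di; apply: (lanczos_breakdown di); apply/eqP; apply/negbNE.
  by rewrite (lanczos_dim_spec ds) ltnn.
have := lanczos_dim_le (minn N n.+1); rewrite leq_eqVlt => /predU1P[de|dlt]; last first.
  by apply: krylov_trunc Kx; exact: zero.
rewrite de; have [nN|nN] := leqP N n.+1; last by [].
by apply: krylov_full; move: de; rewrite (minn_idPl nN).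
Qed.

(** The tridiagonal matrix represents the compression of [M] to the Krylov space,
and a Ritz vector for its largest eigenvalue maximizes the quadratic form. *)
Lemma lanczos_outputP s v : (0 < s)%N -> lanczos_output M b s v ->
  enorm v = 1 /\ forall x, krylov (lanczos_dim M b s) x ->
    quad M x <= quad M v * dot x x.
Proof.
move=> s0 [y [y1 Ty ->]]; set B := lanczos_basis _ _ _.
have BB : B^T *m B = 1%:M by exact: lanczos_basis_ortho.
have Bd u w : dot (B *m u) (B *m w) = dot u w by rewrite dot_mulmxl mulmxA BB mul1mx.
have TE := lanczos_tridiagE s.
have TT : (lanczos_tridiag M b (lanczos_dim M b s))^T = lanczos_tridiag M b (lanczos_dim M b s).
  by rewrite TE !trmx_mul MT trmxK mulmxA.
have [_ [_ _ lP]] := lambda_maxP (lanczos_dim_gt0 s0) TT.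
have qv : quad M (B *m y) = lambda_max (lanczos_tridiag M b (lanczos_dim M b s)).
  by rewrite -quad_conj -TE (quad_eigen Ty) ((enorm1E _).1 y1) mulr1.
split; first by rewrite /enorm Bd (enorm1E _).1 // sqrtr1.
move=> x /krylov_basis [z ->]; rewrite qv Bd -quad_conj -TE; exact: lP.
Qed.

Lemma lanczos_output_ex s : (0 < s)%N -> lanczos_output M b s (lanczos M b s).
Proof.
move=> s0; apply: (@xgetPex _ 0).
have TT : (lanczos_tridiag M b (lanczos_dim M b s))^T = lanczos_tridiag M b (lanczos_dim M b s).
  by rewrite lanczos_tridiagE !trmx_mul MT trmxK mulmxA.
have [y [y1 Ty _]] := lambda_maxP (lanczos_dim_gt0 s0) TT.
by exists (lanczos_basis M b (lanczos_dim M b s) *m y), y.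
Qed.

End LanczosAlgebra.

Section LanczosSuccess.
Context {R : realType}.

Lemma lanczos_unit N (L : R) (A : 'M[R]_N) (b : 'cV[R]_N) s : A^T = A -> enorm b = 1 ->
  (0 < s)%N -> enorm (lanczos (L%:M - A) b s) = 1.
Proof.
move=> AT b1 s0; have MT : (L%:M - A)^T = L%:M - A by rewrite linearB /= tr_scalar_mx AT.
by have [] := lanczos_outputP MT b1 s0 (lanczos_output_ex MT b1 s0).
Qed.

(** A Krylov vector of small Rayleigh quotient is enough, as the Ritz vector
maximizes the Rayleigh quotient of the shifted matrix over the Krylov space. *)
Lemma lanczos_approxEV N (L e : R) (A : 'M[R]_N) (b : 'cV[R]_N) n :
  0 < L -> A^T = A -> enorm b = 1 ->
  excess e A (chebv (cheb_arg L e A) b n).1 <= - L ->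
  approxEV_spec A e (lanczos (L%:M - A) b (minn N n.+1)).
Proof.
move=> L0 AT b1; set x := (chebv _ _ _).1 => xL; have N0 := unit_dim_gt0 b1.
have MT : (L%:M - A)^T = L%:M - A by rewrite linearB /= tr_scalar_mx AT.
have s0 : (0 < minn N n.+1)%N by rewrite leq_min N0.
have [v1 vP] := lanczos_outputP MT b1 s0 (lanczos_output_ex MT b1 s0).
split => //; set v := lanczos _ _ _ in v1 vP *.
have Kx : krylov (L%:M - A) b n.+1 x.
  have YE : cheb_arg L e A = (e / (2%:R * L) + lambda_min A / L)%:M + L^-1 *: (L%:M - A).
    rewrite /cheb_arg scalerBr scale_scalar_mx mulVf ?gt_eqF // addrA -raddfD /=.
    by congr (_%:M - _); ring.
  by have [] := krylov_chebv b n YE.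
have := vP x (krylov_cap MT b1 Kx); rewrite !quadB !quad_scalar ((enorm1E _).1 v1) mulr1.
move: xL; rewrite /excess => xL h.
have x0 : 0 < dot x x.
  rewrite lt_def dotvv_ge0 andbT; apply/eqP => xx; move: xL.
  have /eqP : dot x x == 0 by rewrite xx.
  rewrite xx mulr0 subr0; move/eqP: xx; rewrite dotvv_eq0 => /eqP ->.
  by rewrite /quad dot0l; lra.
rewrite -(ler_pM2r x0); move: h xL; move: (quad A x) (quad A v) (dot x x) (lambda_min A) => p q r l.
nra.
Qed.

End LanczosSuccess.

(** * The rank-one matrix of a Ritz vector as a limit *)

Section PowerLimit.
Context {R : realType}.

Lemma spectral_power N (Q : 'M[R]_N) d p : orthomx Q ->
  (Q *m diag_mx d *m Q^T) ^+ p = Q *m diag_mx (\row_i d 0 i ^+ p) *m Q^T.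
Proof.
move=> Qo; elim: p => [|p IH].
  rewrite expr0; have -> : (\row_i d 0 i ^+ 0) = const_mx 1.
    by apply/matrixP => i j; rewrite !mxE expr0.
  by rewrite diag_const_mx mulmx1 orthomxC.
rewrite exprS IH -[LHS]/(_ *m _) !mulmxA -(mulmxA _ Q^T Q) Qo mulmx1.
rewrite -(mulmxA Q); congr (Q *m _ *m Q^T).
apply/matrixP => i j; rewrite mul_diag_mx !mxE.
by have [->|] := eqVneq i j; rewrite ?mulr1n ?exprS // !mulr0n mulr0.
Qed.

Lemma spectral_entry N (Q : 'M[R]_N) d i j :
  (Q *m diag_mx d *m Q^T) i j = \sum_k d 0 k * (Q i k * Q j k).
Proof.
rewrite mul_mx_diag mxE; apply: eq_bigr => k _; rewrite !mxE; ring.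
Qed.

Lemma cvg_sumr (I : finType) (u : I -> nat -> R) (l : I -> R) :
  (forall i, u i @ \oo --> l i) -> (fun p => \sum_i u i p) @ \oo --> \sum_i l i.
Proof.
move=> h; apply: cvg_big => //; first exact: add_continuous.
Qed.

(** The power method: if the largest eigenvalue is simple, then normalizing the
powers of a matrix by their trace yields the projection to the eigenvector. *)
Lemma power_limit N (H : 'M[R]_N) (v : 'cV[R]_N) (h : R) : psd H -> 0 < h ->
  enorm v = 1 -> H *m v = h *: v -> (forall x, quad H x <= h * dot x x) ->
  (forall w, H *m w = h *: w -> exists c, w = c *: v) ->
  forall i j, (fun p => (H ^+ p) i j / \tr (H ^+ p)) @ \oo --> (v *m v^T) i j.
Proof.
move=> Hp h0 v1 Hv hP simple i j.
have [Q [d [Qo HE d0]]] := psd_spectral Hp.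
have vv := (enorm1E _).1 v1.
have dh k : d 0 k <= h.
  have := hP (col k Q); rewrite (quad_eigen (eigen_col k Qo HE)).
  by rewrite !((enorm1E _).1 (enorm_col_ortho _ Qo)) !mulr1.
have [k0 dk0] : exists k0, d 0 k0 = h.
  apply: contrapT => nk; have {}dh k : d 0 k < h.
    by rewrite lt_neqAle dh andbT; apply/eqP => e; apply: nk; exists k.
  suff : v = 0 by move=> v0; move: vv; rewrite v0 dot0l => /eqP; rewrite eq_sym oner_eq0.
  have Qv : Q^T *m v = 0.
    have : Q^T *m (H *m v) = h *: (Q^T *m v) by rewrite Hv -scalemxAr.
    rewrite HE !mulmxA Qo mul1mx -mulmxA; move: (Q^T *m v) => w /matrixP e.
    apply/matrixP => k l; have := e k l; rewrite mul_diag_mx !mxE.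
    move=> /eqP; rewrite -subr_eq0 -mulrBl mulf_eq0 subr_eq0 (lt_eqF (dh k)) /=.
    by move=> /eqP.
  by rewrite -[v]mul1mx -(orthomxC Qo) -mulmxA Qv mulmx0.
have [c qc] := simple _ (etrans (eigen_col k0 Qo HE) (congr1 (fun a => a *: _) dk0)).
have qq k : dot (col k Q) (col k Q) = 1 by apply/enorm1E/enorm_col_ortho.
have cc : c ^+ 2 = 1.
  by have := qq k0; rewrite qc dotZl dotZr vv mulr1 expr2.
have dlt k : k != k0 -> d 0 k < h.
  move=> kk; rewrite lt_neqAle dh andbT; apply/eqP => dk.
  have [c' qc'] := simple _ (etrans (eigen_col k Qo HE) (congr1 (fun a => a *: _) dk)).
  have : dot (col k Q) (col k0 Q) = 0 by rewrite dot_col Qo mxE (negPf kk).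
  rewrite qc qc' dotZl dotZr vv mulr1 => /eqP; rewrite mulf_eq0 => /orP[/eqP z|/eqP z].
    by have := qq k; rewrite qc' z scale0r dot0l => /eqP; rewrite eq_sym oner_eq0.
  by move: cc; rewrite z expr0n => /eqP; rewrite eq_sym oner_eq0.
have -> : (v *m v^T) i j = Q i k0 * Q j k0.
  have qE l : Q l k0 = c * v l 0.
    have := congr1 (fun w : 'cV[R]_N => w l 0) qc; by rewrite !mxE.
  rewrite !qE mxE big_ord1 !mxE mulrACA -expr2 cc mul1r.
  by [].
have cv k : (fun p => (d 0 k / h) ^+ p) @ \oo --> ((k == k0)%:R : R).
  have [->|kk] := eqVneq k k0.
    rewrite dk0 divff ?gt_eqF //; under eq_fun do rewrite expr1n; exact: cvg_cst.
  apply: cvg_expr; rewrite ger0_norm ?divr_ge0 ?(ltW h0) //.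
  by rewrite ltr_pdivrMr // mul1r dlt.
have hpow p k : d 0 k ^+ p = h ^+ p * (d 0 k / h) ^+ p.
  by rewrite expr_div_n mulrC divfK // expf_neq0 // gt_eqF.
have trE p : \tr (H ^+ p) = h ^+ p * \sum_k (d 0 k / h) ^+ p.
  rewrite HE (spectral_power d p Qo) mxtrace_mulC mulmxA Qo mul1mx mxtrace_diag mulr_sumr.
  by apply: eq_bigr => k _; rewrite mxE.
have enE p : (H ^+ p) i j = h ^+ p * \sum_k (d 0 k / h) ^+ p * (Q i k * Q j k).
  rewrite HE (spectral_power d p Qo) spectral_entry mulr_sumr.
  by apply: eq_bigr => k _; rewrite mxE hpow -mulrA.
have -> : (fun p => (H ^+ p) i j / \tr (H ^+ p)) = (fun p =>
    (\sum_k (d 0 k / h) ^+ p * (Q i k * Q j k)) * (\sum_k (d 0 k / h) ^+ p)^-1).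
  apply/funext => p; rewrite trE enE invfM mulrACA divff ?mul1r //.
  by rewrite expf_neq0 // gt_eqF.
have -> : Q i k0 * Q j k0 = (\sum_k (k == k0)%:R * (Q i k * Q j k)) * (\sum_k (k == k0)%:R)^-1.
  rewrite (bigD1 k0) //= eqxx mul1r big1 ?addr0; last first.
    by move=> k /negPf ->; rewrite mul0r.
  rewrite (bigD1 k0) //= eqxx big1 ?addr0 ?invr1 ?mulr1 //.
  by move=> k /negPf ->.
apply: cvgM.
  by apply: cvg_sumr => k; apply: cvgM; [exact: cv|exact: cvg_cst].
apply: cvgV; last by apply: cvg_sumr => k; exact: cv.
rewrite (bigD1 k0) //= eqxx big1 ?addr0 ?oner_eq0 //.
by move=> k /negPf ->.
Qed.

End PowerLimit.

Section RitzProjection.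
Context {R : realType}.

Definition krylov_proj N (M : 'M[R]_N) (b : 'cV[R]_N) s : 'M[R]_N :=
  \sum_(j < s) lanczos_vec M b j *m (lanczos_vec M b j)^T.
(** The shift by the identity makes the compression of [M] to the Krylov space
positive definite, so that its largest eigenvalue differs from the eigenvalue
[0] on the orthogonal complement. *)
Definition compressed N (M : 'M[R]_N) (b : 'cV[R]_N) s : 'M[R]_N :=
  krylov_proj M b s *m (M + 1%:M) *m krylov_proj M b s.

Lemma krylov_projE N (M : 'M[R]_N) (b : 'cV[R]_N) s : enorm b = 1 ->
  let B := lanczos_basis M b (lanczos_dim M b s) in krylov_proj M b s = B *m B^T.
Proof.
move=> b1 B; apply/matrixP => i j; rewrite summxE mxE.
have e (k : 'I_s) : (lanczos_vec M b k *m (lanczos_vec M b k)^T) i j =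
    lanczos_vec M b k i 0 * lanczos_vec M b k j 0.
  by rewrite mxE big_ord1 !mxE.
rewrite (eq_bigr _ (fun k _ => e k)).
rewrite [RHS](eq_bigr (fun k : 'I_(lanczos_dim M b s) =>
    lanczos_vec M b k i 0 * lanczos_vec M b k j 0)); last first.
  by move=> k _; rewrite !mxE.
pose F k := lanczos_vec M b k i 0 * lanczos_vec M b k j 0.
rewrite -(big_mkord xpredT F) -(big_mkord xpredT F).
rewrite (big_cat_nat (n := lanczos_dim M b s)) ?lanczos_dim_le //=.
rewrite [X in _ + X]big_nat_cond [X in _ + X]big1 ?addr0 // => k /andP[/andP[dk ks] _].
have : lanczos_vec M b k == 0 by rewrite -[_ == _]negbK (lanczos_dim_spec _ b1 ks) -leqNgt.
by move=> /eqP qk; rewrite /F qk mxE mul0r.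
Qed.

(** The tridiagonal matrix is unreduced, hence its eigenvalues are simple: an
eigenvector is determined by its first entry. *)
Lemma tridiag_simple N (M : 'M[R]_N) (b : 'cV[R]_N) s a (y z : 'cV[R]_(lanczos_dim M b s)) :
  enorm b = 1 -> let T := lanczos_tridiag M b (lanczos_dim M b s) in
  (0 < s)%N -> T *m y = a *: y -> T *m z = a *: z -> y != 0 -> exists c, z = c *: y.
Proof.
move=> b1 T s0; set d := lanczos_dim _ _ _ in y z T *.
have d0 : (0 < d)%N by exact: lanczos_dim_gt0.
have key (x : 'cV[R]_d) : T *m x = a *: x -> x (Ordinal d0) 0 = 0 -> x = 0.
  move=> Tx x0; suff h k (kd : (k < d)%N) : x (Ordinal kd) 0 = 0.
    by apply/matrixP => -[k kd] j; rewrite ord1 mxE h.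
  elim/ltn_ind: k kd => -[|k] IH kd.
    by rewrite (_ : Ordinal kd = Ordinal d0) //; exact: val_inj.
  have kd' : (k < d)%N by exact: ltnW.
  have := congr1 (fun w : 'cV[R]_d => w (Ordinal kd') 0) Tx.
  rewrite [RHS]mxE (IH k) // mulr0 mxE (bigD1 (Ordinal kd)) //= big1; last first.
    move=> [l ld] /=; rewrite -val_eqE /= => lk.
    have [lk'|lk'] := ltnP l k.+1.
      by rewrite IH // mulr0.
    rewrite !mxE -val_eqE /= (ltn_eqF lk') (negPf lk).
    have -> : (k == l.+1) = false.
      by apply/negbTE/eqP => e; move: lk'; rewrite e ltnNge leqW.
    by rewrite mul0r.
  rewrite addr0 !mxE -val_eqE /= eqn_leq ltnn andbF eqxx => /eqP.
  rewrite mulf_eq0 lanczos_beta_eq0 (negPf (lanczos_dim_neq0 b1 kd)) /=.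
  by move=> /eqP.
move=> Ty Tz y0; have y00 : y (Ordinal d0) 0 != 0.
  by apply: contra y0 => /eqP /(key _ Ty) ->.
exists (z (Ordinal d0) 0 / y (Ordinal d0) 0); apply/eqP; rewrite -subr_eq0; apply/eqP.
apply: key; last by rewrite !mxE divfK // subrr.
by rewrite mulmxBr -scalemxAr Ty Tz scalerBr !scalerA (mulrC a).
Qed.

(** The compressed matrix acts as the shifted tridiagonal matrix on the Krylov
space and vanishes on its orthogonal complement, so the Ritz vector spans the
eigenspace of its largest eigenvalue. *)
Lemma ritz_limit N (M : 'M[R]_N) (b : 'cV[R]_N) s : psd M -> enorm b = 1 -> (0 < s)%N ->
  forall i j, (fun p => (compressed M b s ^+ p) i j / \tr (compressed M b s ^+ p)) @ \oo -->
    (lanczos M b s *m (lanczos M b s)^T) i j.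
Proof.
move=> [MT Mp] b1 s0; set v := lanczos M b s.
have [y [y1 Ty vE]] := lanczos_output_ex MT b1 s0; rewrite -/v in vE.
set B := lanczos_basis _ _ _ in vE *; set T := lanczos_tridiag _ _ _ in Ty *.
set th := lambda_max T in Ty *.
have BB : B^T *m B = 1%:M by exact: lanczos_basis_ortho.
have TE : T = B^T *m M *m B by exact: lanczos_tridiagE.
have TT : T^T = T by rewrite TE !trmx_mul MT trmxK mulmxA.
have [_ [_ _ lP]] := lambda_maxP (lanczos_dim_gt0 M b1 s0) TT.
have th0 : 0 <= th.
  have : quad T y = th by rewrite (quad_eigen Ty) ((enorm1E _).1 y1) mulr1.
  by rewrite TE quad_conj => <-.
have HE : compressed M b s = B *m (T + 1%:M) *m B^T.
  rewrite /compressed krylov_projE // -/B TE mulmxDr mulmx1 mulmxDl mulmxDr mulmxDl mulmx1.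
  by rewrite !mulmxA -(mulmxA B B^T B) BB mulmx1.
have HT : (compressed M b s)^T = compressed M b s.
  by rewrite HE !trmx_mul trmxK linearD /= TT trmx1 mulmxA.
have Hq x : quad (compressed M b s) x = quad (T + 1%:M) (B^T *m x).
  by rewrite HE -[X in X *m _ *m _](trmxK B) quad_conj.
have qB x : dot (B^T *m x) (B^T *m x) <= dot x x.
  have := dotvv_ge0 (x - B *m (B^T *m x)).
  have e1 : dot (B *m (B^T *m x)) x = dot (B^T *m x) (B^T *m x) by rewrite dot_mulmxl.
  rewrite !(dotBl, dotBr) (dotC x) e1 (dot_mulmxl B) (mulmxA B^T B) BB mul1mx.
  lra.
apply: (@power_limit _ _ _ _ (th + 1)).
- split => // x; rewrite Hq quadD quad_scalar mul1r addr_ge0 ?dotvv_ge0 //.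
  by rewrite TE quad_conj.
- by rewrite ltr_wpDl.
- by rewrite vE /enorm dot_mulmxl mulmxA BB mul1mx.
- rewrite HE vE -!mulmxA (mulmxA B^T) BB mul1mx mulmxDl mul1mx Ty mulmxDr.
  by rewrite -scalemxAr scalerDl scale1r.
- move=> x; rewrite Hq quadD quad_scalar mul1r.
  apply: (@le_trans _ _ ((th + 1) * dot (B^T *m x) (B^T *m x))).
    by rewrite mulrDl mul1r lerD2r.
  by rewrite ler_wpM2l // addr_ge0.
- move=> w Hw; have th1 : th + 1 != 0 by rewrite gt_eqF // ltr_wpDl.
  pose z := B^T *m w.
  have e : (T + 1%:M) *m z = (th + 1) *: z.
    have := congr1 (mulmx B^T) Hw.
    by rewrite HE -scalemxAr -!mulmxA -/z (mulmxA B^T B) BB mul1mx.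
  have wE : w = B *m z.
    by apply: (scalerI th1); rewrite -Hw HE -!mulmxA -/z e -scalemxAr.
  have Tz : T *m z = th *: z.
    by move: e; rewrite mulmxDl mul1mx scalerDl scale1r => /addIr.
  have y0 : y != 0 by rewrite -enorm_eq0 y1 oner_eq0.
  have [c zc] := tridiag_simple b1 s0 Ty Tz y0.
  by exists c; rewrite wE zc vE scalemxAr.
Qed.

End RitzProjection.

(** * Measurability of matrix-valued functions *)

Section Rounding.
Context {R : realType}.

Lemma mx_cvg_entry m n (u : nat -> 'M[R]_(m, n)) (Z : 'M[R]_(m, n)) :
  (forall k i j, `|u k i j - Z i j| <= k.+1%:R^-1) -> u @ \oo --> Z.
Proof.
move=> h; apply/cvg_ballP => e e0.
near=> k; split => // i j; rewrite /ball /= distrC.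
apply: (le_lt_trans (h k i j)).
near: k; have := @cvg_harmonic R => /cvgrPdist_lt/(_ _ e0).
apply: filterS => k; rewrite sub0r normrN ger0_norm //.
by rewrite /harmonic /= invr_ge0.
Unshelve. all: end_near. Qed.

Definition cell m n (k : nat) (Z : 'M[R]_(m, n)) : 'M[int]_(m, n) :=
  \matrix_(i, j) Num.floor (Z i j * k.+1%:R).

Definition cell_center m n (k : nat) (z : 'M[int]_(m, n)) : 'M[R]_(m, n) :=
  \matrix_(i, j) ((z i j)%:~R / k.+1%:R).

Lemma norm_le_inv (x c : R) : 0 < c -> `|x * c| <= 1 -> `|x| <= c^-1.
Proof. by move=> c0; rewrite normrM (gtr0_norm c0) -ler_pdivlMr // div1r. Qed.

Lemma cell_dist m n k (Z Z' : 'M[R]_(m, n)) i j : cell k Z = cell k Z' ->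
  `|Z i j - Z' i j| <= k.+1%:R^-1.
Proof.
move=> /matrixP/(_ i j); rewrite !mxE => e.
have k0 : 0 < k.+1%:R :> R by rewrite ltr0n.
have := floor_itv (Z i j * k.+1%:R); have := floor_itv (Z' i j * k.+1%:R).
rewrite -e intrD; set z := _%:~R => /andP[a1 a2] /andP[b1 b2].
apply: norm_le_inv => //; rewrite mulrBl ler_norml; apply/andP.
by move: a2 b2; rewrite (_ : 1%:~R = 1) // => a2 b2; split; lra.
Qed.

Lemma cell_center_dist m n k (Z : 'M[R]_(m, n)) i j :
  `|cell_center k (cell k Z) i j - Z i j| <= k.+1%:R^-1.
Proof.
rewrite !mxE; have k0 : 0 < k.+1%:R :> R by rewrite ltr0n.
have := floor_itv (Z i j * k.+1%:R); rewrite intrD; set z := _%:~R => /andP[b1 b2].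
apply: norm_le_inv => //; rewrite mulrBl divfK ?lt0r_neq0 //.
rewrite ler_norml; apply/andP; move: b2; rewrite (_ : 1%:~R = 1) // => b2.
by split; lra.
Qed.

End Rounding.

Section MatrixMeasurable.
Context {R : realType} {d : measure_display} {T : measurableType d}.

Definition mx_measurable m n (X : T -> 'M[R]_(m, n)) :=
  forall i j, measurable_fun setT (fun w => X w i j).

Lemma measurable_invr (g : T -> R) : measurable_fun setT g ->
  measurable_fun setT (fun w => (g w)^-1).
Proof.
move=> mg; have -> : (fun w => (g w)^-1) = (fun w => g w * ((g w ^+ 2) `^ (-1))).
  (* the base of the power is a square, and both sides vanish where g does *)
  apply/funext => w; rewrite powR_inv1 ?sqr_ge0 //.
  have [->|g0] := eqVneq (g w) 0; first by rewrite invr0 mul0r.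
  by rewrite expr2 invfM mulVKf.
apply: measurable_funM => //.
apply: (@measurableT_comp _ _ _ _ _ _ (@powR R ^~ (-1))) => //.
exact: measurable_funX.
Qed.

Lemma measurable_sqrtr (g : T -> R) : measurable_fun setT g ->
  measurable_fun setT (fun w => Num.sqrt (g w)).
Proof.
move=> mg; apply: (@measurableT_comp _ _ _ _ _ _ (@Num.sqrt R)) => //.
by apply: continuous_measurable_fun; exact: sqrt_continuous.
Qed.

Lemma mx_measurable_cst m n (X : 'M[R]_(m, n)) : mx_measurable (fun=> X).
Proof. by move=> i j; exact: measurable_cst. Qed.

Lemma mx_measurableD m n (X Y : T -> 'M[R]_(m, n)) :
  mx_measurable X -> mx_measurable Y -> mx_measurable (fun w => X w + Y w).
Proof.
move=> mX mY i j; under eq_fun do rewrite mxE.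
by apply: measurable_funD; [exact: mX|exact: mY].
Qed.

Lemma mx_measurableZ m n (a : T -> R) (X : T -> 'M[R]_(m, n)) :
  measurable_fun setT a -> mx_measurable X -> mx_measurable (fun w => a w *: X w).
Proof.
move=> ma mX i j; under eq_fun do rewrite mxE.
by apply: measurable_funM => //; exact: mX.
Qed.

Lemma mx_measurableB m n (X Y : T -> 'M[R]_(m, n)) :
  mx_measurable X -> mx_measurable Y -> mx_measurable (fun w => X w - Y w).
Proof.
move=> mX mY i j; under eq_fun do rewrite !mxE.
by apply: measurable_funB; [exact: mX|exact: mY].
Qed.

Lemma mx_measurable_tr m n (X : T -> 'M[R]_(m, n)) :
  mx_measurable X -> mx_measurable (fun w => (X w)^T).
Proof. by move=> mX i j; under eq_fun do rewrite mxE; exact: mX. Qed.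

Lemma mx_measurableM m n p (X : T -> 'M[R]_(m, n)) (Y : T -> 'M[R]_(n, p)) :
  mx_measurable X -> mx_measurable Y -> mx_measurable (fun w => X w *m Y w).
Proof.
move=> mX mY i j; under eq_fun do rewrite mxE.
apply: (@measurable_sum _ _ _ _ _ _ (fun k w => X w i k * Y w k j)) => k.
by apply: measurable_funM; [exact: mX|exact: mY].
Qed.

Lemma mx_measurable_sum (I : Type) (s : seq I) m n (X : I -> T -> 'M[R]_(m, n)) :
  (forall k, mx_measurable (X k)) -> mx_measurable (fun w => \sum_(k <- s) X k w).
Proof.
move=> mX i j; under eq_fun do rewrite summxE.
by apply: (@measurable_sum _ _ _ _ _ _ (fun k w => X k w i j)) => k; exact: mX.
Qed.

Lemma mx_measurable_exp n (X : T -> 'M[R]_n) p :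
  mx_measurable X -> mx_measurable (fun w => X w ^+ p).
Proof.
move=> mX; elim: p => [|p IH].
  under [X in mx_measurable X]eq_fun do rewrite expr0; exact: mx_measurable_cst.
under [X in mx_measurable X]eq_fun do rewrite exprS.
exact: mx_measurableM.
Qed.

Lemma measurable_mxtrace n (X : T -> 'M[R]_n) :
  mx_measurable X -> measurable_fun setT (fun w => \tr (X w)).
Proof.
move=> mX; apply: (@measurable_sum _ _ _ _ _ _ (fun k w => X w k k)) => k.
exact: mX.
Qed.

Lemma measurable_dot n (u v : T -> 'cV[R]_n) : mx_measurable u -> mx_measurable v ->
  measurable_fun setT (fun w => dot (u w) (v w)).
Proof.
by move=> mu mv; apply: (mx_measurableM (mx_measurable_tr mu) mv).
Qed.

Lemma measurable_quad n (A : T -> 'M[R]_n) (v : T -> 'cV[R]_n) :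
  mx_measurable A -> mx_measurable v -> measurable_fun setT (fun w => quad (A w) (v w)).
Proof. by move=> mA mv; apply: measurable_dot => //; exact: mx_measurableM. Qed.

Lemma measurable_enorm n (v : T -> 'cV[R]_n) :
  mx_measurable v -> measurable_fun setT (fun w => enorm (v w)).
Proof. by move=> mv; apply: measurable_sqrtr; exact: measurable_dot. Qed.

Lemma mx_measurable_lim m n (X : nat -> T -> 'M[R]_(m, n)) (Y : T -> 'M[R]_(m, n)) :
  (forall p, mx_measurable (X p)) ->
  (forall w i j, (fun p => X p w i j) @ \oo --> Y w i j) -> mx_measurable Y.
Proof.
move=> mX h i j; apply: (@measurable_fun_cvg _ _ _ _ (fun p w => X p w i j)).
  by move=> p; exact: mX.
by move=> w _; exact: h.
Qed.

Lemma measurable_cell m n k (X : T -> 'M[R]_(m, n)) z :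
  mx_measurable X -> measurable [set w | cell k (X w) = z].
Proof.
move=> mX; have -> : [set w | cell k (X w) = z] =
   \bigcap_(ij : 'I_m * 'I_n) [set w | Num.floor (X w ij.1 ij.2 * k.+1%:R) = z ij.1 ij.2].
  apply/seteqP; split=> w /=.
    by move=> <- ij _ /=; rewrite mxE.
  by move=> h; apply/matrixP => i j; rewrite mxE; exact: (h (i, j)).
apply: fin_bigcap_measurable; first exact: finite_finset.
move=> [i j] _ /=.
have -> : [set w | Num.floor (X w i j * k.+1%:R) = z i j] =
    setT `&` (fun w => X w i j * k.+1%:R) @^-1` `[(z i j)%:~R, (z i j + 1)%:~R[%classic.
  rewrite setTI; apply/seteqP; split=> w /=; rewrite in_itv /=.
    by move=> /eqP; rewrite floor_eq.
  by move=> h; apply/eqP; rewrite floor_eq.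
have mg : measurable_fun setT (fun w => X w i j * k.+1%:R).
  by apply: measurable_funM; [exact: mX|exact: measurable_cst].
by apply: mg => //; exact: measurable_itv.
Qed.

(** A continuous function of measurable entries is the pointwise limit of its
values at the centers of finer and finer countable families of cells. *)
Lemma measurable_continuous_mx m n (f : 'M[R]_(m, n) -> R) (X : T -> 'M[R]_(m, n)) :
  continuous f -> mx_measurable X -> measurable_fun setT (fun w => f (X w)).
Proof.
move=> cf mX.
apply: (@measurable_fun_cvg _ _ _ _ (fun k w => f (cell_center k (cell k (X w))))).
  move=> k _ Y mY; rewrite setTI.
  have -> : (fun w => f (cell_center k (cell k (X w)))) @^-1` Y =
    \bigcup_(z : 'M[int]_(m, n)) (if `[< Y (f (cell_center k z)) >]
        then [set w | cell k (X w) = z] else set0).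
    apply/seteqP; split=> w /=.
      by move=> Yw; exists (cell k (X w)) => //=; case: asboolP.
    by move=> [z _]; case: asboolP => // Yz /= ->.
  apply: countable_bigcupT_measurable; first exact: countableP.
  by move=> z; case: ifP => _ //; exact: measurable_cell.
move=> w _.
have h : (fun k => cell_center k (cell k (X w))) @ \oo --> X w.
  by apply: mx_cvg_entry => k i j; exact: cell_center_dist.
exact: (cvg_comp _ _ h (cf (X w))).
Qed.

Lemma measurable_derive m n (f : 'M[R]_(m, n) -> R) (X : T -> 'M[R]_(m, n)) v :
  (forall Z, differentiable f Z) -> mx_measurable X ->
  measurable_fun setT (fun w => 'D_v f (X w)).
Proof.
move=> df mX; have cf : continuous f by move=> Z; exact: differentiable_continuous.
apply: (@measurable_fun_cvg _ _ _ _ (fun k w => k.+1%:R * (f (k.+1%:R^-1 *: v + X w) - f (X w)))).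
  move=> k; apply: measurable_funM; first exact: measurable_cst.
  apply: measurable_funB; last exact: measurable_continuous_mx.
  apply: (@measurable_continuous_mx _ _ _ (fun w => k.+1%:R^-1 *: v + X w)) => //.
  by apply: mx_measurableD => //; exact: mx_measurable_cst.
by move=> w _; exact: derive_cvg_seq.
Qed.

Lemma mx_measurable_symgrad m n (f : 'M[R]_(m, n) -> R) t (X : T -> 'M[R]_(m + n)) :
  (forall Z, differentiable f Z) -> mx_measurable X ->
  mx_measurable (fun w => symgrad (transformed f t) (X w)).
Proof.
move=> df mX i j; under eq_fun do rewrite mxE derive_transformed.
apply: (@measurable_derive _ _ _ (fun w => ursubmx (t *: X w))) => //.
move=> k l; under eq_fun do rewrite !mxE.
by apply: measurable_funM; [exact: measurable_cst|exact: mX].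
Qed.

(** At a breakdown the recurrence divides by zero, where the total inverse is
measurable as well. *)
Lemma mx_measurable_lanczos_vec N (M : T -> 'M[R]_N) (b : T -> 'cV[R]_N) j :
  mx_measurable M -> mx_measurable b -> mx_measurable (fun w => lanczos_vec (M w) (b w) j).
Proof.
move=> mM mb.
suff [] : [/\ mx_measurable (fun w => lanczos_prev (M w) (b w) j),
  measurable_fun setT (fun w => lanczos_beta (M w) (b w) j) &
  mx_measurable (fun w => lanczos_vec (M w) (b w) j)] by [].
elim: j => [|j [IH1 IH2 IH3]].
  by split => //; exact: mx_measurable_cst.
have mr : mx_measurable (fun w => lanczos_resid (M w) (b w) j).
  apply: mx_measurableB; last exact: mx_measurableZ.
  apply: mx_measurableB; first exact: mx_measurableM.
  by apply: mx_measurableZ => //; exact: measurable_quad.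
split.
- by under [X in mx_measurable X]eq_fun do rewrite lanczos_prevS.
- by under eq_fun do rewrite lanczos_betaS; exact: measurable_enorm.
- under [X in mx_measurable X]eq_fun do rewrite lanczos_vecS.
  by apply: mx_measurableZ => //; apply: measurable_invr; exact: measurable_enorm.
Qed.

(** The sign of a Ritz vector is an arbitrary choice, but its rank-one matrix is
a measurable function of the data. *)
Lemma mx_measurable_lanczos N (M : T -> 'M[R]_N) (b : T -> 'cV[R]_N) s : (0 < s)%N ->
  (forall w, psd (M w)) -> (forall w, enorm (b w) = 1) ->
  mx_measurable M -> mx_measurable b ->
  mx_measurable (fun w => lanczos (M w) (b w) s *m (lanczos (M w) (b w) s)^T).
Proof.
move=> s0 Mp b1 mM mb.
have mK : mx_measurable (fun w => krylov_proj (M w) (b w) s).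
  apply: mx_measurable_sum => j; apply: mx_measurableM.
    exact: mx_measurable_lanczos_vec.
  by apply: mx_measurable_tr; exact: mx_measurable_lanczos_vec.
have mH : mx_measurable (fun w => compressed (M w) (b w) s).
  apply: mx_measurableM => //; apply: mx_measurableM => //.
  by apply: mx_measurableD => //; exact: mx_measurable_cst.
apply: (@mx_measurable_lim _ _ (fun p w =>
  (\tr (compressed (M w) (b w) s ^+ p))^-1 *: compressed (M w) (b w) s ^+ p)).
  move=> p; apply: mx_measurableZ; last exact: mx_measurable_exp.
  by apply: measurable_invr; apply: measurable_mxtrace; exact: mx_measurable_exp.
move=> w i j; under eq_fun do rewrite mxE mulrC.
exact: ritz_limit.
Qed.

End MatrixMeasurable.

(** * Continuity in the gradient matrix *)

Section Continuity.
Context {R : realType}.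

Definition mx_cvg m n (A : nat -> 'M[R]_(m, n)) (B : 'M[R]_(m, n)) :=
  forall i j, (fun k => A k i j) @ \oo --> B i j.

Lemma mx_cvg_cst m n (A : 'M[R]_(m, n)) : mx_cvg (fun=> A) A.
Proof. by move=> i j; exact: cvg_cst. Qed.

Lemma mx_cvgD m n (A A' : nat -> 'M[R]_(m, n)) B B' :
  mx_cvg A B -> mx_cvg A' B' -> mx_cvg (fun k => A k + A' k) (B + B').
Proof. by move=> h h' i j; under eq_fun do rewrite mxE; rewrite mxE; exact: cvgD. Qed.

Lemma mx_cvgB m n (A A' : nat -> 'M[R]_(m, n)) B B' :
  mx_cvg A B -> mx_cvg A' B' -> mx_cvg (fun k => A k - A' k) (B - B').
Proof. by move=> h h' i j; under eq_fun do rewrite !mxE; rewrite !mxE; exact: cvgB. Qed.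

Lemma mx_cvgM m n p (A : nat -> 'M[R]_(m, n)) (A' : nat -> 'M[R]_(n, p)) B B' :
  mx_cvg A B -> mx_cvg A' B' -> mx_cvg (fun k => A k *m A' k) (B *m B').
Proof.
move=> h h' i j; under eq_fun do rewrite mxE; rewrite mxE.
apply: (cvg_sumr (u := fun l k => A k i l * A' k l j)) => l.
exact: cvgM.
Qed.

Lemma mx_cvg_tr m n (A : nat -> 'M[R]_(m, n)) B : mx_cvg A B -> mx_cvg (fun k => (A k)^T) B^T.
Proof. by move=> h i j; under eq_fun do rewrite mxE; rewrite mxE; exact: h. Qed.

Lemma cvg_dot n (u v : nat -> 'cV[R]_n) x y : mx_cvg u x -> mx_cvg v y ->
  (fun k => dot (u k) (v k)) @ \oo --> dot x y.
Proof. by move=> h h'; exact: (mx_cvgM (mx_cvg_tr h) h'). Qed.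

Lemma cvg_chebv N (Y : nat -> 'M[R]_N) Z b n : mx_cvg Y Z ->
  mx_cvg (fun k => (chebv (Y k) b n).1) (chebv Z b n).1.
Proof.
move=> h; suff [] : mx_cvg (fun k => (chebv (Y k) b n).1) (chebv Z b n).1 /\
  mx_cvg (fun k => (chebv (Y k) b n).2) (chebv Z b n).2 by [].
elim: n => [|n [IH1 IH2]]; first by split; exact: mx_cvg_cst.
rewrite chebvS; split.
- under [X in mx_cvg X _]eq_fun do rewrite chebvS.
  apply: mx_cvgD; first exact: mx_cvgM.
  by apply: mx_cvgB => //; apply: mx_cvgM => //; exact: mx_cvgM.
- under [X in mx_cvg X _]eq_fun do rewrite chebvS.
  by apply: mx_cvgD => //; exact: mx_cvgM.
Qed.

Lemma quad_le_sum N (A : 'M[R]_N) v : enorm v = 1 -> quad A v <= \sum_i \sum_j `|A i j|.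
Proof.
move=> /enorm1E v1; have vi i : `|v i 0| <= 1.
  rewrite -(@ler_pXn2r _ 2) ?nnegrE // expr1n -normrX ger0_norm ?sqr_ge0 //.
  by rewrite -v1 dotE (bigD1 i) //= expr2 lerDl sumr_ge0 // => j _; rewrite -expr2 sqr_ge0.
rewrite /quad dotE; apply: ler_sum => i _; rewrite mxE mulr_sumr; apply: ler_sum => j _.
apply: (le_trans (ler_norm _)); rewrite !normrM mulrCA -[leRHS]mulr1.
by rewrite ler_wpM2l // mulr_ile1.
Qed.

(** Test the form of [A] on a minimal eigenvector of [B]. *)
Lemma lambda_min_le N (A B : 'M[R]_N) : (0 < N)%N -> A^T = A -> B^T = B ->
  lambda_min A <= lambda_min B + \sum_i \sum_j `|(A - B) i j|.
Proof.
move=> N0 AT BT; have [_ [_ _ lA]] := lambda_minP N0 AT.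
have [u [u1 Bu _]] := lambda_minP N0 BT.
have := lA u; rewrite ((enorm1E _).1 u1) mulr1 => /le_trans; apply.
have -> : quad A u = quad B u + quad (A - B) u by rewrite quadB addrC subrK.
by rewrite (quad_eigen Bu) ((enorm1E _).1 u1) mulr1 lerD2l quad_le_sum.
Qed.

Lemma cvg_lambda_min N (A : nat -> 'M[R]_N) B : (0 < N)%N -> (forall k, (A k)^T = A k) ->
  B^T = B -> mx_cvg A B -> (fun k => lambda_min (A k)) @ \oo --> lambda_min B.
Proof.
move=> N0 AT BT h; pose D k := \sum_i \sum_j `|(A k - B) i j|.
have D0 : D @ \oo --> 0.
  rewrite (_ : 0 = \sum_(i < N) \sum_(j < N) (0 : R)); last first.
    by rewrite big1 // => i _; rewrite big1.
  apply: (cvg_sumr (u := fun i k => \sum_j `|(A k - B) i j|)) => i.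
  apply: (cvg_sumr (u := fun j k => `|(A k - B) i j|)) => j.
  rewrite -[X in _ --> X](normr0 R); apply: cvg_norm.
  by under eq_fun do rewrite !mxE; rewrite -(subrr (B i j)); apply: cvgB => //; exact: cvg_cst.
apply: (@squeeze_cvgr _ _ _ _ (fun k => lambda_min B - D k) (fun k => lambda_min B + D k)).
- apply: nearW => k; rewrite lambda_min_le // andbT lerBlDr.
  apply: (le_trans (lambda_min_le N0 BT (AT k))); rewrite lerD2l.
  by apply: ler_sum => i _; apply: ler_sum => j _; rewrite -normrN !mxE opprB.
- by rewrite -[X in _ --> X]subr0; apply: cvgB => //; exact: cvg_cst.
- by rewrite -[X in _ --> X]addr0; apply: cvgD => //; exact: cvg_cst.
Qed.

Lemma cvg_excess N (A : nat -> 'M[R]_N) B L e b n : (0 < N)%N ->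
  (forall k, (A k)^T = A k) -> B^T = B -> mx_cvg A B ->
  (fun k => excess e (A k) (chebv (cheb_arg L e (A k)) b n).1) @ \oo -->
  excess e B (chebv (cheb_arg L e B) b n).1.
Proof.
move=> N0 AT BT h; have hl := cvg_lambda_min N0 AT BT h.
have hx : mx_cvg (fun k => (chebv (cheb_arg L e (A k)) b n).1) (chebv (cheb_arg L e B) b n).1.
  apply: cvg_chebv; apply: mx_cvgB; last first.
    by move=> i j; under eq_fun do rewrite mxE; rewrite mxE; apply: cvgM => //; exact: cvg_cst.
  move=> i j; under eq_fun do rewrite mxE; rewrite mxE.
  apply: cvgMn; apply: cvgD; first exact: cvg_cst.
  by apply: cvgM => //; exact: cvg_cst.
apply: cvgB; first by apply: cvg_dot => //; exact: mx_cvgM.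
apply: cvgM; last exact: cvg_dot.
by apply: cvgD => //; exact: cvg_cst.
Qed.

End Continuity.

(** * Anticoncentration on the sphere *)

Section AntiConcentration.
Context {R : realType}.

Lemma dot_continuous N (u : 'cV[R]_N) : continuous (fun x : 'cV[R]_N => dot x u).
Proof.
move=> x; have -> : (fun x : 'cV[R]_N => dot x u) = (fun x => \sum_i x i 0 * u i 0).
  by apply/funext => y; rewrite dotE.
have h i : (fun y : 'cV[R]_N => y i 0 * u i 0) y @[y --> x] --> x i 0 * u i 0.
  apply: (cvgM (f := fun y : 'cV[R]_N => y i 0) (g := fun=> u i 0)).
  - exact: (nbhs_filter x).
  - exact: coord_continuous.
  - by apply: cvg_cst; exact: (nbhs_filter x).
apply: cvg_big => //; first exact: add_continuous.
exact: (nbhs_filter x).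
Qed.

Definition strip N (u : 'cV[R]_N) (eta : R) : set 'cV[R]_N := [set x | `|dot x u| < eta].

Lemma strip_borel N (u : 'cV[R]_N) eta : borel (strip u eta).
Proof.
apply: sub_sigma_algebra => /=.
have -> : strip u eta = (fun x => `|dot x u|) @^-1` [set y | y < eta] by [].
apply: open_comp; last exact: open_lt.
move=> x _; apply: (@cvg_norm _ _ _ (nbhs x)); exact: dot_continuous.
Qed.

Definition grid_vec N M (t : {ffun 'I_N -> 'I_M}) : 'cV[R]_N := \col_i (t i).+1%:R.
Definition grid_dir N M (t : {ffun 'I_N -> 'I_M}) : 'cV[R]_N :=
  (enorm (grid_vec t))^-1 *: grid_vec t.

Lemma grid_vec_le N M (t : {ffun 'I_N -> 'I_M}) :
  dot (grid_vec t) (grid_vec t) <= M%:R ^+ 2 * N%:R.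
Proof.
have -> : M%:R ^+ 2 * N%:R = \sum_(i < N) M%:R ^+ 2 :> R.
  by rewrite sumr_const card_ord mulr_natr.
rewrite dotE; apply: ler_sum => i _; rewrite !mxE -expr2.
by rewrite lerXn2r ?nnegrE // ler_nat.
Qed.

(** A unit vector has a coordinate of absolute value at least [1 / sqrt N];
moving that coordinate of the grid direction leaves the strip. *)
Lemma strip_count N M (x : 'cV[R]_N) : (0 < N)%N -> (0 < M)%N -> enorm x = 1 ->
  (#|[set t : {ffun 'I_N -> 'I_M} |
      (`|dot x (grid_dir t)| < (2 * M * N)%:R^-1)%R]%SET| * M <= #|{ffun 'I_N -> 'I_M}|)%N.
Proof.
move=> N0 M0 x1; set eta : R := _^-1; set S := finset _.
have N0' : 0 < N%:R :> R by rewrite ltr0n.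
have M0' : 0 < M%:R :> R by rewrite ltr0n.
have [i xi] : exists i, N%:R^-1 <= x i 0 ^+ 2.
  apply: contrapT => nex; have lt i : x i 0 ^+ 2 < N%:R^-1.
    by rewrite ltNge; apply/negP => h; apply: nex; exists i.
  have := (enorm1E _).1 x1; rewrite dotE => e.
  have : (1 : R) < 1; last by rewrite ltxx.
  rewrite -{1}e (_ : 1 = \sum_(i < N) N%:R^-1); last first.
    by rewrite sumr_const card_ord -[RHS]mulr_natl divff ?gt_eqF.
  apply: ltr_sum; last by move=> j _; rewrite -expr2.
  by apply/hasP; exists (Ordinal N0); rewrite ?mem_index_enum.
have Sin t : t \in S -> dot x (grid_vec t) ^+ 2 < (4%:R * N%:R)^-1.
  rewrite inE => tS; have v0 : grid_vec t != 0.
    apply/eqP => /matrixP/(_ (Ordinal N0) 0); rewrite !mxE => /eqP.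
    by rewrite pnatr_eq0.
  have e0 : 0 < enorm (grid_vec t) by rewrite lt_def enorm_eq0 v0 enorm_ge0.
  have -> : grid_vec t = enorm (grid_vec t) *: grid_dir t.
    by rewrite scalerA divff ?scale1r // gt_eqF.
  rewrite dotZr exprMn -[dot x _ ^+ 2]ger0_norm ?sqr_ge0 // normrX enorm_sqr.
  have vl := grid_vec_le t.
  have : `|dot x (grid_dir t)| ^+ 2 < eta ^+ 2.
     by rewrite ltrXn2r ?nnegrE // ltW // invr_gt0 ltr0n !muln_gt0 M0 N0.
  set a := _ ^+ 2; move=> ae.
  apply: (@le_lt_trans _ _ (M%:R ^+ 2 * N%:R * a)).
    by rewrite ler_wpM2r // exprn_ge0.
  have -> : (4%:R * N%:R)^-1 = M%:R ^+ 2 * N%:R * eta ^+ 2.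
    by rewrite /eta !natrM; field; rewrite !gt_eqF.
  by rewrite ltr_pM2l // mulr_gt0 // exprn_gt0.
pose F (ta : {ffun 'I_N -> 'I_M} * 'I_M) : {ffun 'I_N -> 'I_M} :=
  [ffun j => if j == i then ta.2 else ta.1 j].
rewrite -[X in (_ * X <= _)%N]card_ord -cardsT -cardsX.
rewrite -(card_in_imset (f := F)); first exact: max_card.
move=> [t a] [t' a'] /setXP[tS _] /setXP[t'S _] /ffunP e.
have ea : a = a' by have := e i; rewrite !ffunE eqxx.
have et j : j != i -> t j = t' j by move=> ji; have := e j; rewrite !ffunE (negPf ji).
rewrite ea; congr (_, _); apply/ffunP => j.
have [->|] := eqVneq j i; last exact: et.
apply: contrapT => /eqP ti.
have dE : dot x (grid_vec t) - dot x (grid_vec t') = x i 0 * ((t i)%:R - (t' i)%:R).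
  rewrite -dotBr dotE (bigD1 i) //= big1 ?addr0 => [|j' ji]; rewrite !mxE.
    by congr (_ * _); rewrite -!natr1; ring.
  by rewrite et // subrr mulr0.
have d1 : 1 <= ((t i)%:R - (t' i)%:R) ^+ 2 :> R.
  have : (t i != t' i :> nat) by [].
  rewrite neq_ltn => /orP[]; rewrite -(ler_nat R) -natr1 => h.
    rewrite -(opprB (t' i)%:R) sqrrN; rewrite -[leLHS](expr1n _ 2) lerXn2r ?nnegrE //; lra.
  by rewrite -[leLHS](expr1n _ 2) lerXn2r ?nnegrE //; lra.
have : N%:R^-1 <= (dot x (grid_vec t) - dot x (grid_vec t')) ^+ 2.
  by rewrite dE exprMn -[leLHS]mulr1 ler_pM // invr_ge0 ltW.
have := Sin _ tS; have := Sin _ t'S; rewrite invfM.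
have : 0 < N%:R^-1 :> R by rewrite invr_gt0.
move: (dot x _) (dot x _) (N%:R^-1) => p q r; nra.
Qed.

Context {d : measure_display} {T : measurableType d} (P : probability T R).

Lemma strip_invariant N (b : T -> 'cV[R]_N) (u v : 'cV[R]_N) eta :
  (forall (Q : 'M[R]_N) B, Q^T *m Q = 1%:M -> borel B ->
     P [set w | B (Q *m b w)] = P (b @^-1` B)) ->
  enorm u = 1 -> enorm v = 1 -> P (b @^-1` strip u eta) = P (b @^-1` strip v eta).
Proof.
move=> inv u1 v1; have [Q [Qo QT Qu]] := householder u1 v1.
rewrite -(inv Q _ Qo (strip_borel v eta)); congr (P _); apply/seteqP.
have e w : dot (Q *m b w) v = dot (b w) u.
  by rewrite dot_mulmxl QT -Qu mulmxA -{1}QT Qo mul1mx.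
by split=> w; rewrite /strip /= e.
Qed.

(** All strips have the same probability, and a unit vector lies in a fraction
of at most [1 / M] of the strips around the grid directions. *)
Lemma strip_prob N (b : T -> 'cV[R]_N) (u : 'cV[R]_N) M : (0 < M)%N ->
  (forall B, borel B -> measurable (b @^-1` B)) -> (forall w, enorm (b w) = 1) ->
  (forall (Q : 'M[R]_N) B, Q^T *m Q = 1%:M -> borel B ->
     P [set w | B (Q *m b w)] = P (b @^-1` B)) ->
  enorm u = 1 ->
  (P (b @^-1` strip u (2 * M * N)%:R^-1) <= (M%:R^-1)%:E)%E.
Proof.
move=> M0 mb b1 inv u1; have N0 := unit_dim_gt0 u1.
set eta : R := _^-1; pose G : finType := {ffun 'I_N -> 'I_M}.
have g1 (t : G) : enorm (grid_dir t) = 1.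
  apply: enorm_normalize; apply/eqP => /matrixP/(_ (Ordinal N0) 0); rewrite !mxE => /eqP.
  by rewrite pnatr_eq0.
pose S (t : G) := b @^-1` strip (grid_dir t) eta.
have mS t : measurable (S t) by apply: mb; exact: strip_borel.
have G0 : (0 < #|G|)%N by rewrite card_ffun !card_ord expn_gt0 M0.
pose c : R := #|G|%:R / M%:R.
have key : ((\int[P]_w (\sum_(t : G) (\1_(S t) w)%:E)) <= c%:E)%E.
  apply: (@le_trans _ _ (\int[P]_w (cst c%:E w))%E).
    apply: ge0_le_integral => //.
    - by move=> w _; apply: sume_ge0 => t _; rewrite lee_fin.
    - apply: emeasurable_sum => t; apply/measurable_EFinP; exact: measurable_indic.
    move=> w _; rewrite sumEFin lee_fin /c ler_pdivlMr ?ltr0n //.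
    have := strip_count N0 M0 (b1 w); rewrite -(ler_nat R) natrM; apply: le_trans.
    rewrite ler_wpM2r // -sum1_card natr_sum [leRHS]big_mkcond /=.
    apply: ler_sum => t _; rewrite indicE inE.
    case: ifPn => [_|h]; first by case: (_ \in _).
    suff -> : (w \in S t) = false by [].
    by apply/negbTE; apply: contra h; rewrite !inE.
  have P1 : P setT = 1%E by exact: probability_setT.
  by rewrite integral_cst // [X in (_ * X)%E]P1 mule1.
have Se t : P (S t) = P (b @^-1` strip u eta) by exact: strip_invariant.
move: key; rewrite ge0_integral_sum //; last first.
  by move=> t; apply/measurable_EFinP; exact: measurable_indic.
have Ie t : (\int[P]_x (\1_(S t) x)%:E = P (b @^-1` strip u eta))%E.
  by rewrite -(Se t) integral_indic // setIT.
rewrite (eq_bigr _ (fun t _ => Ie t)).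
have mu : measurable (b @^-1` strip u eta) by apply: mb; exact: strip_borel.
have : P (b @^-1` strip u eta) \is a fin_num by exact: fin_num_measure.
move=> /fineK <-; rewrite sumEFin !lee_fin sumr_const -[fine _ *+ _]mulr_natl.
rewrite /c ler_pM2l ?ltr0n //.
Qed.

End AntiConcentration.

(** * Independence from the past *)

Section Independence.
Context {R : realType} {d : measure_display} {T : measurableType d}.
Context (P : probability T R) {N : nat} (b : nat -> T -> 'cV[R]_N).
Hypothesis rs : random_starts P b.

Lemma borelT : borel [set: 'cV[R]_N].
Proof. by apply: sub_sigma_algebra => /=; exact: openT. Qed.

Lemma borelI (A B : set 'cV[R]_N) : borel A -> borel B -> borel (A `&` B).
Proof.
exact: (@measurableI _ (g_sigma_algebraType [set U : set 'cV[R]_N | open U])).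
Qed.

Lemma mem_iota0 k j : [set` iota 0 k] j = is_true (j < k)%N.
Proof. by rewrite -[LHS]/(is_true (j \in iota 0 k)) mem_iota. Qed.

(** A generating system, closed under intersection, of the events decided by the
first [k] start vectors. *)
Definition history k : set (set T) := [set H | exists B : nat -> set 'cV[R]_N,
  (forall j, borel (B j)) /\ H = \bigcap_(j in [set` iota 0 k]) (b j @^-1` B j)].

Lemma history_setI k : setI_closed (history k).
Proof.
move=> _ _ [B [mB ->]] [B' [mB' ->]]; exists (fun j => B j `&` B' j).
by split=> [j|]; [exact: borelI|rewrite -bigcapI].
Qed.

Lemma history_measurable k H : history k H -> measurable H.
Proof.
have [mb _ _ _] := rs; move=> [B [mB ->]]; apply: bigcap_measurableType.
by move=> j _; exact: mb.
Qed.

Lemma history_indep k H B : history k H -> borel B ->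
  P (H `&` b k @^-1` B) = (P H * P (b k @^-1` B))%E.
Proof.
have [_ _ _ ind] := rs; move=> [C [mC ->]] mB.
pose D j := if j == k then B else C j.
have mD j : borel (D j) by rewrite /D; case: eqP.
have Dk j : j \in iota 0 k -> D j = C j.
  by rewrite mem_iota /D add0n => /andP[_ jk]; rewrite ltn_eqF.
have -> : \bigcap_(j in [set` iota 0 k]) (b j @^-1` C j) `&` b k @^-1` B =
    \bigcap_(j in [set` iota 0 k.+1]) (b j @^-1` D j).
  apply/seteqP; split=> w.
    move=> [h1 h2] j; rewrite mem_iota0 ltnS leq_eqVlt /D => /predU1P[->|jk].
      by rewrite eqxx.
    by rewrite ltn_eqF //; apply: h1; rewrite mem_iota0.
  move=> h; split.
    move=> j jk; rewrite -(Dk j jk); apply: h; rewrite mem_iota0 ltnS ltnW //.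
    by rewrite -mem_iota0.
  by have := h k; rewrite /D eqxx; apply; rewrite mem_iota0.
rewrite (ind (iota 0 k.+1)) ?iota_uniq // -addn1 iotaD big_cat big_seq1 add0n /=.
rewrite {2}/D eqxx; congr (_ * _)%E.
rewrite (ind (iota 0 k)) ?iota_uniq //; rewrite big_seq [RHS]big_seq.
by apply: eq_bigr => j jk; rewrite Dk.
Qed.

(** The events independent of the [k]-th start vector form a lambda-system. *)
Lemma history_sigma_indep k H B : <<s history k >> H -> borel B ->
  measurable H /\ P (H `&` b k @^-1` B) = (P H * P (b k @^-1` B))%E.
Proof.
move=> sH mB; have [mb _ _ _] := rs.
set E := b k @^-1` B; have mE : measurable E by exact: mb.
have P1 : P setT = 1%E by exact: probability_setT.
pose Ind := [set H | measurable H /\ P (H `&` E) = (P H * P E)%E].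
suff h : <<s history k >> `<=` Ind by exact: h.
apply: lambda_system_subset => //; first exact: history_setI.
- split => //.
  + by split=> //; rewrite setTI P1 mul1e.
  + move=> A A' A'A [mA eA] [mA' eA']; split; first exact: measurableD.
    have -> : (A `\` A') `&` E = (A `&` E) `\` (A' `&` E).
      apply/seteqP; split=> w /=; first by move=> [[? h] ?]; split => // -[].
      by move=> [[? ?] h]; split => //; split => // ?; apply: h.
    have fin X : measurable X -> P X \is a fin_num by move=> mX; exact: fin_num_measure.
    have PD X Y : measurable X -> measurable Y -> Y `<=` X -> P (X `\` Y) = (P X - P Y)%E.
      move=> mX mY YX; rewrite -{2}(setIidr YX); apply: measureD => //.
      by rewrite ltey_eq fin.
    rewrite PD // ?PD //; [|exact: measurableI|exact: measurableI|exact: setSI].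
    by rewrite eA eA' -muleBl // ?fin // fin_num_adde_defr // fin.
  + move=> F ndF hF; split; first by apply: bigcupT_measurable => n; exact: (hF n).1.
    rewrite setI_bigcupl.
    have ndFE : nondecreasing_seq (fun n => F n `&` E).
      by move=> m n mn; apply/subsetPset; apply: setSI; apply/subsetPset; exact: ndF.
    have c1 : (P \o (fun n => F n `&` E)) @ \oo --> P (\bigcup_n (F n `&` E)).
      apply: nondecreasing_cvg_mu => //.
      - by move=> n; apply: measurableI => //; exact: (hF n).1.
      - by apply: bigcupT_measurable => n; apply: measurableI => //; exact: (hF n).1.
    have c2 : (P \o F) @ \oo --> P (\bigcup_n F n).
      apply: nondecreasing_cvg_mu => //.
      - by move=> n; exact: (hF n).1.
      - by apply: bigcupT_measurable => n; exact: (hF n).1.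
    have c3 : (fun n => (P (F n) * P E)%E) @ \oo --> (P (\bigcup_n F n) * P E)%E.
      by apply: cvgeZr => //; exact: fin_num_measure.
    have e : (P \o (fun n => F n `&` E)) = (fun n => (P (F n) * P E)%E).
      by apply/funext => n /=; exact: (hF n).2.
    rewrite e in c1; exact: (cvg_unique _ c1 c3).
- move=> A hA; split; first exact: history_measurable hA.
  exact: history_indep.
Qed.

End Independence.

Lemma cvg_harmonic_bound {R : realType} (u : nat -> R) l :
  (forall k, `|u k - l| <= k.+1%:R^-1) -> u @ \oo --> l.
Proof.
move=> h; apply/cvgrPdist_le => e e0; near=> k; rewrite distrC.
apply: (le_trans (h k)).
near: k; have := @cvg_harmonic R => /cvgrPdist_le/(_ _ e0).
apply: filterS => k; rewrite sub0r normrN ger0_norm //.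
by rewrite /harmonic /= invr_ge0.
Unshelve. all: end_near. Qed.

Section FailureEvent.
Context {R : realType} {d : measure_display} {T : measurableType d}.
Context (P : probability T R) {N : nat} (b : nat -> T -> 'cV[R]_N).
Hypothesis rs : random_starts P b.

(** The matrix [A] handed to the [k]-th call depends on the first [k] start
vectors only. Were it to take countably many values, independence would apply to
each value separately; in general [A] is approximated by representatives of
finer and finer countable partitions, and failure, which is an open condition
on [A], is inherited by all fine approximations. *)
Lemma failure_event k (A : g_sigma_algebraType (history b k) -> 'M[R]_N)
   (g : 'M[R]_N -> 'cV[R]_N -> R) (L eta : R) (del : R) :
  mx_measurable A -> 0 < L ->
  (forall w, exists u, enorm u = 1 /\ forall x, enorm x = 1 ->
     eta <= `|dot x u| -> g (A w) x <= - (2%:R * L)) ->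
  (forall u, enorm u = 1 -> (P (b k @^-1` strip u eta) <= del%:E)%E) ->
  (forall x w (v : nat -> T), mx_cvg (fun n => A (v n)) (A w) ->
     (fun n => g (A (v n)) x) @ \oo --> g (A w) x) ->
  exists E : set T, [/\ measurable E, (P E <= del%:E)%E &
    forall w, ~ E w -> g (A w) (b k w) <= - L].
Proof.
move=> mA L0 good sp cont; have [mb b1 _ _] := rs.
pose w0 : T := point; have [u0 [u01 _]] := good w0.
have del0 : 0 <= del by rewrite -lee_fin; apply: le_trans (sp u0 u01).
have [U Uspec] : exists U : nat -> 'M[int]_N -> 'cV[R]_N, forall n z,
    enorm (U n z) = 1 /\ forall w, cell n (A w) = z ->
     exists2 w', cell n (A w') = z & forall x, enorm x = 1 ->
     eta <= `|dot x (U n z)| -> g (A w') x <= - (2%:R * L).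
  have ex (nz : nat * 'M[int]_N) : exists u : 'cV[R]_N, enorm u = 1 /\
     forall w, cell nz.1 (A w) = nz.2 ->
     exists2 w', cell nz.1 (A w') = nz.2 & forall x, enorm x = 1 ->
     eta <= `|dot x u| -> g (A w') x <= - (2%:R * L).
    have [[w' w'z]|nw] := pselect (exists w', cell nz.1 (A w') = nz.2).
      have [u [u1 uP]] := good w'; exists u; split => // w _; by exists w'.
    by exists u0; split => // w wz; case: nw; exists w.
  have [U UP] := choice ex; exists (fun n z => U (n, z)) => n z; exact: (UP (n, z)).
pose C n z : set T := [set w | cell n (A w) = z].
(* [pickle_inv] enumerates the cells without repetition, whence disjointness. *)
pose D n i : set T := if @pickle_inv 'M[int]_N i is Some z then C n z else set0.
pose F n i : set T := if @pickle_inv 'M[int]_N i is Some z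
  then C n z `&` b k @^-1` strip (U n z) eta else set0.
pose Bad n := \bigcup_i F n i.
have sC n z : <<s history b k >> (C n z).
  exact: (@measurable_cell _ _ (g_sigma_algebraType (history b k)) _ _ n A z mA).
have mC n z : measurable (C n z).
  by have [] := history_sigma_indep rs (sC n z) (@borelT R N).
have mF n i : measurable (F n i).
  rewrite /F; case: pickle_inv => // z; apply: measurableI => //.
  by apply: mb; exact: strip_borel.
have mD n i : measurable (D n i) by rewrite /D; case: pickle_inv.
have mBad n : measurable (Bad n) by apply: bigcupT_measurable => i; exact: mF.
have PF n i : (P (F n i) <= del%:E * P (D n i))%E.
  rewrite /F /D; case: pickle_inv => [z|]; last by rewrite measure0 mule0.
  have [_ ->] := history_sigma_indep rs (sC n z) (strip_borel (U n z) eta).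
  by rewrite muleC lee_wpmul2r // sp //; have [] := Uspec n z.
have tD n : trivIset setT (D n).
  move=> i j _ _ [w []]; rewrite /D.
  have := @pickle_invK 'M[int]_N i; have := @pickle_invK 'M[int]_N j.
  case: pickle_inv => //= z <-; case: pickle_inv => //= z' <-.
  by rewrite /C /= => -> ->.
have PBad n : (P (Bad n) <= del%:E)%E.
  apply: (le_trans (measure_sigma_subadditive P (mF n) (mBad n) (@subset_refl _ _))).
  apply: (@le_trans _ _ (\sum_(0 <= i <oo) (del%:E * P (D n i)))%E).
    by apply: lee_nneseries => i *; [exact: measure_ge0|exact: PF].
  rewrite nneseriesZl //; have mU : measurable (\bigcup_i D n i).
    by apply: bigcupT_measurable => i; exact: mD.
  rewrite -(measure_semi_bigcup P (mD n) (tD n) mU) -[leRHS]mule1.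
  by rewrite lee_wpmul2l ?lee_fin // probability_le1.
pose I m := \bigcap_(n in [set n | (m <= n)%N]) Bad n.
have mI m : measurable (I m) by apply: bigcap_measurableType => n _; exact: mBad.
exists (\bigcup_m I m); split.
- by apply: bigcupT_measurable.
- have ndI : nondecreasing_seq I.
    move=> m n mn; apply/subsetPset => w Iw j /= nj; apply: Iw => /=; exact: leq_trans nj.
  have c := nondecreasing_cvg_mu (mu := P) mI (bigcupT_measurable _ mI) ndI.
  rewrite -(cvg_lim _ c) //; apply: lime_le; first by apply/cvg_ex; eexists; exact: c.
  apply: nearW => m /=; apply: (le_trans _ (PBad m)).
  by apply: le_measure; rewrite ?inE //; apply: bigcap_inf => /=.
move=> w nE; rewrite leNgt; apply/negP => gL; apply: nE.
have rep n : exists w', cell n (A w') = cell n (A w) /\ forall x, enorm x = 1 ->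
     eta <= `|dot x (U n (cell n (A w)))| -> g (A w') x <= - (2%:R * L).
  by have [_ /(_ w erefl) [w' e h]] := Uspec n (cell n (A w)); exists w'.
have [v vP] := choice rep.
have cv : mx_cvg (fun n => A (v n)) (A w).
  move=> i j; apply: cvg_harmonic_bound => n; apply: cell_dist.
  by have [] := vP n.
have /cvgr_gt/(_ _ gL) [m _ mP] := cont (b k w) w v cv.
exists m => // n /= mn; exists (pickle (cell n (A w))) => //.
rewrite /F pickleK_inv; split => //; rewrite /preimage /strip /= ltNge; apply/negP => ge.
have [_ /(_ _ (b1 k w) ge) le2] := vP n.
have := mP n mn; rewrite /= ltNge; apply/negP; rewrite negbK.
by apply: (le_trans le2); rewrite lerN2 ler_peMl ?ler1n // ltW.
Qed.

End FailureEvent.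

(** * The number of Lanczos steps *)

Section StepCount.
Context {R : realType}.

Lemma bernoulli_ge (x : R) n : 0 <= x -> 1 + n%:R * x <= (1 + x) ^+ n.
Proof.
move=> x0; elim: n => [|n IH]; first by rewrite mul0r addr0 expr0.
rewrite exprS -natr1; apply: (@le_trans _ _ ((1 + x) * (1 + n%:R * x))).
  have : 0 <= n%:R * x * x by rewrite !mulr_ge0.
  by rewrite mulrDl mul1r mulrDr mulr1; move: (n%:R) => y; nra.
by rewrite ler_wpM2l // addr_ge0.
Qed.

Variables (C L : R) (a : nat).

(** Recovers the index of a call from its accuracy [e = 2 C / (k + 2)]: its value
is [k + 3]. *)
Definition call_index (e : R) : nat := (Num.truncn (2%:R * C / e)).+1.

(** The inverse of the probability with which the call of index [q] may fail; the
square makes these probabilities summable. *)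
Definition failure_inv (N q : nat) : nat := (N ^ a * q ^ 2)%N.

(** How large the Chebyshev polynomial must be to make up for the smallest
component of the start vector that is not counted as a failure. *)
Definition amplification (N q : nat) : nat :=
  (2 * (Num.truncn (L / C)).+1 * q * (4 * failure_inv N q * N) ^ 2)%N.

(** Each block of [sqrt (L / e)] degrees doubles the lower bound
[(1 + sqrt (e / L))^n] on the amplification. *)
Definition cheb_degree (N : nat) (e : R) : nat :=
  ((Num.truncn (Num.sqrt (L / e))).+1 * up_log 2 (amplification N (call_index e)))%N.

Definition solver_steps (N : nat) (e : R) : nat := minn N (cheb_degree N e).+1.

Hypotheses (C_gt0 : 0 < C) (L_gt0 : 0 < L).

Lemma stepsize_gt0 k : 0 < (stepsize k : R).
Proof. by rewrite /stepsize divr_gt0 ?ltr0n. Qed.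

Lemma call_index_stepsize k : call_index (stepsize k * C) = k.+3.
Proof.
have C0 := C_gt0; rewrite /call_index /stepsize.
have -> : 2%:R * C / (2%:R / k.+2%:R * C) = k.+2%:R.
  by field; rewrite !gt_eqF ?ltr0n.
by rewrite natrK.
Qed.

Lemma cheb_degree_amplifies N k (p : R) : (0 < N)%N ->
  let e := stepsize k * C in
  (2 * failure_inv N k.+3 * N)%:R^-1 <= `|p| ->
  2%:R * L - e * (cheb (1 + e / (2%:R * L)) (cheb_degree N e)).1 ^+ 2 * p ^+ 2 <= - (2%:R * L).
Proof.
have C0 := C_gt0; have L0 := L_gt0.
move=> N0 e; set M := failure_inv _ _ => pe.
have M0 : (0 < M)%N by rewrite /M /failure_inv muln_gt0 !expn_gt0 N0.
have e0 : 0 < e by rewrite mulr_gt0 // stepsize_gt0.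
rewrite /cheb_degree call_index_stepsize.
set g := (Num.truncn _).+1; set n := amplification _ _; set r := up_log _ _.
have nr : (n <= 2 ^ r)%N by exact: up_logP.
pose x : R := Num.sqrt (e / L); have eL : 0 < e / L by rewrite divr_gt0.
have x0 : 0 < x by rewrite sqrtr_gt0.
have gx : 1 <= g%:R * x.
  have /andP[_ /ltW h] := truncn_itv (sqrtr_ge0 (L / e)).
  apply: (@le_trans _ _ (Num.sqrt (L / e) * x)); last by rewrite ler_wpM2r // ltW.
  rewrite /x -sqrtrM; last by rewrite divr_ge0 ?ltW.
  have -> : L / e * (e / L) = 1 by field; rewrite !gt_eqF.
  by rewrite sqrtr1.
have e2 : 2%:R * (e / (2%:R * L)) = e / L by field; rewrite gt_eqF.
have g0 : 0 <= e / (2%:R * L) by rewrite divr_ge0 ?mulr_ge0 // ltW.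
have := cheb_growth (g * r) g0; rewrite e2 -/x; set t := (cheb _ _).1 => tz.
have nt : n%:R <= 2%:R * t.
  apply: (le_trans _ tz); rewrite exprM.
  apply: (@le_trans _ _ (2%:R ^+ r)); first by rewrite -natrX ler_nat.
  rewrite lerXn2r ?nnegrE ?exprn_ge0 ?addr_ge0 ?(ltW x0) //.
  by apply: (le_trans _ (bernoulli_ge g (ltW x0))); lra.
pose MN : R := (M * N)%:R; have MN0 : 0 < MN by rewrite ltr0n muln_gt0 M0.
set c0 := (Num.truncn (L / C)).+1%:R : R.
have c0L : L <= c0 * C.
  by rewrite -ler_pdivrMr //; have /andP[_ /ltW] := truncn_itv (divr_ge0 (ltW L0) (ltW C0)).
have nE : n%:R = 32%:R * c0 * k.+3%:R * MN ^+ 2.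
  by rewrite /n /amplification -/M /c0 /MN !(natrM, natrX); ring.
have q0 : 0 < k.+3%:R :> R by rewrite ltr0n.
have c00 : 0 < c0 by rewrite ltr0n.
have n1 : 1 <= n%:R :> R.
  by rewrite ler1n /n /amplification /failure_inv !(muln_gt0, expn_gt0) N0.
have t2 : n%:R / 4%:R <= t ^+ 2.
  by rewrite ler_pdivrMr //; nra.
have p2 : (4%:R * MN ^+ 2)^-1 <= p ^+ 2.
  rewrite -[p ^+ 2]ger0_norm ?sqr_ge0 // normrX.
  have -> : (4%:R * MN ^+ 2)^-1 = ((2 * M * N)%:R^-1) ^+ 2.
    rewrite exprVn; congr (_^-1); have -> : (2 * M * N)%:R = 2%:R * MN by rewrite /MN -natrM mulnA.
    by move: (MN) => y; ring.
  by rewrite lerXn2r ?nnegrE // invr_ge0.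
have eq : 2%:R * C <= e * k.+3%:R.
  have -> : e * k.+3%:R = 2%:R * C * (k.+3%:R / k.+2%:R).
    by rewrite /e /stepsize; field; rewrite gt_eqF ?ltr0n.
  rewrite ler_peMr //; first by rewrite mulr_ge0 // ltW.
  by rewrite ler_pdivlMr ?ltr0n // mul1r ler_nat.
have : 4%:R * L <= e * t ^+ 2 * p ^+ 2; last by lra.
apply: (@le_trans _ _ (e * (n%:R / 4%:R) * (4%:R * MN ^+ 2)^-1)); last first.
  apply: ler_pM => //.
  - by rewrite mulr_ge0 ?ltW // divr_gt0 // (lt_le_trans _ n1).
  - by rewrite invr_ge0 mulr_ge0 // exprn_ge0 // ltW.
  - by rewrite ler_wpM2l // ltW.
have -> : e * (n%:R / 4%:R) * (4%:R * MN ^+ 2)^-1 = 2%:R * c0 * (e * k.+3%:R).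
  rewrite nE; move: (MN) MN0 (e) (c0) (k.+3%:R) => y y0 e' c' q'.
  by field; rewrite gt_eqF.
nra.
Qed.

Lemma ln_ge_half N : (1 < N)%N -> 1 <= 2%:R * ln (N%:R : R).
Proof.
move=> N1; have h2 : 1 <= 2%:R * ln (2%:R : R).
  have := @le_ln1Dx R (- 2%:R^-1); rewrite (_ : 1 - 2%:R^-1 = 2%:R^-1); last by field.
  rewrite lnV ?posrE // => /(_ _) h; have : - ln 2%:R <= - 2%:R^-1 :> R by apply: h; lra.
  by lra.
apply: (le_trans h2); rewrite ler_pM2l // ler_ln ?posrE ?ltr0n ?(ltn_trans _ N1) //.
by rewrite ler_nat.
Qed.

(** Below [N ^ 2] calls the logarithm of the index of the call is of order
[ln N]; beyond, the cap [N] is itself at most the square root of that index. *)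
Lemma solver_steps_le : exists B : R, 0 < B /\ forall N k, (1 < N)%N ->
  (solver_steps N (stepsize k * C))%:R <= B * Num.sqrt k.+3%:R * ln N%:R.
Proof.
have C0 := C_gt0; have L0 := L_gt0.
pose c0 := (Num.truncn (L / C)).+1; pose mu := up_log 2 (32 * c0).
pose W : R := (mu + 2 * a + 12)%:R.
pose S := Num.sqrt (L / C).
exists (4%:R * (S + 1) * W + 2%:R).
have S0 : 0 <= S by exact: sqrtr_ge0.
have W0 : 0 <= W by rewrite /W.
split; first by rewrite ltr_wpDl // !mulr_ge0 // addr_ge0.
move=> N k N1; have l1 := ln_ge_half N1.
set l := ln _ in l1 *; set x := Num.sqrt _.
have x1 : 1 <= x by rewrite -[leLHS]sqrtr1 ler_wsqrtr // ler1n.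
have lx : 1 <= 2%:R * l * x by rewrite -[leLHS]mulr1 ler_pM.
have [qN|qN] := leqP k.+3 (N ^ 2); last first.
  have Nx : N%:R <= x.
    rewrite -[leLHS]ger0_norm // -sqrtr_sqr ler_wsqrtr // -natrX ler_nat; exact: ltnW.
  apply: (@le_trans _ _ N%:R); first by rewrite ler_nat geq_minl.
  apply: (le_trans Nx); rewrite -[leLHS]mul1r -!mulrA.
  rewrite mulrDl [x * l]mulrC [2%:R * (l * x)]mulrA.
  have : 0 <= 4%:R * (S + 1) * W * (l * x).
    by rewrite !mulr_ge0 // ?addr_ge0 //; lra.
  have : x <= 2%:R * l * x by rewrite -[leLHS]mul1r ler_wpM2r //; lra.
  lra.
pose lam := up_log 2 N.
have lamP : (N <= 2 ^ lam)%N by exact: up_logP.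
have lam_l : lam%:R <= 4%:R * l.
  have /andP[h _] := up_log_bounds (isT : (1 < 2)%N) N1; rewrite -/lam in h.
  have : ln ((2 ^ lam.-1)%:R : R) <= l.
    by rewrite ler_ln ?posrE ?ltr0n ?expn_gt0 ?(ltn_trans _ N1) // ler_nat ltnW.
  rewrite natrX lnXn ?posrE // => h1.
  have h2 := @ln_ge_half 2 isT.
  have h3 : lam.-1%:R <= 2%:R * l.
    apply: (@le_trans _ _ (2%:R * (ln 2%:R *+ lam.-1))); last by rewrite ler_pM2l.
    by rewrite -[ln _ *+ _]mulr_natr mulrA -[leLHS]mul1r ler_wpM2r.
  have : lam%:R <= lam.-1%:R + 1 :> R by rewrite natr1 ler_nat leqSpred.
  by lra.
have lam1 : (0 < lam)%N by rewrite /lam up_log_gt0 // .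
have rW : (up_log 2 (amplification N k.+3))%:R <= W * (4%:R * l).
  have nle : (amplification N k.+3 <= 2 ^ (mu + lam * (2 * a + 12)))%N.
    have -> : amplification N k.+3 = (32 * c0 * (k.+3 ^ 5 * N ^ (2 * a + 2)))%N.
      rewrite /amplification /failure_inv -/c0 expnD (mulnC 2 a) expnM.
      by move: (N ^ a)%N => Na; rewrite !expnS !expn0; ring.
    rewrite (expnD 2 mu); apply: leq_mul; first exact: up_logP.
    apply: (@leq_trans (N ^ (2 * a + 12))).
      rewrite (_ : (2 * a + 12 = 2 * 5 + (2 * a + 2))%N); last by rewrite addnCA.
      by rewrite (expnD N (2 * 5)); apply: leq_mul => //; rewrite expnM leq_exp2r.
    by rewrite expnM leq_exp2r // addn_gt0 orbT.
  apply: (@le_trans _ _ (mu + lam * (2 * a + 12))%:R).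
    by rewrite ler_nat up_log_min.
  apply: (@le_trans _ _ (W * lam%:R)); last by rewrite ler_wpM2l.
  rewrite /W -natrM ler_nat -addnA mulnDl [(_ * lam)%N]mulnC [X in (_ + X)%N]mulnC.
  by rewrite leq_add2r leq_pmull.
have gS : (Num.truncn (Num.sqrt (L / (stepsize k * C)))).+1%:R <= (S + 1) * x.
  rewrite -natr1; have /andP[h _] := truncn_itv (sqrtr_ge0 (L / (stepsize k * C))).
  apply: (@le_trans _ _ (Num.sqrt (L / (stepsize k * C)) + 1)); first by rewrite lerD2r.
  have LC0 : 0 <= L / C by rewrite divr_ge0 // ltW.
  rewrite mulrDl mul1r lerD // /S /x -(sqrtrM _ LC0) ler_wsqrtr //.
  have -> : L / (stepsize k * C) = L / C * (k.+2%:R / 2%:R).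
    by rewrite /stepsize; field; rewrite !gt_eqF ?ltr0n.
  rewrite ler_wpM2l // ler_pdivrMr // mulr_natr.
  by apply: (@le_trans _ _ k.+3%:R); rewrite ?ler_nat // mulr2n lerDl.
apply: (@le_trans _ _ ((cheb_degree N (stepsize k * C)).+1%:R)).
  by rewrite ler_nat geq_minr.
rewrite -natr1 /cheb_degree call_index_stepsize natrM.
apply: (@le_trans _ _ ((S + 1) * x * (W * (4%:R * l)) + 2%:R * l * x)).
  by apply: lerD => //; apply: ler_pM.
rewrite le_eqVlt; apply/orP; left; apply/eqP; ring.
Qed.

End StepCount.

(** * Success of the randomized run *)

Section RandomizedRun.
Context {R : realType} {d : measure_display} {T : measurableType d}.
Context (P : probability T R) {m n : nat} (b : nat -> T -> 'cV[R]_(m + n)).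
Context (f : 'M[R]_(m, n) -> R) (t C L : R) (a : nat) (v0 : 'cV[R]_(m + n)).
Hypotheses (rs : random_starts P b) (pf : problem f t C L) (C_gt0 : 0 < C) (L_gt0 : 0 < L).
Hypothesis v01 : enorm v0 = 1.

Let F := transformed f t.
Let ev (w : T) := lanczos_ev L (solver_steps C L a) (fun k => b k w).
Let iterate k (w : T) := hazan F C (ev w) v0 k.

Lemma history_mono k : history b k `<=` history b k.+1.
Proof.
move=> _ [B [mB ->]]; exists (fun j => if j == k then setT else B j); split.
  by move=> j; case: eqP => _ //; exact: borelT.
apply/seteqP; split=> w h j.
  rewrite mem_iota0 ltnS leq_eqVlt => /predU1P[->|jk]; first by rewrite eqxx.
  by rewrite ltn_eqF //; apply: h; rewrite mem_iota0.
by rewrite mem_iota0 => jk; have := h j; rewrite ltn_eqF //; apply; rewrite mem_iota0 ltnW.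
Qed.

Lemma history_last k B : borel B -> history b k.+1 (b k @^-1` B).
Proof.
move=> mB; exists (fun j => if j == k then B else setT); split.
  by move=> j; case: eqP => _ //; exact: borelT.
apply/seteqP; split=> w h.
  by move=> j; case: eqP => // ->.
by have := h k; rewrite eqxx; apply; rewrite mem_iota0.
Qed.

Lemma mx_measurable_history k p q (X : T -> 'M[R]_(p, q)) :
  mx_measurable (X : g_sigma_algebraType (history b k) -> _) ->
  mx_measurable (X : g_sigma_algebraType (history b k.+1) -> _).
Proof.
move=> mX i j _ Y mY; have := mX i j measurableT Y mY.
by apply: sub_sigma_algebra2; exact: history_mono.
Qed.

Lemma mx_measurable_start k :
  mx_measurable (b k : g_sigma_algebraType (history b k.+1) -> _).
Proof.
move=> i j; apply: (measurability _ (RGenOInfty.measurableE R)).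
move=> _ [_ [x ->] <-]; rewrite setTI; apply: sub_sigma_algebra.
have -> : (fun w => b k w i j) @^-1` `]x, +oo[%classic =
    b k @^-1` [set v : 'cV[R]_(m + n) | x < v i j].
  by apply/seteqP; split=> w /=; rewrite in_itv /= andbT.
apply: history_last; apply: sub_sigma_algebra => /=.
have -> : [set v : 'cV[R]_(m + n) | x < v i j] =
    (fun v : 'cV[R]_(m + n) => v i j) @^-1` [set y | x < y] by [].
apply: open_comp; last exact: open_gt.
by move=> v _; exact: coord_continuous.
Qed.

Lemma solver_steps_gt0 e : (0 < solver_steps C L a (m + n) e)%N.
Proof. by rewrite /solver_steps leq_min (unit_dim_gt0 v01). Qed.

Lemma iterate_spectahedron k w : spectahedron (iterate k w).
Proof.
have [_ b1 _ _] := rs; apply: hazan_spectahedron => // j _ /=.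
by apply: lanczos_unit; [exact: symgrad_sym|exact: b1|exact: solver_steps_gt0].
Qed.

Lemma iterate_norm k w : spectral_norm (symgrad F (iterate k w)) <= L.
Proof. by have [_ _ _ _] := pf; apply; exact: iterate_spectahedron. Qed.

Lemma psd_shift (A : 'M[R]_(m + n)) : A^T = A -> spectral_norm A <= L -> psd (L%:M - A).
Proof.
move=> AT AL; split; first by rewrite linearB /= tr_scalar_mx AT.
move=> v; rewrite quadB quad_scalar subr_ge0.
apply: (le_trans (ler_norm _)); apply: (le_trans (quad_spectral_norm A v)).
by rewrite ler_wpM2r // dotvv_ge0.
Qed.

Lemma mx_measurable_iterate k :
  mx_measurable (iterate k : g_sigma_algebraType (history b k) -> _) /\
  mx_measurable (fun w : g_sigma_algebraType (history b k) => symgrad F (iterate k w)).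
Proof.
have [_ df _ _ _] := pf; have [_ b1 _ _] := rs.
suff h : mx_measurable (iterate k : g_sigma_algebraType (history b k) -> _).
  by split => //; exact: mx_measurable_symgrad.
elim: k => [|k IH]; first exact: mx_measurable_cst.
have IH' := mx_measurable_history IH.
pose TS := g_sigma_algebraType (history b k.+1).
pose v w := lanczos (L%:M - symgrad F (iterate k w)) (b k w)
  (solver_steps C L a (m + n) (stepsize k * C)).
have mv : mx_measurable (fun w : TS => v w *m (v w)^T).
  apply: (@mx_measurable_lanczos _ _ TS _ (fun w => L%:M - symgrad F (iterate k w)) (b k)).
  - exact: solver_steps_gt0.
  - by move=> w; apply: psd_shift; [exact: symgrad_sym|exact: iterate_norm].
  - by move=> w; exact: b1.
  - apply: mx_measurableB; first exact: mx_measurable_cst.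
    exact: mx_measurable_symgrad.
  - exact: mx_measurable_start.
apply: (@mx_measurableD _ _ TS _ _ (iterate k)
  (fun w => stepsize k *: (v w *m (v w)^T - iterate k w))) => //.
apply: mx_measurableZ; first exact: measurable_cst.
exact: mx_measurableB.
Qed.

Lemma failure_inv_gt0 k : (0 < failure_inv a (m + n) k.+3)%N.
Proof. by rewrite /failure_inv muln_gt0 !expn_gt0 (unit_dim_gt0 v01). Qed.

(** The matrix of the [k]-th call is decided by the first [k] start vectors, of
which the start vector of that call is independent. *)
Lemma call_success_event k : exists E : set T,
  [/\ measurable E, (P E <= ((failure_inv a (m + n) k.+3)%:R^-1)%:E)%E &
   forall w, ~ E w -> let A := symgrad F (iterate k w) in
     approxEV_spec A (stepsize k * C) (ev w k A (stepsize k * C))].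
Proof.
have N0 := unit_dim_gt0 v01; have [mb b1 inv _] := rs.
set e := stepsize k * C; have e0 : 0 < e by rewrite mulr_gt0 // stepsize_gt0.
set M := failure_inv _ _ _; have M0 : (0 < M)%N by exact: failure_inv_gt0.
pose D := cheb_degree C L a (m + n) e.
have sT w : (symgrad F (iterate k w))^T = symgrad F (iterate k w) by exact: symgrad_sym.
pose A (w : g_sigma_algebraType (history b k)) := symgrad F (iterate k w).
pose g (B : 'M[R]_(m + n)) x := excess e B (chebv (cheb_arg L e B) x D).1.
have good w : exists u, enorm u = 1 /\ forall x, enorm x = 1 ->
    (2 * M * (m + n))%:R^-1 <= `|dot x u| -> g (A w) x <= - (2%:R * L).
  have [u [u1 uP]] := cheb_filter N0 L_gt0 e0 (sT w) (iterate_norm k w).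
  exists u; split => // x x1 ex; apply: (le_trans (uP x D x1)).
  by apply: cheb_degree_amplifies => //; rewrite dotC.
have sp u : enorm u = 1 ->
    (P (b k @^-1` strip u (2 * M * (m + n))%:R^-1) <= (M%:R^-1)%:E)%E.
  by apply: strip_prob => //; [exact: mb|exact: inv].
have cont x w (v : nat -> T) : mx_cvg (fun j => A (v j)) (A w) ->
    (fun j => g (A (v j)) x) @ \oo --> g (A w) x.
  by apply: cvg_excess => //; move=> *; exact: sT.
have [E [mE PE hE]] :=
  failure_event rs (proj2 (mx_measurable_iterate k)) L_gt0 good sp cont.
exists E; split => // w nE B; apply: lanczos_approxEV => //; first exact: sT.
exact: hE.
Qed.

(** By comparison with the telescoping series of [1 / ((k + 1) (k + 2))]. *)
Lemma sum_inv_sqr K : \sum_(k < K) (k.+3%:R ^+ 2)^-1 <= 1 - K.+1%:R^-1 :> R.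
Proof.
elim: K => [|K IH]; first by rewrite big_ord0 invr1 subrr.
rewrite big_ord_recr /=; apply: (le_trans (lerD IH (lexx _))).
have x0 : 0 < K.+1%:R :> R by rewrite ltr0n.
rewrite -[K.+3]addn2 -[K.+2]addn1 !natrD; move: (K.+1%:R) x0 => x x0.
rewrite -subr_ge0; have -> : 1 - (x + 1)^-1 - (1 - x^-1 + ((x + 2%:R) ^+ 2)^-1) =
   (3%:R * x + 4%:R) / (x * (x + 1) * (x + 2%:R) ^+ 2).
  by field; rewrite !gt_eqF //; lra.
by rewrite divr_ge0 ?mulr_ge0 ?exprn_ge0 //; lra.
Qed.

(** Union bound over the calls; the failure probabilities are summable. *)
Lemma run_success_event K : exists E : set T,
  [/\ measurable E, ((1 - (m + n)%:R ^- a)%:E <= P E)%E &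
   forall w, E w -> calls_succeed F C (ev w) v0 K].
Proof.
have [E EP] := choice call_success_event.
have mE k : measurable (E k) by have [] := EP k.
pose U := \big[setU/set0]_(k < K) E k.
have mU : measurable U by apply: bigsetU_measurable.
have PU : (P U <= ((m + n)%:R ^- a)%:E)%E.
  apply: (le_trans (Boole_inequality P (fun i _ => mE i))).
  apply: (@le_trans _ _ (\sum_(k < K) ((failure_inv a (m + n) k.+3)%:R^-1)%:E)%E).
    by apply: lee_sum => k _; have [] := EP k.
  rewrite sumEFin lee_fin.
  apply: (@le_trans _ _ ((m + n)%:R ^- a * \sum_(k < K) (k.+3%:R ^+ 2)^-1)).
    rewrite mulr_sumr le_eqVlt; apply/orP; left; apply/eqP; apply: eq_bigr => k _.
    by rewrite /failure_inv natrM !natrX invfM.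
  rewrite -[leRHS]mulr1 ler_wpM2l ?invr_ge0 ?exprn_ge0 //.
  by apply: (le_trans (sum_inv_sqr K)); rewrite gerBl invr_ge0.
exists (~` U); split.
- exact: measurableC.
- rewrite probability_setC // EFinB leeB //.
- move=> w nU j jK; have [_ _ /(_ w)] := EP j; apply => Ej; apply: nU.
  by rewrite /U -bigcup_mkord; exists j.
Qed.

End RandomizedRun.

(** * Counting operations *)

Section OperationCount.
Context {R : realType}.

Lemma num_entries_small m n (f : 'M[R]_(m, n) -> R) : (m + n <= 1)%N -> num_entries f = 0%N.
Proof.
move=> mn; apply/eqP; rewrite -leqn0; apply: (leq_trans (max_card _)).
by rewrite card_prod !card_ord leqn0 muln_eq0; case: m mn {f} => [|[|m]] //; case: n.
Qed.

Lemma total_ops_le N C (steps : nat -> R -> nat) cstep cupd K (x : R) :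
  (forall k j, (cstep k j)%:R <= x) -> (forall k, (cupd k)%:R <= x) ->
  (total_ops N C steps cstep cupd K)%:R <=
    x * (1 + K%:R + \sum_(k < K) (steps N (stepsize k * C))%:R).
Proof.
move=> hs hu; rewrite /total_ops natrD natr_sum.
have -> : x * (1 + K%:R + \sum_(k < K) (steps N (stepsize k * C))%:R) =
    x + \sum_(k < K) (x * (steps N (stepsize k * C))%:R + x).
  by rewrite big_split /= -mulr_sumr sumr_const card_ord -mulr_natr; ring.
apply: lerD => //; apply: ler_sum => k _; rewrite natrD; apply: lerD => //.
rewrite natr_sum; apply: (@le_trans _ _ (\sum_(j < steps N (stepsize k * C)) x)).
  by apply: ler_sum.
by rewrite sumr_const card_ord mulr_natr.
Qed.

Lemma powR32 (e : R) : 0 < e -> e `^ (3%:R / 2%:R) = e * Num.sqrt e.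
Proof.
move=> e0; have -> : 3%:R / 2%:R = 1 + 2%:R^-1 :> R by field.
rewrite powRD; last by rewrite gt_eqF ?implybT // implybT.
by rewrite powRr1 ?ltW // powR12_sqrt // ltW.
Qed.

(** Each of the [K] terms is at most [B * sqrt (K + 2) * l], and [K + 2] is at
most [Q / eps]. *)
Lemma sum_steps_bound (s : nat -> R) (B l c eps eps0 : R) :
  0 < B -> 1 <= 2%:R * l -> 0 < c -> 0 < eps -> eps <= eps0 ->
  (forall k, s k <= B * Num.sqrt k.+3%:R * l) ->
  forall Q, Q = c + 3%:R * eps0 ->
  1 + (iterations c eps)%:R + \sum_(k < iterations c eps) s k <=
    (B + 2%:R) * (Q * Num.sqrt Q) * l / (eps * Num.sqrt eps).
Proof.
move=> B0 l1 c0 e0 ee sB Q QE; set K := iterations c eps.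
have l0 : 0 < l by lra.
have Q0 : 0 < Q by rewrite QE; lra.
have KQ : K%:R + 2%:R <= Q / eps.
  rewrite /K /iterations -natr1.
  have /andP[h _] := truncn_itv (divr_ge0 (ltW c0) (ltW e0)).
  have : 3%:R <= 3%:R * eps0 / eps by rewrite ler_pdivlMr //; lra.
  by rewrite QE mulrDl; lra.
pose y : R := Num.sqrt (K%:R + 2%:R).
have y1 : 1 <= y by rewrite -[leLHS]sqrtr1 ler_wsqrtr //; have : 0 <= K%:R :> R by []; lra.
have sumle : \sum_(k < K) s k <= K%:R * (B * y * l).
  apply: (@le_trans _ _ (\sum_(k < K) (B * y * l))); last first.
    by rewrite sumr_const card_ord mulr_natl.
  apply: ler_sum => k _; apply: (le_trans (sB k)).
  rewrite ler_wpM2r ?(ltW l0) // ler_wpM2l ?(ltW B0) // ler_wsqrtr //.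
  by rewrite -natrD ler_nat addn2; exact: (ltn_ord k).
have ly : 1 <= 2%:R * l * y by rewrite -[leLHS]mulr1 ler_pM.
have K0 : 0 <= K%:R :> R by [].
apply: (@le_trans _ _ ((K%:R + 2%:R) * y * ((B + 2%:R) * l))).
  apply: (@le_trans _ _ ((1 + K%:R) * (2%:R * l * y) + K%:R * (B * y * l))).
    by apply: lerD => //; rewrite ler_peMr // addr_ge0.
  rewrite -subr_ge0.
  have -> : (K%:R + 2%:R) * y * ((B + 2%:R) * l) -
     ((1 + K%:R) * (2%:R * l * y) + K%:R * (B * y * l)) = 2%:R * y * l * (B + 1) by ring.
  by rewrite !mulr_ge0 //; lra.
have yQ : y <= Num.sqrt Q / Num.sqrt eps.
  by rewrite -sqrtrV ?(ltW e0) // -sqrtrM ?(ltW Q0) // ler_wsqrtr.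
have -> : (B + 2%:R) * (Q * Num.sqrt Q) * l / (eps * Num.sqrt eps) =
   Q / eps * (Num.sqrt Q / Num.sqrt eps) * ((B + 2%:R) * l).
  by field; rewrite !gt_eqF // sqrtr_gt0.
rewrite ler_wpM2r //; first by rewrite mulr_ge0 //; lra.
by apply: ler_pM => //; lra.
Qed.

End OperationCount.

Theorem corollary32 (R : realType) (C L : R) (C_gt0 : 0 < C) (L_gt0 : 0 < L) :
  exists c : R, 0 < c /\
  (* iterations: any eigenvector routine whose calls meet their specification *)
  (forall (m n : nat) (f : 'M[R]_(m, n) -> R) (t : R), problem f t C L ->
   forall (eps : R), 0 < eps ->
   forall (ev : ev_routine (m + n)) (v0 : 'cV[R]_(m + n)) (k : nat),
     enorm v0 = 1 -> (iterations c eps <= k)%N ->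
     calls_succeed (transformed f t) C ev v0 k ->
     eps_optimal f t eps (nnr_solver f t C ev v0 k)) /\
  (* operations: the Lanczos implementation, with high probability *)
  (forall a : nat, exists steps : nat -> R -> nat,
   forall kappa eps0 : R, 0 < kappa -> 0 < eps0 -> exists (c' : R) (p : nat), 0 < c' /\
   forall (m n : nat) (f : 'M[R]_(m, n) -> R) (t : R), problem f t C L ->
   forall (eps : R), 0 < eps ->
   forall (d : measure_display) (T : measurableType d) (P : probability T R)
     (b : nat -> T -> 'cV[R]_(m + n)), random_starts P b ->
   forall (v0 : 'cV[R]_(m + n)), enorm v0 = 1 ->
   forall (cstep : nat -> nat -> nat) (cupd : nat -> nat),
     (forall k j, (cstep k j)%:R <= kappa * (num_entries f)%:R) ->
     (forall k, (cupd k)%:R <= kappa * (num_entries f)%:R) ->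
   let K := iterations c eps in
   let ev := fun w : T => lanczos_ev L steps (fun k => b k w) in
   exists E : set T,
     [/\ measurable E,
         ((1 - (m + n)%:R ^- a)%:E <= P E)%E,
         forall w, E w ->
           calls_succeed (transformed f t) C (ev w) v0 K /\
           eps_optimal f t eps (nnr_solver f t C (ev w) v0 K) &
         eps <= eps0 ->
           (total_ops (m + n) C steps cstep cupd K)%:R <=
           c' * ln (m + n)%:R ^+ p
           * ((num_entries f)%:R / eps `^ (3%:R / 2%:R))]).
Proof.
have c0 : 0 < 8%:R * C by rewrite mulr_gt0.
exists (8%:R * C); split=> //; split.
  by move=> m n f t pf eps e0 ev v0 k v01 Kk cs; exact: (@solver_eps_optimal _ _ _ _ _ _ L).
move=> a; exists (solver_steps C L a) => kappa eps0 kappa0 eps00.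
have [B [B0 BP]] := solver_steps_le a C_gt0 L_gt0.
pose Q := 8%:R * C + 3%:R * eps0; have Q0 : 0 < Q by rewrite addr_gt0 // mulr_gt0.
exists (kappa * ((B + 2%:R) * (Q * Num.sqrt Q))), 1%N; split.
  by rewrite !mulr_gt0 ?sqrtr_gt0 // addr_gt0.
move=> m n f t pf eps e0 d T P b rs v0 v01 cstep cupd hs hu K ev.
have [E [mE PE EP]] := run_success_event a rs pf C_gt0 L_gt0 v01 K.
exists E; split => //.
  move=> w Ew; split; first exact: EP.
  apply: (@solver_eps_optimal _ _ _ _ _ _ L) => //; exact: EP.
move=> ee; apply: (le_trans (total_ops_le _ _ _ _ hs hu)).
(* In dimension 1 the logarithm vanishes, but then so does N_f. *)
have [mn1|mn1] := leqP (m + n) 1.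
  by rewrite num_entries_small // mulr0 mul0r mul0r mulr0.
have l1 := @ln_ge_half R _ mn1.
have := sum_steps_bound B0 l1 c0 e0 ee (fun k => BP (m + n)%N k mn1) (erefl Q).
rewrite -/K expr1 powR32 // => /(ler_wpM2l _) h.
apply: (le_trans (h (kappa * (num_entries f)%:R) _)); first by rewrite mulr_ge0 // ltW.
by rewrite le_eqVlt; apply/orP; left; apply/eqP; rewrite !invfM; ring.
Qed.
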